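(* Let $d\ge1$ and $d'=2\lfloor d/2\rfloor$. Let $\mu,\nu$ be probability measures on $\mathbb{R}^d$ supported on a set of diameter $1$, and assume that for some $I>0$, $|S_\lambda(\mu,\nu)-W_2^2(\mu,\nu)|\le\lambda^2I$ for all $\lambda\ge 0$. Then, with the choice $\lambda=n^{-1/(d'+4)}$, $$\mathbf{E}\big[|\hat S_{\lambda,n}-W_2^2(\mu,\nu)|\big]\le C\,n^{-2/(d'+4)},$$ where $C$ is a constant depending only on $I$ and $d$. Moreover, for all $t,\lambda\ge0$, $$\mathbf{P}\Big[\big|\hat S_{\lambda,n}-\mathbf{E}[\hat S_{\lambda,n}]\big|\ge t\Big]\le2\exp(-nt^2/4).$$
   Context: For probability measures $\mu,\nu$ on $\mathbb{R}^d$ with finite second moments, $\Pi(\mu,\nu)$ is the set of couplings; $H(\gamma,\pi)=\int\log(d\gamma/d\pi)\,d\gamma$ if $\gamma\ll\pi$ and $+\infty$ otherwise. For $\lambda\ge0$, $T_\lambda(\mu,\nu)=\min_{\gamma\in\Pi(\mu,\nu)}\int\|y-x\|_2^2\,d\gamma(x,y)+2\lambda H(\gamma,\mu\otimes\nu)$; $W_2^2(\mu,\nu)=T_0(\mu,\nu)$; and $S_\lambda(\mu,\nu)=T_\lambda(\mu,\nu)-\frac12(T_\lambda(\mu,\mu)+T_\lambda(\nu,\nu))$. For $n\ge1$, $\hat\mu_n=\frac1n\sum_{i=1}^n\delta_{x_i}$ and $\hat\nu_n=\frac1n\sum_{i=1}^n\delta_{y_i}$, where $x_1,\dots,x_n$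 are i.i.d. from $\mu$ and $y_1,\dots,y_n$ are i.i.d. from $\nu$, all independent, and $\hat S_{\lambda,n}=S_\lambda(\hat\mu_n,\hat\nu_n)$. *)

(* Defs.v *)
From HB Require Import structures.
From mathcomp Require Import all_boot all_order all_algebra.
From mathcomp Require Import all_classical all_reals all_analysis.

Set Implicit Arguments.
Unset Strict Implicit.
Unset Printing Implicit Defensive.
Import Order.TTheory GRing.Theory Num.Theory.
Import numFieldNormedType.Exports.

Local Open Scope classical_set_scope.
Local Open Scope ring_scope.
Local Open Scope ereal_scope.
Local Open Scope charge_scope.

(* R^d is [d.-tuple R], whose library sigma-algebra is the product of the
   Borel sigma-algebras of the coordinates, i.e. the Borel sigma-algebra of
   R^d. *)
Section euclidean.
Context {R : realType} {d : nat}.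
Implicit Types (x y : d.-tuple R) (A : set (d.-tuple R)).

Definition euclid_dist x y : R :=
  Num.sqrt (\sum_(i < d) (tnth y i - tnth x i) ^+ 2)%R.

Definition diameter A : \bar R :=
  ereal_sup [set (euclid_dist p.1 p.2)%:E | p in A `*` A].

(* [A] need not be measurable. *)
Definition supported_on (mu : probability (d.-tuple R) R) A : Prop :=
  mu.-negligible (~` A).

End euclidean.

Section relative_entropy.
Context {dT} {T : measurableType dT} {R : realType}.

(* The integral is that of an extended-real function whose negative part is
   integrable.  The density is positive gamma-almost everywhere, so the value
   [lne r = -oo] for [r <= 0] only occurs on a gamma-null set. *)
Definition rel_entropy (gamma : {finite_measure set T -> \bar R})
    (pi : {sigma_finite_measure set T -> \bar R}) : \bar R :=
  if `[< gamma `<< pi >] then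
    \int[gamma]_z lne (('d (charge_of_finite_measure gamma) '/d pi) z)
  else +oo.

End relative_entropy.

Section entropic_transport.
Context {R : realType} {d : nat}.
Local Notation Rd := (d.-tuple R).
Implicit Types (mu nu : probability Rd R) (lambda : R).

Definition couplings mu nu : set (probability (Rd * Rd)%type R) :=
  [set gamma |
    (forall A, measurable A -> gamma (fst @^-1` A) = mu A) /\
    (forall B, measurable B -> gamma (snd @^-1` B) = nu B)].

(* The measure [mu \x nu], bundled so as to carry a finite-measure structure. *)
Definition product_of mu nu : subprobability (Rd * Rd)%type R :=
  product_subprobability (mu : subprobability Rd R, nu : subprobability Rd R).

(* For [lambda = 0] the entropy term vanishes even when the entropy is
   infinite, since [0 * +oo = 0]. *)
Definition eot_objective lambda mu nu (gamma : probability (Rd * Rd)%type R) :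
    \bar R :=
  \int[gamma]_z (euclid_dist z.1 z.2 ^+ 2)%:E +
  (2 * lambda)%:E * rel_entropy gamma (product_of mu nu).

Definition eot lambda mu nu : \bar R :=
  ereal_inf [set eot_objective lambda mu nu gamma | gamma in couplings mu nu].

Definition wasserstein2_sq mu nu : \bar R := eot 0%R mu nu.

Definition sinkhorn_div lambda mu nu : \bar R :=
  eot lambda mu nu - (2^-1)%:E * (eot lambda mu mu + eot lambda nu nu).

End entropic_transport.

Section empirical_measure.
Context {dT} {T : measurableType dT} {R : realType} {n : nat}.
Variables (n_gt0 : (0 < n)%N) (x : 'I_n -> T).

(* [n_gt0] is an argument so that the measure is canonically a probability. *)
Definition empirical (A : set T) : \bar R :=
  let _ := n_gt0 in (n%:R^-1)%:E * \sum_(i < n) \d_(x i) A.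

Let empirical0 : empirical set0 = 0.
Proof. by rewrite /empirical big1 ?mule0// => i _; rewrite measure0. Qed.

Let empirical_ge0 A : 0 <= empirical A.
Proof.
by rewrite /empirical mule_ge0 ?sume_ge0// lee_fin invr_ge0 ler0n.
Qed.

Let empirical_sigma_additive : semi_sigma_additive empirical.
Proof.
pose i0 : 'I_n := Ordinal n_gt0.
pose m (k : nat) : {measure set T -> \bar R} := \d_(x (insubd i0 k)).
have r0 : (0 <= n%:R^-1 :> R)%R by rewrite invr_ge0 ler0n.
have -> : empirical = mscale (NngNum r0) (msum m n).
  apply/funext => A; rewrite /empirical /mscale /msum; congr (_ * _).
  by apply: eq_bigr => i _; rewrite /m /= valKd.
exact: measure_semi_sigma_additive.
Qed.

HB.instance Definition _ := isMeasure.Build _ _ _ empirical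
  empirical0 empirical_ge0 empirical_sigma_additive.

Let empiricalT : empirical [set: T] = 1.
Proof.
rewrite /empirical (eq_bigr (fun=> 1%:E)); last by move=> i _; rewrite diracT.
by rewrite sumEFin -EFinM sumr_const card_ord mulVf// pnatr_eq0 -lt0n.
Qed.

HB.instance Definition _ :=
  Measure_isProbability.Build _ _ _ empirical empiricalT.

End empirical_measure.

Section sampling.
Context {dO} {Omega : measurableType dO} {R : realType}
  {dT} {T : measurableType dT}.
Variable P : probability Omega R.

Definition mutually_independent (J : finType) (Z : J -> {RV P >-> T}) : Prop :=
  forall (K : {set J}) (A : J -> set T), (forall j, measurable (A j)) ->
    P [set w | forall j, j \in K -> A j (Z j w)] =
    \prod_(j in K) P (Z j @^-1` A j).

Definition has_law (Z : {RV P >-> T}) (mu : probability T R) : Prop :=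
  forall A, measurable A -> distribution P Z A = mu A.

Definition independent_samples (n : nat) (mu nu : probability T R)
    (X Y : 'I_n -> {RV P >-> T}) : Prop :=
  [/\ forall i, has_law (X i) mu,
      forall j, has_law (Y j) nu &
      mutually_independent
        (fun k : 'I_n + 'I_n => match k with inl i => X i | inr j => Y j end)].

End sampling.

Definition empirical_sinkhorn_div {R : realType} {d n : nat}
    (n_gt0 : (0 < n)%N) {dO : measure_display} {Omega : measurableType dO}
    {P : probability Omega R} (X Y : 'I_n -> {RV P >-> d.-tuple R})
    (lambda : R) (w : Omega) : \bar R :=
  sinkhorn_div lambda (empirical n_gt0 (fun i => X i w))
                      (empirical n_gt0 (fun i => Y i w)).

(* Main.v *)
Require Import Defs.
From HB Require Import structures.
From mathcomp Require Import all_boot all_order all_algebra.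
From mathcomp Require Import all_classical all_reals all_analysis.
From mathcomp Require Import measurable_realfun.
From mathcomp Require Import ring lra.

Set Implicit Arguments.
Unset Strict Implicit.
Unset Printing Implicit Defensive.
Import Order.TTheory GRing.Theory Num.Theory.
Import numFieldNormedType.Exports.

Local Open Scope classical_set_scope.
Local Open Scope ring_scope.

(** Let (f, g) be the Schrödinger potentials of (mu, nu) and
    p = exp ((f + g - c) / (2 lambda)) the density of the optimal coupling, so
    that T_lambda = int f dmu + int g dnu.  Since the exponential lies above its
    tangents, the empirical cost differs from T_lambda by at most the
    fluctuations of the sample means of f, of g and of the row and column means
    of 1 - p, the latter having variance at most int p^2 / n.  Where x + y stays
    in a cube of side sqrt lambda, p(x,y) p(x',y') <= e^(d/4) p(x,y') p(x',y),
    and the marginal constraints of p bound the integral of p^2 over that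
    region by e^(d/4); counting cubes, int p^2 <= C lambda^(-d/2).  The
    resulting rate lambda^(-d/4) n^(-1/2) suffices when d >= 2.  For d = 1 the
    potentials are Lipschitz uniformly in lambda, and comparing distribution
    functions on a grid gives n^(-1/2).

    For the concentration bound, moving one sample point changes the empirical
    Sinkhorn divergence by at most 2/n, and McDiarmid's inequality applies.
    The case lambda = 0 is the limit lambda -> 0, because a coupling of
    empirical measures has relative entropy at most log n. *)

(** * Bounded measurable functions and their integrals *)

(** Every estimate inserts the potentials of one pair of measures into the dual problem of another.
    They are therefore wanted at every point of the space, with the marginal constraints valid
    everywhere and with [|f| <= 1], [|g| <= 2] uniformly in lambda: hence a cost truncated at 1, and
    an iterative construction whose contraction factor tends to 1 as lambda -> 0, harmless since
    only existence is used. Locating x + y alone suffices because the potentials and squares cancel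
    in p(x,y) p(x',y') / (p(x,y') p(x',y)), leaving exp (<x - x', y - y'> / lambda), and 4ab <= (a +
    b)^2. The cubes thus live in R^d and not in R^(2d), which halves the exponent of 1/lambda. In
    the terms T(mu,mu) and T(nu,nu) of the divergence both samples coincide and independence fails
    on the diagonal; the integral of p(x,x) obeys the same cube bound and enters with weight 1/n.
    With D = d' + 4 and lambda = n^(-1/D), the bias lambda^2 I is the target rate n^(-2/D), and the
    fluctuation stays below it as soon as d + 8 <= 2 D, which holds for d >= 2 and fails for d =
    1. *)

Section bounded_measurable.
Context {dT} {T : measurableType dT} {R : realType}.
Implicit Types f g : T -> R.

(** Bounded at every point and not almost everywhere: one function is integrated against population,
    empirical and coupling measures, and its integral is a real number under all of them. *)
Definition bmeas f :=
  measurable_fun [set: T] f /\ exists M : R, forall x, `|f x| <= M.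

Lemma eq_bmeas f g : bmeas f -> (forall x, g x = f x) -> bmeas g.
Proof. by move=> bf gf; have -> : g = f by apply/funext. Qed.

Lemma bmeas_cst (r : R) : bmeas (fun=> r).
Proof. by split; [exact: measurable_cst | exists `|r|]. Qed.

Lemma bmeasD f g : bmeas f -> bmeas g -> bmeas (fun x => f x + g x).
Proof.
move=> [mf [M fM]] [mg [N gN]]; split; first exact: measurable_funD.
by exists (M + N) => x; rewrite (le_trans (ler_normD _ _))// lerD.
Qed.

Lemma bmeasN f : bmeas f -> bmeas (fun x => - f x).
Proof.
move=> [mf [M fM]]; split; first exact: measurableT_comp.
by exists M => x; rewrite normrN.
Qed.

Lemma bmeasB f g : bmeas f -> bmeas g -> bmeas (fun x => f x - g x).
Proof. by move=> bf bg; apply: bmeasD => //; exact: bmeasN. Qed.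

Lemma bmeasM f g : bmeas f -> bmeas g -> bmeas (fun x => f x * g x).
Proof.
move=> [mf [M fM]] [mg [N gN]]; split; first exact: measurable_funM.
by exists (M * N) => x; rewrite normrM ler_pM.
Qed.

Lemma bmeas_norm f : bmeas f -> bmeas (fun x => `|f x|).
Proof.
move=> [mf [M fM]]; split; first exact: measurableT_comp.
by exists M => x; rewrite normr_id.
Qed.

Lemma bmeas_sum (I : Type) (s : seq I) (P : pred I) (F : I -> T -> R) :
  (forall i, P i -> bmeas (F i)) -> bmeas (fun x => \sum_(i <- s | P i) F i x).
Proof.
move=> bF; elim: s => [|i s IHs].
  by apply: (eq_bmeas (bmeas_cst 0)) => x; rewrite big_nil.
have [Pi|Pi] := boolP (P i).
  by apply: (eq_bmeas (bmeasD (bF i Pi) IHs)) => x; rewrite big_cons Pi.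
by apply: (eq_bmeas IHs) => x; rewrite big_cons (negbTE Pi).
Qed.

Lemma bmeas_expR f : bmeas f -> bmeas (fun x => expR (f x)).
Proof.
move=> [mf [M fM]]; split; first exact: measurableT_comp.
exists (expR M) => x; rewrite ger0_norm ?expR_ge0// ler_expR.
by rewrite (le_trans (ler_norm _)).
Qed.

Lemma bmeas_indic (A : set T) : measurable A -> bmeas (\1_A : T -> R).
Proof.
move=> mA; split; first exact: measurable_indic.
by exists 1 => x; rewrite indicE ger0_norm ?ler0n// lern1 leq_b1.
Qed.

Lemma bmeas_ln f (m : R) : 0 < m -> (forall x, m <= f x) -> bmeas f ->
  bmeas (fun x => ln (f x)).
Proof.
move=> m0 mf [mef [M fM]]; split; first exact: measurableT_comp.
have fxM x : f x <= M by rewrite (le_trans (ler_norm _)).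
have fx0 x : 0 < f x by rewrite (lt_le_trans m0).
exists (`|ln m| + `|ln M|) => x.
have h1 : ln m <= ln (f x) by rewrite ler_ln// posrE.
have h2 : ln (f x) <= ln M by rewrite ler_ln ?posrE// (lt_le_trans (fx0 x)).
rewrite ler_norml.
have := ler_norm (ln M); have := ler_norm (- ln m); rewrite normrN.
have := normr_ge0 (ln M); have := normr_ge0 (ln m).
move: (`|_|) (`|_|) => a b; lra.
Qed.

Lemma bmeas_integrable (mu : probability T R) f :
  bmeas f -> mu.-integrable [set: T] (EFin \o f).
Proof.
move=> [mf [M fM]]; apply: measurable_bounded_integrable => //.
  by rewrite -ge0_fin_numE// fin_num_measure.
by exists M; split; [exact: num_real | move=> N MN x _ /=; rewrite (le_trans (fM x))// ltW].
Qed.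

Variable mu : probability T R.

Lemma probability_inhabited : exists x : T, True.
Proof.
apply/not_existsP => h; have : mu setT = 0%E.
  rewrite (_ : setT = set0) ?measure0//.
  by apply/seteqP; split => x // _; have := h x.
by rewrite [LHS](probability_setT mu) => /eqP; rewrite onee_eq0.
Qed.

Lemma Rintegral_EFin f : bmeas f ->
  ((\int[mu]_x f x)%:E = \int[mu]_x (f x)%:E)%E.
Proof.
by move=> bf; rewrite fineK//; exact: integrable_fin_num (bmeas_integrable _ bf).
Qed.

Lemma bRintegral_cst (r : R) : \int[mu]_x r = r.
Proof.
have mu1 : fine (mu setT) = 1 by rewrite probability_setT.
by rewrite Rintegral_cst//= mu1 mulr1.
Qed.

Lemma bRintegralD f g : bmeas f -> bmeas g ->
  \int[mu]_x (f x + g x) = \int[mu]_x f x + \int[mu]_x g x.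
Proof. by move=> ? ?; rewrite RintegralD//; exact: bmeas_integrable. Qed.

Lemma bRintegralB f g : bmeas f -> bmeas g ->
  \int[mu]_x (f x - g x) = \int[mu]_x f x - \int[mu]_x g x.
Proof. by move=> ? ?; rewrite RintegralB//; exact: bmeas_integrable. Qed.

Lemma bRintegralZ (r : R) f : bmeas f ->
  \int[mu]_x (r * f x) = r * \int[mu]_x f x.
Proof. by move=> ?; rewrite RintegralZl//; exact: bmeas_integrable. Qed.

Lemma bRintegralZr (r : R) f : bmeas f ->
  \int[mu]_x (f x * r) = \int[mu]_x f x * r.
Proof. by move=> ?; rewrite RintegralZr//; exact: bmeas_integrable. Qed.

Lemma bRintegral_sum (I : Type) (s : seq I) (P : pred I) (F : I -> T -> R) :
  (forall i, P i -> bmeas (F i)) ->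
  \int[mu]_x (\sum_(i <- s | P i) F i x) =
  \sum_(i <- s | P i) \int[mu]_x F i x.
Proof.
move=> bF; elim: s => [|i s IHs].
  rewrite big_nil; under eq_Rintegral do rewrite big_nil.
  exact: bRintegral_cst.
rewrite big_cons; under eq_Rintegral do rewrite big_cons.
case: ifP => // Pi; rewrite bRintegralD ?IHs//; first exact: bF.
exact: bmeas_sum.
Qed.

Lemma ler_bRintegral f g : bmeas f -> bmeas g -> (forall x, f x <= g x) ->
  \int[mu]_x f x <= \int[mu]_x g x.
Proof. by move=> ? ? ?; rewrite le_Rintegral//; exact: bmeas_integrable. Qed.

Lemma bRintegral_le f (r : R) : bmeas f -> (forall x, f x <= r) ->
  \int[mu]_x f x <= r.
Proof.
by move=> bf fr; rewrite -[leRHS]bRintegral_cst ler_bRintegral//; exact: bmeas_cst.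
Qed.

Lemma bRintegral_ge f (r : R) : bmeas f -> (forall x, r <= f x) ->
  r <= \int[mu]_x f x.
Proof.
by move=> bf fr; rewrite -[leLHS]bRintegral_cst ler_bRintegral//; exact: bmeas_cst.
Qed.

Lemma ler_norm_bRintegral f : bmeas f ->
  `|\int[mu]_x f x| <= \int[mu]_x `|f x|.
Proof. by move=> bf; rewrite le_normr_Rintegral//; exact: bmeas_integrable. Qed.

Lemma bRintegral_indic (A : set T) : measurable A ->
  ((\int[mu]_x \1_A x)%:E = mu A)%E.
Proof.
by move=> mA; rewrite Rintegral_EFin ?integral_indic ?setIT//; exact: bmeas_indic.
Qed.

Lemma bRintegral_sqr_le f : bmeas f ->
  (\int[mu]_x f x) ^+ 2 <= \int[mu]_x (f x ^+ 2).
Proof.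
move=> bf; set m := \int[mu]_x f x.
have bf2 : bmeas (fun x => f x ^+ 2).
  by apply: (eq_bmeas (bmeasM bf bf)) => x; rewrite expr2.
have : 0 <= \int[mu]_x (f x ^+ 2 - (2 * m * f x - m ^+ 2)).
  apply: Rintegral_ge0 => x _; rewrite opprB addrA.
  by have := sqr_ge0 (f x - m); rewrite sqrrB; lra.
have b1 : bmeas (fun x => 2 * m * f x) by apply: bmeasM => //; exact: bmeas_cst.
have b2 := bmeas_cst (m ^+ 2).
rewrite bRintegralB//; last exact: bmeasB.
rewrite bRintegralB// bRintegralZ// bRintegral_cst -/m.
by rewrite -mulrA -expr2; lra.
Qed.

(** Serves among others to pass from the untruncated divergence, known only to be measurable, to the
    truncated one on the event that all sample points lie in the support. *)
Lemma ae_eq_bRintegral (A : set T) f g : measurable A -> mu A = 1%E ->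
  measurable_fun [set: T] f -> measurable_fun [set: T] g ->
  (forall x, A x -> f x = g x) ->
  (\int[mu]_x (f x)%:E = \int[mu]_x (g x)%:E)%E.
Proof.
move=> mA A1 mf mg fg; apply: ae_eq_integral => //; do ?exact/measurable_EFinP.
exists (~` A); split; first exact: measurableC.
  by rewrite [LHS](probability_setC mu mA) A1 subee.
by move=> x /=; apply: contra_not => Ax _; rewrite fg.
Qed.

End bounded_measurable.

Lemma bmeas_comp d1 d2 (T1 : measurableType d1) (T2 : measurableType d2)
    (R : realType) (f : T2 -> R) (g : T1 -> T2) :
  measurable_fun [set: T1] g -> bmeas f -> bmeas (fun x => f (g x)).
Proof.
by move=> mg [mf [M fM]]; split; [exact: measurableT_comp | exists M => x].
Qed.

Section fubini_bounded.
Context {d1 d2} {T1 : measurableType d1} {T2 : measurableType d2} {R : realType}.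
Variables (mu : probability T1 R) (nu : probability T2 R).

Lemma bmeas_pair1 (F : T1 -> T2 -> R) x :
  bmeas (fun z : T1 * T2 => F z.1 z.2) -> bmeas (F x).
Proof.
move=> bF.
by apply: (@bmeas_comp _ _ _ _ _ (fun z : T1 * T2 => F z.1 z.2) (pair x)).
Qed.

Lemma bmeas_pair2 (F : T1 -> T2 -> R) y :
  bmeas (fun z : T1 * T2 => F z.1 z.2) -> bmeas (F ^~ y).
Proof.
move=> bF.
by apply: (@bmeas_comp _ _ _ _ _ (fun z : T1 * T2 => F z.1 z.2) (fun x => (x, y))).
Qed.

Let prodT : (mu \x nu)%E setT = 1%E.
Proof.
rewrite -setXTT; transitivity (mu setT * nu setT)%E.
  exact: product_measure1E.
by rewrite (probability_setT mu) (probability_setT nu) mule1.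
Qed.

HB.instance Definition _ := Measure.on (mu \x nu)%E.
HB.instance Definition _ :=
  Measure_isProbability.Build _ _ _ (mu \x nu)%E prodT.

(** The measure underlying [product_of], bundled as a probability so that the calculus of bounded
    functions applies to it. *)
Definition prod_prob : probability (T1 * T2)%type R := (mu \x nu)%E.

Lemma bmeas_fubini1 (F : T1 -> T2 -> R) :
  bmeas (fun z : T1 * T2 => F z.1 z.2) -> bmeas (fun x => \int[nu]_y F x y).
Proof.
move=> bF; split.
  apply/measurable_EFinP => /=.
  have -> : EFin \o (fun x => \int[nu]_y F x y) =
      fubini_F nu (fun z => (F z.1 z.2)%:E).
    by apply/funext => x /=; rewrite Rintegral_EFin//; exact: bmeas_pair1.
  apply: (@measurable_fubini_F _ _ _ _ _ mu nu (fun z => (F z.1 z.2)%:E)).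
  exact: (bmeas_integrable prod_prob bF).
case: (bF) => _ [M FM]; exists M => x.
rewrite (le_trans (ler_norm_bRintegral _ (bmeas_pair1 _ bF)))//.
by apply: bRintegral_le => [|y]; [exact/bmeas_norm/bmeas_pair1 | exact: (FM (x, y))].
Qed.

Lemma bRintegral_prod (F : T1 -> T2 -> R) :
  bmeas (fun z : T1 * T2 => F z.1 z.2) ->
  \int[prod_prob]_z F z.1 z.2 = \int[mu]_x \int[nu]_y F x y.
Proof.
move=> bF; apply: EFin_inj.
rewrite Rintegral_EFin// Rintegral_EFin; last exact: bmeas_fubini1.
rewrite -(integral12_prod_meas1 (bmeas_integrable prod_prob bF)).
by apply: eq_integral => x _; rewrite Rintegral_EFin//; exact: bmeas_pair1.
Qed.

End fubini_bounded.

Section fubini_swap.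
Context {d1 d2} {T1 : measurableType d1} {T2 : measurableType d2} {R : realType}.
Variables (mu : probability T1 R) (nu : probability T2 R).

Lemma bmeas_fubini2 (F : T1 -> T2 -> R) :
  bmeas (fun z : T1 * T2 => F z.1 z.2) -> bmeas (fun y => \int[mu]_x F x y).
Proof.
move=> bF; apply: (@bmeas_fubini1 _ _ _ _ _ nu mu (fun y x => F x y)).
apply: (@bmeas_comp _ _ _ _ _ (fun z : T1 * T2 => F z.1 z.2)
  (fun z : T2 * T1 => (z.2, z.1))) => //.
exact: measurable_fun_pair.
Qed.

Lemma bRintegral_prod2 (F : T1 -> T2 -> R) :
  bmeas (fun z : T1 * T2 => F z.1 z.2) ->
  \int[prod_prob mu nu]_z F z.1 z.2 = \int[nu]_y \int[mu]_x F x y.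
Proof.
move=> bF; apply: EFin_inj.
rewrite Rintegral_EFin// Rintegral_EFin; last exact: bmeas_fubini2.
rewrite -(integral21_prod_meas1 (bmeas_integrable (prod_prob mu nu) bF)).
by apply: eq_integral => x _; rewrite Rintegral_EFin//; exact: bmeas_pair2.
Qed.

Lemma bRintegral_swap (F : T1 -> T2 -> R) :
  bmeas (fun z : T1 * T2 => F z.1 z.2) ->
  \int[mu]_x \int[nu]_y F x y = \int[nu]_y \int[mu]_x F x y.
Proof. by move=> bF; rewrite -bRintegral_prod// bRintegral_prod2. Qed.

End fubini_swap.

Lemma bRintegral_image d1 d2 (T1 : measurableType d1) (T2 : measurableType d2)
    (R : realType) (P : probability T1 R) (Q : probability T2 R)
    (phi : T1 -> T2) (f : T2 -> R) :
  measurable_fun [set: T1] phi ->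
  (forall A, measurable A -> Q A = P (phi @^-1` A)) -> bmeas f ->
  \int[Q]_y f y = \int[P]_x f (phi x).
Proof.
move=> mphi QP bf; rewrite /Rintegral; congr fine.
rewrite (eq_measure_integral (pushforward P phi)); last first.
  by move=> A mA _; exact: QP.
rewrite integral_pushforward//; first by case: bf => mf _; exact/measurable_EFinP.
apply: (@bmeas_integrable _ _ _ P (fun x => f (phi x))).
exact: bmeas_comp bf.
Qed.

(** * Existence of the Schrödinger potentials *)

(** With [B = A / (1 - q)] the intervals of radius [B * q ^+ k] around [u k] are nested, because
    [B * q ^+ k - B * q ^+ k.+1 = A * q ^+ k]; the supremum of their left ends lies in all of them.
    The explicit rate gives uniformity when [u] depends on a point. *)
Lemma geometric_limit (R : realType) (u : nat -> R) (A q : R) :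
  0 <= q -> q < 1 -> (forall k, `|u k.+1 - u k| <= A * q ^+ k) ->
  exists l : R, forall k, `|l - u k| <= A / (1 - q) * q ^+ k.
Proof.
move=> q0 q1 ustep; set B := A / (1 - q).
have q1' : 1 - q != 0 by rewrite subr_eq0 eq_sym lt_eqF.
have BA k : B * q ^+ k - B * q ^+ k.+1 = A * q ^+ k.
  by rewrite exprS /B; field.
pose a k := u k - B * q ^+ k; pose b k := u k + B * q ^+ k.
have aS k : a k <= a k.+1.
  by have := ustep k; rewrite ler_norml /a -BA; lra.
have bS k : b k.+1 <= b k.
  by have := ustep k; rewrite ler_norml /b -BA; lra.
have aD k j : a k <= a (k + j)%N.
  by elim: j => [|j IH]; rewrite ?addn0// addnS (le_trans IH).
have bD k j : b (k + j)%N <= b k.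
  by elim: j => [|j IH]; rewrite ?addn0// addnS (le_trans _ IH).
have A0 : 0 <= A by have := ustep 0; rewrite expr0 mulr1; exact: le_trans.
have B0 : 0 <= B by rewrite divr_ge0// subr_ge0 ltW.
have ab k : a k <= b k.
  have : 0 <= B * q ^+ k by rewrite mulr_ge0// exprn_ge0.
  by rewrite /a /b; lra.
have abkj k j : a j <= b k.
  by rewrite (le_trans (aD j k))// (le_trans (ab _))// addnC.
have aub k : ubound (range a) (b k) by move=> _ [j _ <-].
have has : has_sup (range a) by split; [exists (a 0), 0%N | exists (b 0)].
exists (sup (range a)) => k; rewrite ler_norml; apply/andP; split.
  have : a k <= sup (range a) by apply: ub_le_sup; [case: has | exists k].
  by rewrite /a; lra.
have : sup (range a) <= b k by apply: ge_sup => //; case: has.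
by rewrite /b; lra.
Qed.

Lemma geometric_eq0 (R : realType) (x B q : R) :
  0 <= q -> q < 1 -> (forall k, `|x| <= B * q ^+ k) -> x = 0.
Proof.
move=> q0 q1 xq; apply/eqP; rewrite -normr_eq0 eq_le normr_ge0 andbT.
have cq : B * q ^+ k @[k --> \oo] --> B * 0.
  by apply: cvgMr; apply: cvg_expr; rewrite ger0_norm.
rewrite mulr0 in cq; rewrite -(cvg_lim _ cq)//.
apply: limr_ge; first by apply/cvg_ex; exists 0.
by apply: nearW.
Qed.

Section positive_functions.
Context {dT} {T : measurableType dT} {R : realType}.
Implicit Types v w : T -> R.

(** The lower bound away from zero keeps [v^-1] and [ln v] bounded, so that Sinkhorn scalings stay
    in the class. *)
Definition bpos v := bmeas v /\ exists2 m : R, 0 < m & forall y, m <= v y.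

Lemma bpos_gt0 v y : bpos v -> 0 < v y.
Proof. by move=> [_ [m m0 mv]]; exact: lt_le_trans (mv y). Qed.

Lemma bposM v w : bpos v -> bpos w -> bpos (fun y => v y * w y).
Proof.
move=> [bv [m m0 mv]] [bw [n n0 nw]]; split; first exact: bmeasM.
by exists (m * n) => [|y]; [exact: mulr_gt0 | rewrite ler_pM// ltW].
Qed.

Lemma bpos_expR v : bmeas v -> bpos (fun y => expR (v y)).
Proof.
move=> bv; split; first exact: bmeas_expR.
case: bv => _ [M vM]; exists (expR (- M)) => [|y]; first exact: expR_gt0.
by rewrite ler_expR; have := vM y; rewrite ler_norml => /andP[].
Qed.

Lemma bpos_ln v : bpos v -> bmeas (fun y => ln (v y)).
Proof. by move=> [bv [m m0 mv]]; exact: bmeas_ln mv bv. Qed.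

Lemma bposV v : bpos v -> bpos (fun y => (v y)^-1).
Proof.
move=> bv; have := bpos_expR (bmeasN (bpos_ln bv)).
rewrite (_ : (fun y => expR _) = (fun y => (v y)^-1))//.
by apply/funext => y; rewrite expRN lnK// posrE bpos_gt0.
Qed.

End positive_functions.

(** * Contraction of the Sinkhorn iteration *)

Section sinkhorn_half_step.
Context {d1 d2} {T1 : measurableType d1} {T2 : measurableType d2} {R : realType}.
Variables (mu : probability T1 R) (nu : probability T2 R).
Variables (k : T1 -> T2 -> R) (kappa : R).
Hypothesis bk : bmeas (fun z : T1 * T2 => k z.1 z.2).
Hypothesis kappa0 : 0 < kappa.
Hypothesis kge : forall x y, kappa <= k x y.
Hypothesis kle : forall x y, k x y <= 1.
Implicit Types v w : T2 -> R.

Definition kint v (x : T1) : R := \int[nu]_y (k x y * v y).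

(** Half a Sinkhorn iteration: the scaling of the first variable that gives the kernel [k], already
    scaled by [v] in the second, all row integrals equal to 1. *)
Definition half_step v (x : T1) : R := (kint v x)^-1.

Let bk1 x : bmeas (k x). Proof. exact: bmeas_pair1 bk. Qed.

Let bkv x v : bmeas v -> bmeas (fun y => k x y * v y).
Proof. by move=> bv; exact: bmeasM. Qed.

Let k0 x y : 0 < k x y. Proof. exact: lt_le_trans (kge x y). Qed.

Lemma bmeas_kprod v : bmeas v -> bmeas (fun z : T1 * T2 => k z.1 z.2 * v z.2).
Proof. by move=> bv; apply: bmeasM => //; exact: bmeas_comp bv. Qed.

Lemma bpos_kint v : bpos v -> bpos (kint v).
Proof.
move=> [bv [m m0 mv]]; split.
  exact: (bmeas_fubini1 mu nu (F := fun x y => k x y * v y) (bmeas_kprod bv)).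
exists (kappa * m) => [|x]; first exact: mulr_gt0.
by apply: bRintegral_ge => [|y]; [exact: bkv | rewrite ler_pM// ltW].
Qed.

Lemma bpos_half_step v : bpos v -> bpos (half_step v).
Proof. by move=> bv; apply/bposV/bpos_kint. Qed.

Lemma kintZ r v x : bmeas v -> kint (fun y => r * v y) x = r * kint v x.
Proof.
move=> bv; rewrite -bRintegralZ; last exact: bkv.
by apply: eq_Rintegral => y _; rewrite mulrCA.
Qed.

Lemma kintB v w x : bmeas v -> bmeas w ->
  kint (fun y => v y - w y) x = kint v x - kint w x.
Proof.
move=> bv bw; rewrite -bRintegralB; [|exact: bkv..].
by apply: eq_Rintegral => y _; rewrite mulrBr.
Qed.

Lemma ler_kint v w x : bmeas v -> bmeas w -> (forall y, v y <= w y) ->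
  kint v x <= kint w x.
Proof.
by move=> bv bw vw; apply: ler_bRintegral => [||y]; [exact: bkv..|rewrite ler_pM2l].
Qed.

(** Pointwise under the integral, [k x y >= kappa >= kappa * k x' y]. *)
Lemma kint_harnack v x x' : bmeas v -> (forall y, 0 <= v y) ->
  kappa * kint v x' <= kint v x.
Proof.
move=> bv v0; rewrite -bRintegralZ; last exact: bkv.
apply: ler_bRintegral => [||y]; [|exact: bkv|].
  by apply: bmeasM; [exact: bmeas_cst | exact: bkv].
rewrite mulrA ler_wpM2r// (le_trans _ (kge x y))//.
by rewrite ler_piMr// ltW.
Qed.

(* Doeblin minorisation: the probabilities [k x y * v y dnu / kint v x] all
   dominate [kappa ^+ 2] times the one at [x0]. *)
Lemma kint_contract (x0 : T1) (a b : R) v v' : bpos v -> bmeas v' ->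
  (forall y, a * v y <= v' y) -> (forall y, v' y <= b * v y) ->
  let r := kint v' x0 / kint v x0 in
  forall x,
    (kappa ^+ 2 * r + (1 - kappa ^+ 2) * a) * kint v x <= kint v' x /\
    kint v' x <= (kappa ^+ 2 * r + (1 - kappa ^+ 2) * b) * kint v x.
Proof.
move=> pv bv' av vb r x.
have bv : bmeas v by case: pv.
have bZ s : bmeas (fun y => s * v y) by apply: bmeasM => //; exact: bmeas_cst.
have Kx : 0 < kint v x by exact/bpos_gt0/bpos_kint.
have Kx0 : 0 < kint v x0 by exact/bpos_gt0/bpos_kint.
have rE : kint v' x0 = r * kint v x0 by rewrite divfK ?gt_eqF.
have K0 : kappa * kint v x <= kint v x0.
  by apply: kint_harnack => // y; exact/ltW/bpos_gt0.
have key w : bmeas w -> (forall y, 0 <= w y) -> forall s,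
    kint w x0 = s * kint v x0 -> kappa ^+ 2 * s * kint v x <= kint w x.
  move=> bw w0 s ws.
  have s0 : 0 <= s.
    rewrite -(pmulr_lge0 _ Kx0) -ws.
    by apply: Rintegral_ge0 => y _; rewrite mulr_ge0// ltW.
  apply: le_trans (kint_harnack x x0 bw w0).
  by rewrite ws expr2 -!mulrA ler_pM2l// mulrCA ler_wpM2l.
split.
- have := key (fun y => v' y - a * v y) (bmeasB bv' (bZ a)) _ (r - a).
  rewrite !kintB// !kintZ// rE -mulrBl => /(_ _ erefl).
  by move=> /(_ (fun y => _)) h; have := h (fun y => etrans (subr_ge0 _ _) (av y)); lra.
- have := key (fun y => b * v y - v' y) (bmeasB (bZ b) bv') _ (b - r).
  rewrite !kintB// !kintZ// rE -mulrBl => /(_ _ erefl).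
  by move=> /(_ (fun y => _)) h; have := h (fun y => etrans (subr_ge0 _ _) (vb y)); lra.
Qed.

Lemma half_step_anti (a b : R) v v' : 0 < a -> bpos v -> bpos v' ->
  (forall x, a * kint v x <= kint v' x) -> (forall x, kint v' x <= b * kint v x) ->
  forall x, b^-1 * half_step v x <= half_step v' x /\
            half_step v' x <= a^-1 * half_step v x.
Proof.
move=> a0 pv pv' av vb x.
have Kx : 0 < kint v x by exact/bpos_gt0/bpos_kint.
have Kx' : 0 < kint v' x by exact/bpos_gt0/bpos_kint.
have b0 : 0 < b by rewrite -(pmulr_lgt0 _ Kx) (lt_le_trans Kx').
by rewrite /half_step -!invfM; split; rewrite lef_pV2// posrE ?mulr_gt0.
Qed.

End sinkhorn_half_step.

Section sinkhorn_fixed_point.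
Context {d1 d2} {T1 : measurableType d1} {T2 : measurableType d2} {R : realType}.
Variables (mu : probability T1 R) (nu : probability T2 R).
Variables (k : T1 -> T2 -> R) (kappa : R).
Hypothesis bk : bmeas (fun z : T1 * T2 => k z.1 z.2).
Hypothesis kappa0 : 0 < kappa.
Hypothesis kge : forall x y, kappa <= k x y.
Hypothesis kle : forall x y, k x y <= 1.
Implicit Types v w : T2 -> R.

Let kT y x := k x y.

Let bkT : bmeas (fun z : T2 * T1 => kT z.1 z.2).
Proof.
apply: (bmeas_comp (f := fun z : T1 * T2 => k z.1 z.2)
  (g := fun z : T2 * T1 => (z.2, z.1))) => //.
exact: measurable_fun_pair.
Qed.

Let kgeT y x : kappa <= kT y x. Proof. exact: kge. Qed.

Let U : (T2 -> R) -> T1 -> R := half_step nu k.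
Let V : (T1 -> R) -> T2 -> R := half_step mu kT.

Let pU v : bpos v -> bpos (U v).
Proof. exact: (bpos_half_step mu nu bk kappa0). Qed.

Let pV (u : T1 -> R) : bpos u -> bpos (V u).
Proof. exact: (bpos_half_step nu mu bkT kappa0 kgeT). Qed.

Let L v := V (U v).

Let pL v : bpos v -> bpos (L v). Proof. by move=> pv; apply/pV/pU. Qed.

Let V_mono (a b : R) u u' : 0 < a -> bpos u -> bpos u' ->
  (forall x, a * u x <= u' x) -> (forall x, u' x <= b * u x) ->
  forall y, b^-1 * V u y <= V u' y /\ V u' y <= a^-1 * V u y.
Proof.
move=> a0 pu pu' au ub y.
have [[bu _] [bu' _]] := (pu, pu').
have bZ s : bmeas (fun x => s * u x) by apply: bmeasM => //; exact: bmeas_cst.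
apply: (half_step_anti nu bkT kappa0 kgeT a0 pu pu') => y'.
- by rewrite -(kintZ _ bkT)//; exact: (ler_kint _ bkT kappa0 kgeT).
- by rewrite -(kintZ _ bkT)//; exact: (ler_kint _ bkT kappa0 kgeT).
Qed.

(** Each half step inverts its bounds, so two of them restore [a] and [b]. The hypotheses compare
    [kint] and not [v] with [v'], since [kint_contract] has already gained its factor there. *)
Let L_mono (a b : R) v v' : 0 < a -> bpos v -> bpos v' ->
  (forall x, a * kint nu k v x <= kint nu k v' x) ->
  (forall x, kint nu k v' x <= b * kint nu k v x) ->
  forall y, a * L v y <= L v' y /\ L v' y <= b * L v y.
Proof.
move=> a0 pv pv' av vb y.
have [x0 _] := probability_inhabited mu.
have Kx : 0 < kint nu k v x0 by exact/bpos_gt0/(bpos_kint mu nu bk kappa0 kge).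
have Kx' : 0 < kint nu k v' x0 by exact/bpos_gt0/(bpos_kint mu nu bk kappa0 kge).
have b0 : 0 < b by rewrite -(pmulr_lgt0 _ Kx) (lt_le_trans Kx').
have h := half_step_anti mu bk kappa0 kge a0 pv pv' av vb.
have b0' : 0 < b^-1 by rewrite invr_gt0.
have := V_mono b0' (pU pv) (pU pv') (fun x => (h x).1) (fun x => (h x).2) y.
by rewrite !invrK.
Qed.

(** By definition [(L v y)^-1] is the integral of [k x y * U v x] in [x], and [(U v x)^-1] that of
    [k x y * v y] in [y]: the integral is the total mass of the kernel scaled by [U v] and [v],
    whose rows are normalised. *)
Let mass v : bpos v -> \int[nu]_y (v y / L v y) = 1.
Proof.
move=> pv; have [bv _] := pv; have [bU _] := pU pv.
have -> : \int[nu]_y (v y / L v y) =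
    \int[nu]_y \int[mu]_x (v y * (k x y * U v x)).
  apply: eq_Rintegral => y _; rewrite /L /V /half_step invrK.
  rewrite bRintegralZ//; apply: bmeasM => //.
  exact: (bmeas_pair1 (F := kT)).
rewrite -(bRintegral_swap mu nu (F := fun x y => v y * (k x y * U v x))).
  rewrite -[RHS](bRintegral_cst mu); apply: eq_Rintegral => x _.
  have -> : \int[nu]_y (v y * (k x y * U v x)) = \int[nu]_y (U v x * (k x y * v y)).
    by apply: eq_Rintegral => y _; rewrite mulrC mulrAC mulrC.
  rewrite bRintegralZ; last by apply: bmeasM => //; exact: bmeas_pair1 bk.
  rewrite -/(kint nu k v x) mulVf// gt_eqF//.
  exact/bpos_gt0/(bpos_kint mu nu bk kappa0 kge).
apply: bmeasM; first exact: bmeas_comp bv.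
by apply: bmeasM => //; exact: bmeas_comp bU.
Qed.

(** The ratio [v / L v] has mean 1, so it cannot lie strictly on one side of 1. This pins down the
    multiplicative constant, which contraction of ratios alone leaves free. *)
Let a_le1_le_b (a b : R) v : 0 < a -> bpos v ->
  (forall y, a * v y <= L v y) -> (forall y, L v y <= b * v y) -> a <= 1 <= b.
Proof.
move=> a0 pv av vb.
have [y0 _] := probability_inhabited nu.
have pLv := pL pv.
have Lv0 y : 0 < L v y by exact: bpos_gt0.
have v0 y : 0 < v y by exact: bpos_gt0.
have b0 : 0 < b by rewrite -(pmulr_lgt0 _ (v0 y0)) (lt_le_trans (Lv0 y0)).
have bq : bmeas (fun y => v y / L v y).
  by have [] := bposM pv (bposV pLv).
apply/andP; split.
- rewrite -invf_ge1// -(mass pv); apply: bRintegral_le => // y.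
  by rewrite ler_pdivrMr// -ler_pdivrMl ?invr_gt0// invrK.
- rewrite -invf_le1// -(mass pv); apply: bRintegral_ge => // y.
  by rewrite ler_pdivlMr// ler_pdivrMl.
Qed.

Let q := 1 - kappa ^+ 2.

Let kappa1 : kappa <= 1.
Proof.
have [x0 _] := probability_inhabited mu.
have [y0 _] := probability_inhabited nu.
exact: le_trans (kge x0 y0) _.
Qed.

Let q0 : 0 <= q. Proof. by rewrite /q subr_ge0 expr_le1// ltW. Qed.

Let q1 : q < 1. Proof. by rewrite /q gtrBl exprn_gt0. Qed.

Let vs n := iter n L (fun=> 1).

Let pvs n : bpos (vs n).
Proof.
elim: n => [|n IH]; last exact: pL.
by split; [exact: bmeas_cst | exists 1].
Qed.

(** Bounds on the ratio of successive iterates. In one step both ends move towards the common point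
    [r] by the weight [kappa ^+ 2], so the width shrinks by [q]. The lower end only increases and
    stays above [kappa], which later makes the logarithm Lipschitz. *)
Let vs_step n : exists ab : R * R, [/\ kappa <= ab.1,
  ab.2 - ab.1 <= (kappa^-1 - kappa) * q ^+ n &
  forall y, ab.1 * vs n y <= vs n.+1 y /\ vs n.+1 y <= ab.2 * vs n y].
Proof.
elim: n => [|n [[a b] [/= ka abq h]]].
  exists (kappa, kappa^-1); split => //=; first by rewrite expr0 mulr1.
  move=> y; rewrite !mulr1 /L.
  have K x : kappa <= kint nu k (fun=> 1) x <= 1.
    have b1 : bmeas (fun y => k x y * 1).
      by apply: bmeasM; [exact: bmeas_pair1 bk | exact: bmeas_cst].
    by apply/andP; split; [apply: bRintegral_ge|apply: bRintegral_le] => // ?; rewrite mulr1.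
  have HU x : 1 <= U (fun=> 1) x <= kappa^-1.
    have /andP[K1 K2] := K x; have K0 : 0 < kint nu k (fun=> 1) x by exact: lt_le_trans K1.
    by rewrite /U /half_step invf_ge1// K2 lef_pV2.
  have [bU _] := pU (pvs 0).
  have bkU : bmeas (fun x => kT y x * U (fun=> 1) x).
    by apply: bmeasM => //; exact: (bmeas_pair1 (F := kT)).
  have U0 x : 0 < U (fun=> 1) x by exact/bpos_gt0/(pU (pvs 0)).
  have K1 : kappa <= kint mu kT (U (fun=> 1)) y.
    apply: (bRintegral_ge mu bkU) => x; have /andP[u1 _] := HU x.
    by rewrite (le_trans (kge x y))// ler_peMr// (le_trans (ltW kappa0) (kge _ _)).
  have K2 : kint mu kT (U (fun=> 1)) y <= kappa^-1.
    apply: (bRintegral_le mu bkU) => x; have /andP[_ u2] := HU x.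
    by apply: le_trans u2; apply: ler_piMl; [exact: ltW | exact: kle].
  have K0 : 0 < kint mu kT (U (fun=> 1)) y by exact: lt_le_trans K1.
  rewrite /V /half_step; split; last by rewrite lef_pV2.
  by rewrite -[leLHS]invrK lef_pV2// posrE invr_gt0.
have [x0 _] := probability_inhabited mu.
have a0 : 0 < a by exact: lt_le_trans ka.
have bv' : bmeas (vs n.+1) by case: (pvs n.+1).
have C := kint_contract mu nu bk kappa0 kge kle x0 (pvs n) bv'
  (fun y => (h y).1) (fun y => (h y).2).
set r := kint nu k (vs n.+1) x0 / kint nu k (vs n) x0 in C.
have ar : a <= r.
  rewrite ler_pdivlMr; last exact/bpos_gt0/(bpos_kint mu nu bk kappa0 kge).
  have [bv _] := pvs n.
  rewrite -(kintZ _ bk)//; apply: (ler_kint _ bk kappa0 kge) => //.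
    by apply: bmeasM => //; exact: bmeas_cst.
  by move=> y; have [] := h y.
have aa' : a <= kappa ^+ 2 * r + (1 - kappa ^+ 2) * a.
  have : 0 <= kappa ^+ 2 * (r - a) by rewrite mulr_ge0 ?subr_ge0// sqr_ge0.
  by rewrite mulrBr mulrBl mul1r; lra.
exists (kappa ^+ 2 * r + (1 - kappa ^+ 2) * a,
        kappa ^+ 2 * r + (1 - kappa ^+ 2) * b); split => /=.
- exact: le_trans aa'.
- rewrite (_ : _ - _ = q * (b - a)); last by rewrite /q; ring.
  by rewrite exprS mulrCA ler_wpM2l.
- have a0' := lt_le_trans a0 aa'.
  exact: (L_mono a0' (pvs n) (pvs n.+1) (fun x => (C x).1) (fun x => (C x).2)).
Qed.

Let ln_le_sub1 (b : R) : 0 < b -> ln b <= b - 1.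
Proof. by move=> b0; have := expR_ge1Dx (ln b); rewrite lnK// lerBrDl. Qed.

(** The ratio lies in an interval [[a, b]] that contains 1, and [ln] has slope at most
    [a^-1 <= kappa^-1] there. *)
Let ln_step n y : `|ln (vs n.+1 y) - ln (vs n y)| <=
  (kappa^-1 - kappa) / kappa * q ^+ n.
Proof.
have [[a b] [/= ka abq h]] := vs_step n; have [h1 h2] := h y.
have a0 : 0 < a by exact: lt_le_trans ka.
have /andP[a1 b1] : a <= 1 <= b.
  by apply: (a_le1_le_b a0 (pvs n)) => y'; have [] := h y'.
have b0 : 0 < b by exact: lt_le_trans b1.
have v0 : 0 < vs n y by exact: bpos_gt0.
have v0' : 0 < vs n.+1 y by exact/bpos_gt0/(pvs n.+1).
rewrite -ln_div ?posrE// mulrAC; set z := vs n.+1 y / vs n y.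
have za : a <= z by rewrite ler_pdivlMr.
have zb : z <= b by rewrite ler_pdivrMr.
have z0 : 0 < z by exact: lt_le_trans za.
apply: (@le_trans _ _ ((b - a) / kappa)); last by rewrite ler_pM2r ?invr_gt0.
have K1 : 1 <= kappa^-1 by rewrite invf_ge1.
rewrite ler_norml; apply/andP; split.
  have : ln a^-1 <= a^-1 - 1 by apply: ln_le_sub1; rewrite invr_gt0.
  rewrite lnV ?posrE// => lna.
  have lnaz : ln a <= ln z by rewrite ler_ln.
  have : a^-1 - 1 <= (b - a) / kappa.
    rewrite (_ : _ - _ = (1 - a) / a); last by field; rewrite gt_eqF.
    by rewrite ler_pM ?subr_ge0 ?invr_ge0 ?(ltW a0)// ?lerD2r// lef_pV2.
  by lra.
rewrite (le_trans (ln_le_sub1 z0))// (@le_trans _ _ (b - a))//; first by lra.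
by rewrite ler_peMr// subr_ge0 (le_trans a1).
Qed.

Let squeeze_norm (b b' l u z : R) : b' <= b -> - b + l <= z -> z <= b + l ->
  `|u - l| <= b' -> `|z - u| <= 2 * b.
Proof. by rewrite !ler_norml; lra. Qed.

Let ln_bounds (b w z : R) : 0 < w -> 0 < z -> expR (- b) * w <= z -> z <= expR b * w ->
  - b + ln w <= ln z <= b + ln w.
Proof.
move=> w0 z0 h1 h2; rewrite -[X in X && _]ler_expR -[X in _ && X]ler_expR !expRD !lnK//.
by rewrite h1 h2.
Qed.

(** The logarithms of the iterates converge geometrically and uniformly, so the limit is bounded and
    measurable. It is fixed by [L]: the bounds [expR (- (B * q ^+ n))] and [expR (B * q ^+ n)]
    between [v] and the iterate [vs n] pass to [L v] and [vs n.+1], whence [ln (L v)] and [ln v]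
    differ by at most [2 * B * q ^+ n] for every [n]. *)
Lemma sinkhorn_fixed_point : exists u v, [/\ bpos u, bpos v,
  forall x, u x * \int[nu]_y (k x y * v y) = 1 &
  forall y, v y * \int[mu]_x (k x y * u x) = 1].
Proof.
set B := (kappa^-1 - kappa) / kappa / (1 - q).
have lex y : exists l, forall n, `|l - ln (vs n y)| <= B * q ^+ n.
  by apply: geometric_limit => // n; exact: ln_step.
clearbody B; pose l y := sval (cid (lex y)).
have lP y n : `|l y - ln (vs n y)| <= B * q ^+ n by rewrite /l; case: cid.
have B0 : 0 <= B.
  have [y0 _] := probability_inhabited nu.
  by have := lP y0 0; rewrite expr0 mulr1; exact: le_trans.
have bl : bmeas l.
  split; last first.
    exists B => y; have := lP y 0.
    by rewrite expr0 mulr1 [ln _]ln1 subr0.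
  apply: (@measurable_fun_cvg _ _ _ _ (fun n y => ln (vs n y))).
    by move=> n; have [] := bpos_ln (pvs n).
  move=> y _; apply/cvgrPdist_le => e e0.
  have cB : B * q ^+ n @[n --> \oo] --> B * 0.
    by apply: cvgMr; apply: cvg_expr; rewrite ger0_norm.
  rewrite mulr0 in cB; have /cvgrPdist_le/(_ e e0) := cB.
  apply: filterS => n; rewrite sub0r normrN ger0_norm; last first.
    by rewrite mulr_ge0// exprn_ge0.
  exact: le_trans (lP y n).
pose v y := expR (l y).
have pv : bpos v by exact: bpos_expR.
exists (U v), v; split => //; first exact: pU.
  by move=> x; rewrite mulVf// gt_eqF//; exact/bpos_gt0/(bpos_kint mu nu bk kappa0 kge).
suff LvE y : L v y = v y.
  move=> y; rewrite -[v y]LvE mulVf// gt_eqF//.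
  by apply/bpos_gt0/(bpos_kint nu mu bkT kappa0 kgeT) => //; exact: pU.
have Lv0 : 0 < L v y by exact/bpos_gt0/pL.
have v0 : 0 < v y by exact: bpos_gt0.
suff lnE : ln (L v y) - ln (v y) = 0.
  by apply: ln_inj; rewrite ?posrE//; exact/subr0_eq.
apply: (@geometric_eq0 _ _ (2 * B) q) => // n.
have lv0 : 0 < vs n.+1 y by exact/bpos_gt0/(pvs n.+1).
have lo x : expR (- (B * q ^+ n)) * kint nu k (vs n) x <= kint nu k v x.
  have [bv _] := pvs n; have [bv' _] := pv.
  rewrite -(kintZ _ bk)//; apply: (ler_kint _ bk kappa0 kge) => //.
    by apply: bmeasM => //; exact: bmeas_cst.
  move=> y'; rewrite -[vs n y']lnK ?posrE ?(bpos_gt0 _ (pvs n))// -expRD ler_expR.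
  by have := lP y' n; rewrite ler_norml; lra.
have up x : kint nu k v x <= expR (B * q ^+ n) * kint nu k (vs n) x.
  have [bv _] := pvs n; have [bv' _] := pv.
  rewrite -(kintZ _ bk)//; apply: (ler_kint _ bk kappa0 kge) => //.
    by apply: bmeasM => //; exact: bmeas_cst.
  move=> y'; rewrite -[vs n y']lnK ?posrE ?(bpos_gt0 _ (pvs n))// -expRD ler_expR.
  by have := lP y' n; rewrite ler_norml; lra.
have [] := L_mono (expR_gt0 _) (pvs n) pv lo up y.
rewrite -[L (vs n)]/(vs n.+1) => h1 h2.
have /andP[k1 k2] := ln_bounds lv0 Lv0 h1 h2.
have Bq : B * q ^+ n.+1 <= B * q ^+ n.
  by rewrite exprS mulrCA ler_piMl ?(ltW q1)// mulr_ge0// exprn_ge0.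
rewrite /v expRK -mulrA; exact: squeeze_norm Bq k1 k2 (lP y n.+1).
Qed.

End sinkhorn_fixed_point.

Section schrodinger_system.
Context {d1 d2} {T1 : measurableType d1} {T2 : measurableType d2} {R : realType}.
Variables (mu : probability T1 R) (nu : probability T2 R).
Variables (c : T1 -> T2 -> R) (eps : R).
Implicit Types (f : T1 -> R) (g : T2 -> R).

Definition gibbs f g x y : R := expR ((f x + g y - c x y) / eps).

(** The constraints hold at every point, not only almost everywhere. Replacing one marginal by any
    other measure then keeps the total Gibbs mass equal to 1, and the potentials can be evaluated at
    arbitrary sample points. *)
Definition schrodinger f g :=
  [/\ bmeas f, bmeas g,
      forall x, \int[nu]_y gibbs f g x y = 1 &
      forall y, \int[mu]_x gibbs f g x y = 1].

Hypothesis bc : bmeas (fun z : T1 * T2 => c z.1 z.2).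
Hypothesis eps0 : 0 < eps.

Lemma bmeas_gibbs f g : bmeas f -> bmeas g ->
  bmeas (fun z : T1 * T2 => gibbs f g z.1 z.2).
Proof.
move=> bf bg; apply: bmeas_expR; apply: bmeasM; last exact: bmeas_cst.
apply: bmeasB => //; apply: bmeasD.
  exact: (bmeas_comp (g := fst) _ bf).
exact: (bmeas_comp (g := snd) _ bg).
Qed.

Lemma gibbs_gt0 f g x y : 0 < gibbs f g x y. Proof. exact: expR_gt0. Qed.

(** If [f x - f x'] exceeded [D], the row of [gibbs] at [x] would dominate the row at [x'] by a
    constant factor above 1, yet both integrate to 1. So [f] inherits every modulus of continuity of
    the cost, whatever [eps] is. *)
Lemma schrodinger_modulus f g x x' (D : R) : schrodinger f g ->
  (forall y, c x y - c x' y <= D) -> f x - f x' <= D.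
Proof.
move=> [bf bg fgx _] cD; have bG := bmeas_gibbs bf bg.
rewrite leNgt; apply/negP => Df.
suff : expR ((f x - f x' - D) / eps) <= 1.
  rewrite -expR0 ler_expR leNgt => /negP; apply.
  by rewrite divr_gt0// subr_gt0.
rewrite -[leRHS](fgx x) -[leLHS]mulr1 -[X in _ * X <= _](fgx x') -bRintegralZ; last exact: bmeas_pair1 bG.
apply: ler_bRintegral => [||y]; [| exact: bmeas_pair1 bG |].
  by apply: bmeasM; [exact: bmeas_cst | exact: bmeas_pair1 bG].
rewrite -expRD ler_expR -mulrDl ler_pM2r ?invr_gt0//.
by have := cD y; lra.
Qed.

Lemma schrodinger_ex (M : R) : (forall x y, 0 <= c x y <= M) ->
  exists f g, [/\ schrodinger f g, forall x, `|f x| <= M &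
    forall y, `|g y| <= 2 * M].
Proof.
move=> cM.
have bk : bmeas (fun z : T1 * T2 => expR (- (c z.1 z.2 / eps))).
  by apply/bmeas_expR/bmeasN/bmeasM => //; exact: bmeas_cst.
have kge x y : expR (- (M / eps)) <= expR (- (c x y / eps)).
  by rewrite ler_expR lerN2 ler_pM2r ?invr_gt0//; case/andP: (cM x y).
have kle x y : expR (- (c x y / eps)) <= 1.
  by rewrite -expR0 ler_expR oppr_le0 divr_ge0 ?(ltW eps0)//; case/andP: (cM x y).
have [u [v [pu pv uE vE]]] := sinkhorn_fixed_point mu nu
  (k := fun x y => expR (- (c x y / eps))) bk (expR_gt0 _) kge kle.
have [x0 _] := probability_inhabited mu.
(* A constant may be moved between the potentials. Fixing [f x0 = 0] turns the bound [M] on the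
   oscillation of [f] into a bound on [f]. *)
pose f x := eps * (ln (u x) - ln (u x0)).
pose g y := eps * (ln (v y) + ln (u x0)).
have gE x y : gibbs f g x y = u x * (expR (- (c x y / eps)) * v y).
  rewrite /gibbs (_ : _ / eps = ln (u x) + (- (c x y / eps) + ln (v y))).
    by rewrite !expRD !lnK ?posrE ?(bpos_gt0 _ pu) ?(bpos_gt0 _ pv).
  by rewrite /f /g; field; rewrite gt_eqF.
have S : schrodinger f g.
  have [bv _] := pv; have [bu _] := pu.
  split => [||x|y].
  - by apply: bmeasM; [exact: bmeas_cst | apply: bmeasB; [exact: bpos_ln | exact: bmeas_cst]].
  - by apply: bmeasM; [exact: bmeas_cst | apply: bmeasD; [exact: bpos_ln | exact: bmeas_cst]].
  - rewrite -(uE x) -bRintegralZ; first by apply: eq_Rintegral => y _; exact: gE.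
    by apply: bmeasM => //; exact: (bmeas_pair1 (F := fun x y => expR (- (c x y / eps)))).
  - rewrite -(vE y) -bRintegralZ.
      by apply: eq_Rintegral => x _; rewrite gE; ring.
    by apply: bmeasM => //; exact: (bmeas_pair2 (F := fun x y => expR (- (c x y / eps)))).
have fx0 : f x0 = 0 by rewrite /f subrr mulr0.
have fM x : `|f x| <= M.
  have h x1 x2 : f x1 - f x2 <= M.
    apply: (schrodinger_modulus S) => y.
    by have := cM x1 y; have := cM x2 y; lra.
  by rewrite ler_norml; have := h x x0; have := h x0 x; rewrite fx0; lra.
exists f, g; split => // y; have [bf bg _ gy] := S.
have bG : bmeas (fun x => gibbs f g x y) by exact: (bmeas_pair2 (F := gibbs f g)) (bmeas_gibbs bf bg).
(* The column constraint, with [|f| <= M] and [0 <= c <= M] inserted, confines [g] to the interval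
   from [- M] to [2 * M]. *)
have g1 : 1 <= expR ((g y + M) / eps).
  rewrite -{1}(gy y); apply: bRintegral_le => // x.
  rewrite ler_expR ler_pM2r ?invr_gt0//.
  by have := fM x; have := cM x y; rewrite ler_norml; lra.
have g2 : expR ((g y - 2 * M) / eps) <= 1.
  rewrite -[leRHS](gy y); apply: bRintegral_ge => // x.
  rewrite ler_expR ler_pM2r ?invr_gt0//.
  by have := fM x; have := cM x y; rewrite ler_norml; lra.
rewrite -[X in X <= _]expR0 ler_expR pmulr_lge0 ?invr_gt0// in g1.
rewrite -[X in _ <= X]expR0 ler_expR pmulr_lle0 ?invr_gt0// in g2.
have [y0 _] := probability_inhabited nu.
by have := cM x0 y0; rewrite ler_norml; lra.
Qed.

End schrodinger_system.

(** * Duality *)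

Section entropy_gibbs.
Local Open Scope charge_scope.
Context {dT} {T : measurableType dT} {R : realType}.

(** The function [q], later a log density, need not be integrable. It is replaced by
    [maxe (l z) (q z)], equal to it almost everywhere, whose negative part is dominated by that of
    [l]. *)
Lemma le_integral_ae (gamma : probability T R) (l q : T -> \bar R) (N : set T) :
  gamma.-integrable setT l -> measurable_fun setT q ->
  measurable N -> gamma N = 0%E -> (forall z, ~ N z -> (l z <= q z)%E) ->
  (\int[gamma]_z l z <= \int[gamma]_z q z)%E.
Proof.
move=> il mq mN N0 lq.
have ml := measurable_int _ il.
have -> : (\int[gamma]_z q z = \int[gamma]_z (maxe (l z) (q z)))%E.
  apply: ae_eq_integral => //; first exact: measurable_maxe.
  exists N; split => // z /=; apply: contra_notP => Nz _.
  by rewrite max_r//; exact: lq.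
rewrite integralE [leRHS]integralE leeB//.
- apply: ge0_le_integral => //; do ?exact: measurable_funepos.
    by apply: measurable_funepos; exact: measurable_maxe.
  by move=> z _; rewrite !funeposE ge_max !le_max !lexx !orbT.
- apply: ge0_le_integral => //; do ?exact: measurable_funeneg.
    by apply: measurable_funeneg; exact: measurable_maxe.
  move=> z _; rewrite !funenegE ge_max !le_max lexx !orbT andbT.
  by rewrite leeN2 le_max lexx.
Qed.

Lemma measurable_lne_fin (r : T -> \bar R) : measurable_fun setT r ->
  (forall z, r z \is a fin_num) -> measurable_fun setT (fun z => lne (r z)).
Proof.
move=> mr fr.
have mfr : measurable_fun setT (fun z => fine (r z)) by exact: measurableT_comp.
have -> : (fun z => lne (r z)) = (fun z => if (0 < fine (r z))%R
   then (ln (fine (r z)))%:E else -oo%E).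
  apply/funext => z; rewrite -{1}(fineK (fr z)); case: ifPn => r0.
    by rewrite lne_EFin.
  by rewrite le0_lneNy// lee_fin leNgt.
apply: measurable_fun_ifT => //.
  exact: measurable_fun_ltr.
apply/measurable_EFinP; exact: measurableT_comp.
Qed.

Variables (gamma : probability T R) (pi : {finite_measure set T -> \bar R}).

(** For the density [r] of gamma, [1 + ln t <= t] at [t = expR h / r] gives
    [ln r >= h + 1 - expR h / r]. Integrating against gamma turns the last term into at most the
    integral of [expR h] against pi. This is the Donsker-Varadhan bound with the logarithm
    linearised. *)
Lemma gibbs_variational (h : T -> R) : bmeas h ->
  ((\int[gamma]_z h z + 1)%R%:E - \int[pi]_z (expR (h z))%:E <=
   rel_entropy gamma pi)%E.
Proof.
move=> bh; rewrite /rel_entropy; case: asboolP => [gp|_]; last exact: leey.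
have bexp := bmeas_expR bh.
pose r := Radon_Nikodym_SigmaFinite.f gamma pi.
have fr z : r z \is a fin_num by exact: Radon_Nikodym_SigmaFinite.f_fin_num.
have r0 z : (0 <= r z)%E by exact: Radon_Nikodym_SigmaFinite.f_ge0.
have mr : measurable_fun setT r.
  exact: measurable_int (Radon_Nikodym_SigmaFinite.f_integrable gp).
pose rr z := fine (r z).
have mrr : measurable_fun setT rr by exact: measurableT_comp.
have rE z : r z = (rr z)%:E by rewrite /rr fineK.
have rr0 z : 0 <= rr z by rewrite -lee_fin -rE.
(* The derivative of the charge is exchanged for a version that is finite and nonnegative at every
   point. *)
have -> : (\int[gamma]_z lne (('d (charge_of_finite_measure gamma) '/d pi) z) =
           \int[gamma]_z lne (r z))%E.
  apply: ae_eq_integral => //.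
  - apply: measurable_lne_fin => // z; exact: Radon_Nikodym_fin_num.
  - exact: measurable_lne_fin.
  - apply: (null_dominates_ae_eq _ gp) => //.
    have := ae_eq_Radon_Nikodym_SigmaFinite gp measurableT.
    by apply: filterS => z /= rz _; rewrite -rz.
pose N := [set z | rr z <= 0].
have mN : measurable N.
  rewrite (_ : N = rr @^-1` `]-oo, 0]%classic).
    by rewrite -[X in measurable X]setTI; exact: mrr.
  by apply/seteqP; split => z; rewrite /N /= in_itv.
have N0 : gamma N = 0%E.
  rewrite (Radon_Nikodym_SigmaFinite.f_integral gp mN) -/r.
  rewrite integral0_eq// => z Nz; rewrite rE; congr EFin.
  by apply/eqP; rewrite eq_le rr0 andbT.
(* Zero where the density vanishes, a gamma-null set. Pi may charge that set, which is why [Jle] is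
   an inequality. *)
pose E z := if 0 < rr z then expR (h z) / rr z else 0.
have mE : measurable_fun setT E.
  have -> : E = fun z => if 0 < rr z then expR (h z - ln (rr z)) else 0.
    apply/funext => z; rewrite /E; case: ifPn => // rz0.
    by rewrite expRB lnK ?posrE.
  apply: measurable_fun_ifT => //; first exact: measurable_fun_ltr.
  apply: measurableT_comp => //; apply: measurable_funB; first by case: bh.
  exact: measurableT_comp.
have E0 z : 0 <= E z.
  by rewrite /E; case: ifP => // ?; rewrite divr_ge0 ?expR_ge0.
have Jle : (\int[gamma]_z (E z)%:E <= \int[pi]_z (expR (h z))%:E)%E.
  rewrite -(Radon_Nikodym_SigmaFinite.change_of_variables gp (f := EFin \o E))//.
  - apply: ge0_le_integral => //.
    + by move=> z _; rewrite -/r mule_ge0// lee_fin.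
    + by apply: emeasurable_funM => //; exact/measurable_EFinP.
    + by apply/measurable_EFinP; case: bexp.
    + move=> z _ /=; rewrite -/r rE -EFinM lee_fin /E.
      case: ifPn => rz0; first by rewrite divfK// gt_eqF.
      by rewrite mul0r expR_ge0.
  - exact/measurable_EFinP.
have piE : (\int[pi]_z (expR (h z))%:E < +oo)%E.
  have [_ [M hM]] := bexp.
  apply: (@le_lt_trans _ _ (\int[pi]_z (cst M%:E z))%E).
    apply: ge0_le_integral => //.
    - by apply/measurable_EFinP; case: bexp.
    - by move=> z _ /=; rewrite lee_fin (le_trans (ler_norm _)).
  rewrite integral_cst// lte_mul_pinfty//.
    have [z0 _] := probability_inhabited gamma.
    by rewrite lee_fin (le_trans _ (hM z0)).
  by rewrite -ge0_fin_numE// fin_num_measure.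
have iE : gamma.-integrable setT (EFin \o E).
  apply/integrableP; split; first exact/measurable_EFinP.
  under eq_integral do rewrite /= ger0_norm//.
  exact: le_lt_trans Jle piE.
have bh1 : bmeas (fun z => h z + 1) by apply: bmeasD => //; exact: bmeas_cst.
have ih1 := bmeas_integrable gamma bh1.
apply: (@le_trans _ _ (\int[gamma]_z (h z + 1 - E z)%:E)%E).
  rewrite integralB_EFin// -Rintegral_EFin// bRintegralD//; last exact: bmeas_cst.
  by rewrite bRintegral_cst leeB.
apply: (@le_integral_ae _ _ _ N) => //.
- have := integrableB measurableT ih1 iE.
  by apply: eq_integrable.
- exact: measurable_lne_fin.
- move=> z /= /negP; rewrite -ltNge => rz0.
  rewrite rE lne_EFin// lee_fin /E rz0.
  have t0 : 0 < expR (h z) / rr z by rewrite divr_gt0 ?expR_gt0.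
  have := expR_ge1Dx (ln (expR (h z) / rr z)).
  by rewrite lnK ?posrE// ln_div ?posrE ?expR_gt0// expRK; lra.
Qed.

End entropy_gibbs.

Section density_probability.
Context {dT} {T : measurableType dT} {R : realType}.
Variables (pi : probability T R) (p : T -> R).
Hypotheses (bp : bmeas p) (p0 : forall z, 0 <= p z) (p1 : \int[pi]_z p z = 1).

Definition density_measure (A : set T) : \bar R := (\int[pi]_(z in A) (p z)%:E)%E.

Let m0 : density_measure set0 = 0%E.
Proof. by rewrite /density_measure integral_set0. Qed.

Let m_ge0 A : (0 <= density_measure A)%E.
Proof. by apply: integral_ge0 => z _; rewrite lee_fin. Qed.

Let m_sigma_additive : semi_sigma_additive density_measure.
Proof.
apply: semi_sigma_additive_nng_induced => [|z]; last by rewrite lee_fin.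
by apply/measurable_EFinP; case: bp.
Qed.

HB.instance Definition _ := isMeasure.Build _ _ _ density_measure
  m0 m_ge0 m_sigma_additive.

Let m1 : density_measure setT = 1%E.
Proof. by rewrite /density_measure -Rintegral_EFin// p1. Qed.

HB.instance Definition _ :=
  Measure_isProbability.Build _ _ _ density_measure m1.

Lemma density_probability_ex : exists gamma : probability T R,
  forall A, measurable A -> gamma A = (\int[pi]_(z in A) (p z)%:E)%E.
Proof. by exists density_measure. Qed.

End density_probability.

Section entropy_density.
Local Open Scope charge_scope.
Context {dT} {T : measurableType dT} {R : realType}.
Variables (gamma : probability T R) (pi : {finite_measure set T -> \bar R}).

Lemma rel_entropy_density (h : T -> R) : bmeas h ->
  (forall A, measurable A -> gamma A = (\int[pi]_(z in A) (expR (h z))%:E)%E) ->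
  rel_entropy gamma pi = (\int[gamma]_z h z)%:E.
Proof.
move=> bh gE; rewrite /rel_entropy.
have gp : gamma `<< pi.
  apply/null_content_dominatesP => A mA pA; rewrite gE//.
  by rewrite null_set_integral//; apply/measurable_EFinP/measurable_funTS;
     case: (bmeas_expR bh).
rewrite asboolT// Rintegral_EFin//; apply: ae_eq_integral => //.
- by apply: measurable_lne_fin => // z; exact: Radon_Nikodym_fin_num.
- by apply/measurable_EFinP; case: bh.
- apply: (null_dominates_ae_eq _ gp) => //.
  have : ae_eq pi setT ('d (charge_of_finite_measure gamma) '/d pi)
      (fun z => (expR (h z))%:E).
    apply: integral_ae_eq => //; first exact: Radon_Nikodym_integrable.
      by apply/measurable_EFinP; case: (bmeas_expR bh).
    move=> A _ mA; rewrite -Radon_Nikodym_integral//; exact: gE.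
  apply: filterS => z /= rz _; rewrite rz// lne_EFin ?expR_gt0// expRK//.
Qed.

End entropy_density.

Section entropic_duality.
Context {R : realType} {d : nat}.
Local Notation Rd := (d.-tuple R).
Variables (c : Rd -> Rd -> R) (lambda : R) (mu nu : probability Rd R).
Hypothesis bc : bmeas (fun z : Rd * Rd => c z.1 z.2).
Hypothesis lambda0 : 0 < lambda.
Let eps := 2 * lambda.

(** Same form as [eot_objective], for an arbitrary cost, so that duality can be applied to the
    truncated one. *)
Definition cost_objective (gamma : probability (Rd * Rd)%type R) : \bar R :=
  (\int[gamma]_z (c z.1 z.2)%:E +
   (2 * lambda)%:E * rel_entropy gamma (product_of mu nu))%E.

Lemma coupling_fst gamma (f : Rd -> R) : couplings mu nu gamma -> bmeas f ->
  \int[gamma]_z f z.1 = \int[mu]_x f x.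
Proof. by move=> [g1 _] bf; apply/esym/bRintegral_image => // A mA; rewrite g1. Qed.

Lemma coupling_snd gamma (f : Rd -> R) : couplings mu nu gamma -> bmeas f ->
  \int[gamma]_z f z.2 = \int[nu]_x f x.
Proof. by move=> [_ g2] bf; apply/esym/bRintegral_image => // A mA; rewrite g2. Qed.

Let eps0 : 0 < eps. Proof. exact: mulr_gt0. Qed.

(** The marginals of a coupling determine the integral of [f + g], so only the transport cost
    depends on gamma. This feeds weak duality, its equality case and the comparison with
    [lambda = 0]. *)
Lemma integral_log_gibbs gamma (f g : Rd -> R) : couplings mu nu gamma ->
  bmeas f -> bmeas g ->
  eps * \int[gamma]_z ((f z.1 + g z.2 - c z.1 z.2) / eps) =
  \int[mu]_x f x + \int[nu]_y g y - \int[gamma]_z c z.1 z.2.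
Proof.
move=> cg bf bg.
have bf1 : bmeas (fun z : Rd * Rd => f z.1) by exact: (bmeas_comp (g := fst) _ bf).
have bg2 : bmeas (fun z : Rd * Rd => g z.2) by exact: (bmeas_comp (g := snd) _ bg).
rewrite bRintegralZr; last by apply: bmeasB => //; exact: bmeasD.
rewrite bRintegralB//; last exact: bmeasD.
rewrite bRintegralD// (coupling_fst cg)// (coupling_snd cg)//.
by rewrite mulrC divfK// gt_eqF.
Qed.

(** The Gibbs variational inequality for the logarithm of [gibbs], times [eps]. Since [f] and [g]
    are arbitrary, potentials of other measures may be inserted. *)
Lemma weak_duality gamma (f g : Rd -> R) : couplings mu nu gamma ->
  bmeas f -> bmeas g ->
  ((\int[mu]_x f x + \int[nu]_y g y -
    eps * (\int[mu]_x \int[nu]_y gibbs c eps f g x y - 1))%:E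
   <= cost_objective gamma)%E.
Proof.
move=> cg bf bg; pose h (z : Rd * Rd) := (f z.1 + g z.2 - c z.1 z.2) / eps.
have bG := bmeas_gibbs eps bc bf bg.
have bh : bmeas h.
  apply: bmeasM; last exact: bmeas_cst.
  apply: bmeasB => //; apply: bmeasD.
    exact: (bmeas_comp (g := fst) _ bf).
  exact: (bmeas_comp (g := snd) _ bg).
have := gibbs_variational gamma (product_of mu nu) bh.
have -> : (\int[product_of mu nu]_z (expR (h z))%:E)%E =
    (\int[mu]_x \int[nu]_y gibbs c eps f g x y)%:E.
  by rewrite -bRintegral_prod// Rintegral_EFin.
rewrite -EFinB /cost_objective => hle.
apply: (@le_trans _ _ (\int[gamma]_z (c z.1 z.2)%:E +
  (2 * lambda)%:E * (\int[gamma]_z h z + 1 -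
    \int[mu]_x \int[nu]_y gibbs c eps f g x y)%:E)%E); last first.
  by rewrite leeD2l// lee_wpmul2l// lee_fin ltW.
rewrite -Rintegral_EFin// -EFinM -EFinD lee_fin -/eps.
have E : eps * \int[gamma]_z h z = _ := integral_log_gibbs cg bf bg.
by move: E; lra.
Qed.

(** The density [gibbs] has the prescribed marginals by the two constraints, and its entropy is
    exactly the integral of its logarithm, so the duality gap closes. *)
Lemma schrodinger_coupling (f g : Rd -> R) : schrodinger mu nu c eps f g ->
  exists2 gamma, couplings mu nu gamma &
    cost_objective gamma = (\int[mu]_x f x + \int[nu]_y g y)%:E.
Proof.
move=> [bf bg fg1 fg2]; pose h (z : Rd * Rd) := (f z.1 + g z.2 - c z.1 z.2) / eps.
have bG := bmeas_gibbs eps bc bf bg.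
have bh : bmeas h.
  apply: bmeasM; last exact: bmeas_cst.
  apply: bmeasB => //; apply: bmeasD.
    exact: (bmeas_comp (g := fst) _ bf).
  exact: (bmeas_comp (g := snd) _ bg).
pose p z := expR (h z).
have p1 : \int[prod_prob mu nu]_z p z = 1.
  rewrite (bRintegral_prod mu nu (F := gibbs c eps f g))//.
  by under eq_Rintegral do rewrite fg1; exact: bRintegral_cst.
have [gamma gE] := density_probability_ex (bmeas_expR bh)
  (fun z => expR_ge0 (h z)) p1.
have gE' A : measurable A -> gamma A = (\int[prod_prob mu nu]_z (p z * \1_A z))%:E.
  move=> mA; rewrite gE// Rintegral_EFin; last first.
    by apply: bmeasM; [exact: bmeas_expR | exact: bmeas_indic].
  by rewrite integral_mkcond; apply: eq_integral => z _; rewrite epatch_indic.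
have mfst (A : set Rd) : measurable A -> measurable (@fst Rd Rd @^-1` A).
  by move=> mA; rewrite -[X in measurable X]setTI; exact: measurable_fst.
have msnd (A : set Rd) : measurable A -> measurable (@snd Rd Rd @^-1` A).
  by move=> mA; rewrite -[X in measurable X]setTI; exact: measurable_snd.
have cg : couplings mu nu gamma.
  split=> A mA; (rewrite gE'; last by [exact: mfst | exact: msnd]).
  - have bA := bmeas_indic (R := R) mA.
    rewrite (bRintegral_prod mu nu (F := fun x y => gibbs c eps f g x y * \1_A x)).
      rewrite -bRintegral_indic//; congr EFin; apply: eq_Rintegral => x _.
      rewrite bRintegralZr ?fg1 ?mul1r//; exact: bmeas_pair1 bG.
    by apply: bmeasM => //; exact: (bmeas_comp (g := fst) _ bA).
  - have bA := bmeas_indic (R := R) mA.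
    rewrite (bRintegral_prod2 mu nu (F := fun x y => gibbs c eps f g x y * \1_A y)).
      rewrite -bRintegral_indic//; congr EFin; apply: eq_Rintegral => y _.
      rewrite bRintegralZr ?fg2 ?mul1r//; exact: bmeas_pair2 bG.
    by apply: bmeasM => //; exact: (bmeas_comp (g := snd) _ bA).
exists gamma => //; rewrite /cost_objective (rel_entropy_density bh); last exact: gE.
rewrite -Rintegral_EFin// -EFinM -EFinD.
have E : eps * \int[gamma]_z h z = _ := integral_log_gibbs cg bf bg.
by rewrite -/eps E; congr EFin; lra.
Qed.

Definition cost_eot : \bar R :=
  ereal_inf [set cost_objective gamma | gamma in couplings mu nu].

Lemma cost_eot_ge (f g : Rd -> R) : bmeas f -> bmeas g ->
  ((\int[mu]_x f x + \int[nu]_y g y -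
    eps * (\int[mu]_x \int[nu]_y gibbs c eps f g x y - 1))%:E <= cost_eot)%E.
Proof.
by move=> bf bg; apply: le_ereal_inf_tmp => _ [gamma cg <-]; exact: weak_duality.
Qed.

Lemma cost_eot_schrodinger (f g : Rd -> R) : schrodinger mu nu c eps f g ->
  cost_eot = (\int[mu]_x f x + \int[nu]_y g y)%:E.
Proof.
move=> S; apply/eqP; rewrite eq_le; apply/andP; split.
  have [gamma cg <-] := schrodinger_coupling S.
  by apply: ereal_inf_lbound; exists gamma.
have [bf bg fg1 _] := S; have := cost_eot_ge bf bg.
have -> : \int[mu]_x \int[nu]_y gibbs c eps f g x y = 1.
  by under eq_Rintegral do rewrite fg1; exact: bRintegral_cst.
by rewrite subrr mulr0 subr0.
Qed.

End entropic_duality.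

(** * Truncated cost and empirical measures *)

Section truncated_cost.
Context {R : realType} {d : nat}.
Local Notation Rd := (d.-tuple R).
Implicit Types (x y : Rd) (mu nu : probability Rd R).

Lemma sqr_euclid_dist x y :
  euclid_dist x y ^+ 2 = \sum_(i < d) (tnth y i - tnth x i) ^+ 2.
Proof. by rewrite sqr_sqrtr// sumr_ge0// => i _; exact: sqr_ge0. Qed.

(* Truncation leaves the transport problem unchanged between measures carried by
   a set of small diameter, and makes the cost, hence the potentials, bounded
   on the whole space. *)
Definition trunc_cost (M : R) x y : R := Num.min (euclid_dist x y ^+ 2) M.

Lemma measurable_euclid_dist_sqr :
  measurable_fun [set: Rd * Rd] (fun z : Rd * Rd => euclid_dist z.1 z.2 ^+ 2).
Proof.
under eq_fun do rewrite sqr_euclid_dist.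
apply: measurable_sum => i; apply: measurable_funX.
apply: measurable_funB.
  exact: (measurableT_comp (measurable_tnth i)).
exact: (measurableT_comp (measurable_tnth i)).
Qed.

Lemma trunc_cost_ge0 M x y : 0 <= M -> 0 <= trunc_cost M x y.
Proof. by move=> M0; rewrite le_min sqr_ge0. Qed.

Lemma trunc_cost_le M x y : trunc_cost M x y <= M.
Proof. by rewrite ge_min lexx orbT. Qed.

Lemma bmeas_trunc_cost M : 0 <= M ->
  bmeas (fun z : Rd * Rd => trunc_cost M z.1 z.2).
Proof.
move=> M0; split.
  apply: measurable_minr; [exact: measurable_euclid_dist_sqr|exact: measurable_cst].
exists M => z; rewrite ger0_norm ?trunc_cost_le//; exact: trunc_cost_ge0.
Qed.

(** A coupling of measures carried by [B] is carried by the square of [B], where both costs agree;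
    the entropy term does not see the cost. *)
Lemma eot_trunc (M : R) (lambda : R) mu nu (B : set Rd) : 0 <= M ->
  measurable B -> mu B = 1%E -> nu B = 1%E ->
  (forall x y, B x -> B y -> euclid_dist x y ^+ 2 <= M) ->
  eot lambda mu nu = cost_eot (trunc_cost M) lambda mu nu.
Proof.
move=> M0 mB muB nuB BM; congr ereal_inf.
suff H gamma : couplings mu nu gamma ->
    eot_objective lambda mu nu gamma =
    cost_objective (trunc_cost M) lambda mu nu gamma.
  by apply/seteqP; split => _ [g cg <-]; exists g => //; rewrite H.
move=> [g1 g2]; rewrite /eot_objective /cost_objective; congr (_ + _)%E.
have mBC := measurableC mB.
have m1 : measurable (@fst Rd Rd @^-1` (~` B)).
  by rewrite -[X in measurable X]setTI; exact: measurable_fst.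
have m2 : measurable (@snd Rd Rd @^-1` (~` B)).
  by rewrite -[X in measurable X]setTI; exact: measurable_snd.
apply: ae_eq_integral => //.
- by apply/measurable_EFinP; exact: measurable_euclid_dist_sqr.
- by apply/measurable_EFinP; case: (bmeas_trunc_cost M0).
exists (fst @^-1` (~` B) `|` snd @^-1` (~` B)); split.
- exact: measurableU.
- apply/eqP; rewrite eq_le measure_ge0 andbT.
  rewrite (le_trans (measureU2 _ m1 m2))//.
  have e1 : gamma (fst @^-1` (~` B)) = 0%E.
    by rewrite g1// [LHS](probability_setC mu mB) muB subee.
  have e2 : gamma (snd @^-1` (~` B)) = 0%E.
    by rewrite g2// [LHS](probability_setC nu mB) nuB subee.
  by rewrite [X in (X + _)%E]e1 [X in (_ + X)%E]e2 adde0.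
- move=> [x y] /=; apply: contra_notP => /not_orP[/contrapT Bx /contrapT By] _.
  by rewrite /trunc_cost; congr EFin; apply/esym/min_idPl; exact: BM.
Qed.

End truncated_cost.

Section empirical_integral.
Context {dT} {T : measurableType dT} {R : realType} {n : nat}.
Variables (n_gt0 : (0 < n)%N) (x : 'I_n -> T).

Definition empirical_prob : probability T R := empirical n_gt0 x.

Lemma empirical_preimage (A : set T) : measurable A ->
  empirical_prob A = (n%:R^-1 * \sum_(i < n) \1_A (x i))%:E.
Proof.
move=> mA; rewrite [LHS]/(empirical _ _ _) /empirical EFinM; congr (_ * _)%E.
by rewrite -sumEFin; apply: eq_bigr => i _; rewrite diracE.
Qed.

Let ge0_integral_empirical (f : T -> R) : measurable_fun setT f ->
  (forall t, 0 <= f t) ->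
  (\int[empirical_prob]_t (f t)%:E = (n%:R^-1 * \sum_(i < n) f (x i))%:E)%E.
Proof.
move=> mf f0; pose i0 : 'I_n := Ordinal n_gt0.
pose m (k : nat) : {measure set T -> \bar R} := \d_(x (insubd i0 k)).
have r0 : (0 <= n%:R^-1 :> R)%R by rewrite invr_ge0 ler0n.
rewrite (eq_measure_integral (mscale (NngNum r0) (msum m n))); last first.
  move=> A mA _; rewrite [LHS]/(empirical _ _ _) /empirical /mscale /msum.
  by congr (_ * _)%E; apply: eq_bigr => i _; rewrite /m /= valKd.
have mf' : measurable_fun setT (EFin \o f) by exact/measurable_EFinP.
rewrite ge0_integral_mscale//; last by move=> t _ /=; rewrite lee_fin.
rewrite ge0_integral_measure_sum//; last by move=> t _ /=; rewrite lee_fin.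
rewrite EFinM -sumEFin; congr (_ * _)%E; apply: eq_bigr => i _.
by rewrite integral_dirac// /m valKd diracT mul1e.
Qed.

Lemma integral_empirical (f : T -> R) : bmeas f ->
  \int[empirical_prob]_t f t = n%:R^-1 * \sum_(i < n) f (x i).
Proof.
move=> bf; have [mf [M fM]] := bf.
have fM0 t : 0 <= f t + M by have := fM t; rewrite ler_norml; lra.
have bfM : bmeas (fun t => f t + M) by apply: bmeasD => //; exact: bmeas_cst.
have : \int[empirical_prob]_t (f t + M) = n%:R^-1 * \sum_(i < n) (f (x i) + M).
  by apply: EFin_inj; rewrite Rintegral_EFin// ge0_integral_empirical//; case: bfM.
rewrite bRintegralD ?bRintegral_cst//; last exact: bmeas_cst.
rewrite big_split/= sumr_const card_ord mulrDr -[M *+ n]mulr_natl mulKf.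
  by move/addIr.
by rewrite pnatr_eq0 -lt0n.
Qed.

End empirical_integral.

(** * Empirical transport costs *)

Section dual_tangent.
Context {R : realType} {n : nat}.
Variables (n_gt0 : (0 < n)%N) (eps : R).
Hypothesis eps0 : 0 < eps.
Implicit Types (a b : 'I_n -> R) (C : 'I_n -> 'I_n -> R).

Definition mean a : R := n%:R^-1 * \sum_(i < n) a i.

Definition gibbs_mx a b C i j : R := n%:R^-1 ^+ 2 * expR ((a i + b j - C i j) / eps).

(** Convexity of the exponential, jointly in the potentials and in the cost matrix. The tangent in
    the potentials measures marginal defects, the tangent in the cost the effect of moving sample
    points. *)
Lemma dual_tangent a b C a' b' C' :
  - (eps * \sum_(i < n) \sum_(j < n) gibbs_mx a' b' C' i j) <=
  - (eps * \sum_(i < n) \sum_(j < n) gibbs_mx a b C i j) -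
  \sum_(i < n) \sum_(j < n) gibbs_mx a b C i j *
    ((a' i + b' j - C' i j) - (a i + b j - C i j)).
Proof.
rewrite -opprD lerN2 mulr_sumr -big_split/= mulr_sumr ler_sum// => i _.
rewrite mulr_sumr mulr_sumr -big_split/= ler_sum// => j _.
set u := a i + b j - C i j; set u' := a' i + b' j - C' i j.
rewrite /gibbs_mx -/u -/u'.
have -> : u' / eps = u / eps + (u' - u) / eps by field; rewrite gt_eqF.
rewrite expRD; have := expR_ge1Dx ((u' - u) / eps); set e := expR ((u' - u) / eps).
move=> he; have : 1 * eps + (u' - u) <= e * eps.
  have := ler_wpM2r (ltW eps0) he.
  by rewrite mulrDl divfK ?gt_eqF.
move=> he'; set k := _ ^+ 2 * expR (u / eps).
have k0 : 0 <= k by rewrite mulr_ge0 ?expR_ge0// sqr_ge0.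
have := ler_wpM2l k0 he'; rewrite /k; lra.
Qed.

Lemma ler_mean a b : (forall i, a i <= b i) -> mean a <= mean b.
Proof. by move=> ab; rewrite ler_pM2l ?invr_gt0 ?ltr0n// ler_sum. Qed.

Lemma meanD a b : mean (fun i => a i + b i) = mean a + mean b.
Proof. by rewrite /mean big_split mulrDr. Qed.

Lemma meanB a b : mean (fun i => a i - b i) = mean a - mean b.
Proof. by rewrite /mean sumrB mulrBr. Qed.

Lemma mean_cst (r : R) : mean (fun=> r) = r.
Proof.
by rewrite /mean sumr_const card_ord -[r *+ n]mulr_natl mulKf// pnatr_eq0 -lt0n.
Qed.

Lemma meanZ (r : R) a : mean (fun i => r * a i) = r * mean a.
Proof. by rewrite /mean -mulr_sumr mulrCA. Qed.

Lemma ler_norm_mean a : `|mean a| <= mean (fun i => `|a i|).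
Proof.
rewrite /mean normrM ger0_norm ?invr_ge0 ?ler0n//.
by rewrite ler_wpM2l ?invr_ge0 ?ler0n// ler_norm_sum.
Qed.

End dual_tangent.

Section empirical_transport.
Context {R : realType} {d n : nat}.
Local Notation Rd := (d.-tuple R).
Variables (n_gt0 : (0 < n)%N) (c : Rd -> Rd -> R) (M lambda : R).
Hypothesis bc : bmeas (fun z : Rd * Rd => c z.1 z.2).
Hypothesis cM : forall x y, 0 <= c x y <= M.
Hypothesis lambda0 : 0 < lambda.
Implicit Types x y : 'I_n -> Rd.
Let eps := 2 * lambda.
Let eps0 : 0 < eps. Proof. exact: mulr_gt0. Qed.

Definition emp_cost x y : R :=
  fine (cost_eot c lambda (empirical_prob n_gt0 x) (empirical_prob n_gt0 y)).

Lemma emp_cost_schrodinger x y f g :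
  schrodinger (empirical_prob n_gt0 x) (empirical_prob n_gt0 y) c eps f g ->
  emp_cost x y = mean (f \o x) + mean (g \o y).
Proof.
move=> S; rewrite /emp_cost (cost_eot_schrodinger bc lambda0 S)/=.
by have [bf bg _ _] := S; rewrite !integral_empirical.
Qed.

Lemma schrodinger_row x y f g :
  schrodinger (empirical_prob n_gt0 x) (empirical_prob n_gt0 y) c eps f g ->
  forall t, mean (fun j => gibbs c eps f g t (y j)) = 1.
Proof.
move=> [bf bg f1 _] t; have := f1 t; rewrite integral_empirical//.
exact: bmeas_pair1 (bmeas_gibbs eps bc bf bg).
Qed.

Lemma schrodinger_col x y f g :
  schrodinger (empirical_prob n_gt0 x) (empirical_prob n_gt0 y) c eps f g ->
  forall t, mean (fun i => gibbs c eps f g (x i) t) = 1.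
Proof.
move=> [bf bg _ g1] t; have := g1 t; rewrite integral_empirical//.
exact: (bmeas_pair2 (F := gibbs c eps f g)) (bmeas_gibbs eps bc bf bg).
Qed.

Definition cost_mx x y i j : R := c (x i) (y j).

Definition dual_value a b C : R :=
  mean a + mean b -
  eps * (\sum_(i < n) \sum_(j < n) gibbs_mx (n := n) eps a b C i j - 1).

Lemma emp_cost_optimal x y : exists a b,
  let P := gibbs_mx eps a b (cost_mx x y) in
  [/\ emp_cost x y = mean a + mean b,
      forall i, \sum_(j < n) P i j = n%:R^-1 &
      forall j, \sum_(i < n) P i j = n%:R^-1].
Proof.
have [f [g [S _ _]]] := schrodinger_ex (empirical_prob n_gt0 x)
  (empirical_prob n_gt0 y) bc eps0 cM.
exists (f \o x), (g \o y); split; first exact: emp_cost_schrodinger.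
- move=> i; rewrite -[RHS]mulr1 -[X in _ = _ * X](schrodinger_row S (x i)).
  by rewrite /mean mulrA -expr2 mulr_sumr.
- move=> j; rewrite -[RHS]mulr1 -[X in _ = _ * X](schrodinger_col S (y j)).
  by rewrite /mean mulrA -expr2 mulr_sumr.
Qed.

Let sum_invn : \sum_(i < n) n%:R^-1 = 1 :> R.
Proof.
by rewrite sumr_const card_ord -[LHS]mulr_natl mulfV// pnatr_eq0 -lt0n.
Qed.

(** [P] is the optimal coupling. Its uniform marginals cancel the part of the tangent that is linear
    in the potentials, so only the change of the cost matrix, averaged by [P], remains. *)
Lemma emp_cost_subgradient x y : exists P : 'I_n -> 'I_n -> R,
  [/\ forall i j, 0 <= P i j,
      forall i, \sum_(j < n) P i j = n%:R^-1,
      forall j, \sum_(i < n) P i j = n%:R^-1 &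
      forall a b C, dual_value a b C <= emp_cost x y +
        \sum_(i < n) \sum_(j < n) P i j * (C i j - cost_mx x y i j)].
Proof.
have [a [b [TE Prow Pcol]]] := emp_cost_optimal x y.
set P := gibbs_mx eps a b (cost_mx x y) in Prow Pcol.
exists P; split => //; first by move=> i j; rewrite mulr_ge0 ?expR_ge0// sqr_ge0.
move=> a' b' C'.
have := dual_tangent eps0 a b (cost_mx x y) a' b' C'.
rewrite -/P [X in _ <= - (eps * X) - _](eq_bigr (fun=> n%:R^-1)); last first.
  by move=> i _; exact: Prow.
have -> : \sum_(i < n) \sum_(j < n) P i j *
   ((a' i + b' j - C' i j) - (a i + b j - cost_mx x y i j)) =
   mean a' - mean a + (mean b' - mean b) -
   \sum_(i < n) \sum_(j < n) P i j * (C' i j - cost_mx x y i j).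
  transitivity (\sum_(i < n) \sum_(j < n) (P i j * (a' i - a i)) +
    \sum_(i < n) \sum_(j < n) (P i j * (b' j - b j)) -
    \sum_(i < n) \sum_(j < n) P i j * (C' i j - cost_mx x y i j)).
    rewrite -big_split -sumrB; apply: eq_bigr => i _ /=.
    rewrite -big_split -sumrB; apply: eq_bigr => j _ /=; ring.
  congr (_ + _ - _).
    rewrite -meanB /mean mulr_sumr; apply: eq_bigr => i _.
    by rewrite -mulr_suml Prow.
  rewrite exchange_big -meanB /mean mulr_sumr; apply: eq_bigr => j _.
  by rewrite -mulr_suml Pcol.
by rewrite sum_invn TE /dual_value; lra.
Qed.

Lemma emp_cost_dual x y a b : dual_value a b (cost_mx x y) <= emp_cost x y.
Proof.
have [P [_ _ _ /(_ a b (cost_mx x y))]] := emp_cost_subgradient x y.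
rewrite big1 ?addr0// => i _; rewrite big1// => j _.
by rewrite subrr mulr0.
Qed.

Lemma emp_cost_attained x y :
  exists a b, dual_value a b (cost_mx x y) = emp_cost x y.
Proof.
have [a [b [TE Prow _]]] := emp_cost_optimal x y; exists a, b.
rewrite /dual_value (eq_bigr (fun=> n%:R^-1)); last by move=> i _; exact: Prow.
by rewrite sum_invn subrr mulr0 subr0.
Qed.

Lemma emp_cost_perturb x y : exists P : 'I_n -> 'I_n -> R,
  [/\ forall i j, 0 <= P i j,
      forall i, \sum_(j < n) P i j = n%:R^-1,
      forall j, \sum_(i < n) P i j = n%:R^-1 &
      forall x' y', emp_cost x' y' <= emp_cost x y +
        \sum_(i < n) \sum_(j < n) P i j * (cost_mx x' y' i j - cost_mx x y i j)].
Proof.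
have [P [P0 Prow Pcol Psub]] := emp_cost_subgradient x y; exists P; split => // x' y'.
by have [a [b <-]] := emp_cost_attained x' y'; exact: Psub.
Qed.

(** Approximating from below lowers the Gibbs mass too, so the loss comes from the two linear terms
    alone and no estimate of the exponential enters. *)
Lemma dual_value_lower (delta : R) a b a' b' C :
  (forall i, a i - delta <= a' i <= a i) ->
  (forall i, b i - delta <= b' i <= b i) ->
  dual_value a b C - 2 * delta <= dual_value a' b' C.
Proof.
move=> ha hb.
have ma : mean a - delta <= mean a'.
  rewrite -[X in _ - X](mean_cst n_gt0) -meanB; apply: ler_mean => // i.
  by case/andP: (ha i).
have mb : mean b - delta <= mean b'.
  rewrite -[X in _ - X](mean_cst n_gt0) -meanB; apply: ler_mean => // i.
  by case/andP: (hb i).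
have G : \sum_(i < n) \sum_(j < n) gibbs_mx eps a' b' C i j <=
    \sum_(i < n) \sum_(j < n) gibbs_mx eps a b C i j.
  apply: ler_sum => i _; apply: ler_sum => j _.
  rewrite /gibbs_mx ler_wpM2l ?sqr_ge0// ler_expR ler_pM2r ?invr_gt0//.
  by have := ha i; have := hb j; lra.
have := ler_wpM2l (ltW eps0) G; rewrite /dual_value; lra.
Qed.

End empirical_transport.

Section finite_set_measurable.
Context {R : realType} {d : nat}.
Local Notation Rd := (d.-tuple R).

Lemma measurable_tuple_set1 (a : Rd) : measurable [set a].
Proof.
rewrite (_ : [set a] = (fun z => euclid_dist a z ^+ 2) @^-1` [set 0]).
  rewrite -[X in measurable X]setTI.
  have := measurableT_comp (@measurable_euclid_dist_sqr R d) (pair1_measurable a).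
  by apply.
apply/seteqP; split => [_ -> /=|z /=]; rewrite sqr_euclid_dist.
  by rewrite big1// => i _; rewrite subrr expr0n.
move/eqP; rewrite psumr_eq0; last by move=> i _; exact: sqr_ge0.
move=> /allP h; apply: eq_from_tnth => i.
have := h i; rewrite mem_index_enum sqrf_eq0 subr_eq0 => /(_ isT).
by move/eqP.
Qed.

Lemma measurable_range n (x : 'I_n -> Rd) : measurable (range x).
Proof.
rewrite (_ : range x = \big[setU/set0]_(i < n) [set x i]).
  by apply: bigsetU_measurable => i _; exact: measurable_tuple_set1.
rewrite -bigcup_seq; apply/seteqP; split => [_ [i _ <-]|z [i _ ->]]; last by exists i.
by exists i => //=; rewrite mem_index_enum.
Qed.

End finite_set_measurable.

Section measurable_emp_cost.
Context {R : realType} {d n : nat}.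
Local Notation Rd := (d.-tuple R).
Variables (n_gt0 : (0 < n)%N) (c : Rd -> Rd -> R) (M lambda : R).
Hypothesis bc : bmeas (fun z : Rd * Rd => c z.1 z.2).
Hypothesis cM : forall x y, 0 <= c x y <= M.
Context {dZ} {Z : measurableType dZ}.
Variables (X Y : 'I_n -> Z -> Rd).
Hypothesis mX : forall i, measurable_fun setT (X i).
Hypothesis mY : forall i, measurable_fun setT (Y i).

(** An enumeration of the pairs of rational vectors. Indices that decode to nothing get zero
    potentials, harmless because every dual value is a lower bound. *)
Let ratv (k : nat) : ('I_n -> R) * ('I_n -> R) :=
  if @unpickle ({ffun 'I_n -> rat} * {ffun 'I_n -> rat})%type k is Some ab
  then (fun i => ratr (ab.1 i), fun i => ratr (ab.2 i)) else (fun=> 0, fun=> 0).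

Let rat_below (r e : R) : 0 < e -> exists q : rat, r - e <= ratr q <= r.
Proof.
move=> e0; have re : r - e < r by rewrite ltrBlDr ltrDl.
have [q] := rat_in_itvoo re.
by rewrite in_itv/= => /andP[h1 h2]; exists q; rewrite !ltW.
Qed.

(* The optimal potentials are not obviously measurable in the data, but the cost
   is the supremum of countably many dual values, those at rational potentials. *)
Lemma measurable_emp_cost : 0 < lambda ->
  measurable_fun setT (fun z => emp_cost n_gt0 c lambda (X^~ z) (Y^~ z)).
Proof.
move=> lambda0; have eps0 : 0 < 2 * lambda by exact: mulr_gt0.
pose h k z := dual_value lambda (ratv k).1 (ratv k).2 (cost_mx c (X^~ z) (Y^~ z)).
have mh k : measurable_fun setT (h k).
  apply: measurable_funB => //; apply: measurable_funM => //.
  apply: measurable_funB => //.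
  apply: measurable_sum => i; apply: measurable_sum => j.
  apply: measurable_funM => //; apply: measurableT_comp => //.
  apply: measurable_funM => //; apply: measurable_funB => //.
  have mXY : measurable_fun setT (fun z => (X i z, Y j z)) by exact: measurable_fun_pair.
  by case: bc => mc _; exact: (measurableT_comp mc mXY).
have hub z : has_ubound (range (h ^~ z)).
  by exists (emp_cost n_gt0 c lambda (X^~ z) (Y^~ z)) => _ [k _ <-]; exact: emp_cost_dual.
rewrite (_ : (fun z => _) = fun z => sups (h ^~ z) 0).
  by apply: measurable_fun_sups.
apply/funext => z.
have -> : sups (h ^~ z) 0 = sup (range (h ^~ z)).
  rewrite /sups; congr sup.
  by apply/seteqP; split => [_ [k _ <-]|_ [k _ <-]]; exists k.
apply/eqP; rewrite eq_le; apply/andP; split; last first.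
  apply: ge_sup; first by exists (h 0 z), 0.
  by move=> _ [k _ <-]; exact: emp_cost_dual.
have [a [b <-]] := emp_cost_attained n_gt0 bc cM lambda0 (X^~ z) (Y^~ z).
apply/ler_addgt0Pl => e e0; have e20 : 0 < e / 2 by rewrite divr_gt0.
pose qa : {ffun 'I_n -> rat} := [ffun i => sval (cid (rat_below (a i) e20))].
pose qb : {ffun 'I_n -> rat} := [ffun i => sval (cid (rat_below (b i) e20))].
have hz : h (pickle (qa, qb)) z <= sup (range (h ^~ z)).
  by apply: ub_le_sup => //; exists (pickle (qa, qb)).
have := @dual_value_lower R n n_gt0 lambda lambda0 (e / 2) a b
  (ratv (pickle (qa, qb))).1 (ratv (pickle (qa, qb))).2 (cost_mx c (X^~ z) (Y^~ z)).
rewrite /ratv pickleK /=.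
have -> : 2 * (e / 2) = e by field.
move=> /(_ _ _)/= L; rewrite addrC -lerBlDr (le_trans _ hz)// /h /ratv pickleK /=.
by apply: L => i; rewrite ffunE; case: cid.
Qed.

End measurable_emp_cost.

(** * Vanishing regularisation for empirical measures *)

Section emp_cost_zero.
Context {R : realType} {d n : nat}.
Local Notation Rd := (d.-tuple R).
Variables (n_gt0 : (0 < n)%N) (c : Rd -> Rd -> R) (M : R).
Hypothesis bc : bmeas (fun z : Rd * Rd => c z.1 z.2).
Hypothesis cM : forall x y, 0 <= c x y <= M.
Implicit Types (x y : 'I_n -> Rd) (lambda : R).

(** The entropy is nonnegative: this is the variational inequality at [h = 0]. *)
Lemma cost_objective0 lambda mu nu gamma : 0 <= lambda ->
  (cost_objective c 0 mu nu gamma <= cost_objective c lambda mu nu gamma)%E.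
Proof.
move=> l0; rewrite /cost_objective mulr0 mul0e adde0 leeDl// mule_ge0//.
  by rewrite lee_fin mulr_ge0.
have := gibbs_variational gamma (product_of mu nu) (bmeas_cst 0).
apply: le_trans; rewrite bRintegral_cst add0r.
under eq_integral do rewrite expR0.
rewrite integral_cst//= mul1e sube_ge0 ?orbT//.
exact: (@sprobability_setT _ _ _ (prod_prob mu nu)).
Qed.

Lemma cost_eot0_le lambda mu nu : 0 <= lambda ->
  (cost_eot c 0 mu nu <= cost_eot c lambda mu nu)%E.
Proof.
move=> l0; apply: le_ereal_inf_tmp => _ [gamma cg <-].
apply: le_trans (cost_objective0 _ _ _ l0).
by apply: ereal_inf_lbound; exists gamma.
Qed.

Let n0 : n%:R != 0 :> R. Proof. by rewrite pnatr_eq0 -lt0n. Qed.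

Let ln_n0 : 0 <= ln (n%:R : R). Proof. by rewrite ln_ge0// ler1n. Qed.

(* A coupling of empirical measures is supported on pairs where the Gibbs density
   is at most [n], whence the loss of [2 * lambda * ln n]. *)
Lemma cost_eot0_ge lambda x y : 0 < lambda ->
  ((emp_cost n_gt0 c lambda x y - 2 * lambda * ln n%:R)%:E <=
   cost_eot c 0 (empirical_prob n_gt0 x) (empirical_prob n_gt0 y))%E.
Proof.
move=> l0; set mu := empirical_prob n_gt0 x; set nu := empirical_prob n_gt0 y.
have eps0 : 0 < 2 * lambda by exact: mulr_gt0.
have [f [g [S _ _]]] := schrodinger_ex mu nu bc eps0 cM.
apply: le_ereal_inf_tmp => _ [gamma cg <-].
rewrite /cost_objective mulr0 mul0e adde0 -Rintegral_EFin// lee_fin.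
have [bf bg _ _] := S.
have := integral_log_gibbs bc l0 cg bf bg.
set h := fun z : Rd * Rd => (f z.1 + g z.2 - c z.1 z.2) / (2 * lambda).
rewrite -[\int[gamma]_z _]/(\int[gamma]_z h z) => hE.
have -> : emp_cost n_gt0 c lambda x y = \int[mu]_x f x + \int[nu]_y g y.
  by rewrite /emp_cost (cost_eot_schrodinger bc l0 S).
suff : \int[gamma]_z h z <= ln n%:R.
  by move=> /(ler_wpM2l (ltW eps0)); rewrite hE; lra.
have bh : bmeas h.
  apply: bmeasM; last exact: bmeas_cst.
  apply: bmeasB => //; apply: bmeasD.
    exact: (bmeas_comp (g := fst) _ bf).
  exact: (bmeas_comp (g := snd) _ bg).
pose h' z := Num.min (h z) (ln n%:R).
have bh' : bmeas h'.
  have [mh [K hK]] := bh; split; first exact: measurable_minr.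
  exists (K + ln n%:R) => z; have := hK z.
  rewrite !ler_norml /h' minEle; case: ifP => _ ; first by move: ln_n0; lra.
  by move: ln_n0; have := normr_ge0 (h z); have := hK z; lra.
have mR : measurable (@fst Rd Rd @^-1` range x).
  by rewrite -[X in measurable X]setTI; apply: measurable_fst => //; exact: measurable_range.
have gR : gamma (@fst Rd Rd @^-1` range x) = 1%E.
  have [g1 _] := cg; rewrite g1; last exact: measurable_range.
  rewrite empirical_preimage; last exact: measurable_range.
  congr EFin; rewrite (eq_bigr (fun=> 1)); last first.
    by move=> i _; rewrite indicE mem_set//; exists i.
  by rewrite sumr_const card_ord mulVf.
have -> : \int[gamma]_z h z = \int[gamma]_z h' z.
  congr fine; apply: (ae_eq_bRintegral mR gR).
  - by case: bh.
  - by case: bh'.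
  move=> [a t] /= [i _ <-]; apply/esym/min_idPl.
  (* The column constraint is a mean of positive terms equal to 1, and the density at [x i] is one
     of the [n] terms. *)
  have : n%:R^-1 * gibbs c (2 * lambda) f g (x i) t <= 1.
    rewrite -[leRHS](schrodinger_col bc S t) /mean ler_pM2l ?invr_gt0 ?ltr0n//.
    by rewrite (bigD1 i)//= lerDl sumr_ge0// => j _; exact: expR_ge0.
  rewrite mulrC ler_pdivrMr ?ltr0n// mul1r => hn.
  by rewrite -[h _]expRK ler_ln ?posrE ?expR_gt0 ?ltr0n.
apply: bRintegral_le => // z; by rewrite /h' ge_min lexx orbT.
Qed.

(** At [lambda = 0] there are no potentials; finiteness comes from comparison with [lambda = 1] on
    both sides. *)
Lemma cost_eot_emp lambda x y : 0 <= lambda ->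
  cost_eot c lambda (empirical_prob n_gt0 x) (empirical_prob n_gt0 y) =
  (emp_cost n_gt0 c lambda x y)%:E.
Proof.
have pos l : 0 < l -> cost_eot c l (empirical_prob n_gt0 x) (empirical_prob n_gt0 y) =
    (emp_cost n_gt0 c l x y)%:E.
  move=> l0; have eps0 : 0 < 2 * l by exact: mulr_gt0.
  have [f [g [S _ _]]] := schrodinger_ex (empirical_prob n_gt0 x)
    (empirical_prob n_gt0 y) bc eps0 cM.
  by rewrite /emp_cost (cost_eot_schrodinger bc l0 S).
rewrite le_eqVlt => /predU1P[<-|]; last exact: pos.
rewrite /emp_cost fineK//.
have h1 := cost_eot0_ge x y (ltr01 : 0 < 1).
have h2 := cost_eot0_le (empirical_prob n_gt0 x) (empirical_prob n_gt0 y) ler01.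
rewrite (pos _ ltr01) in h2; apply: fin_real; apply/andP; split.
  exact: lt_le_trans (ltNyr _) h1.
exact: le_lt_trans h2 (ltry _).
Qed.

Lemma emp_cost0_le lambda x y : 0 < lambda ->
  emp_cost n_gt0 c 0 x y <= emp_cost n_gt0 c lambda x y <=
  emp_cost n_gt0 c 0 x y + 2 * lambda * ln n%:R.
Proof.
move=> l0; have h1 := cost_eot0_ge x y l0.
have h2 := cost_eot0_le (empirical_prob n_gt0 x) (empirical_prob n_gt0 y) (ltW l0).
rewrite !cost_eot_emp ?lexx ?(ltW l0)// in h1 h2.
by move: h1 h2; rewrite !lee_fin; lra.
Qed.

End emp_cost_zero.

Section bounded_differences.
Context {R : realType} {d n : nat}.
Local Notation Rd := (d.-tuple R).
Variables (n_gt0 : (0 < n)%N) (c : Rd -> Rd -> R).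
Hypothesis bc : bmeas (fun z : Rd * Rd => c z.1 z.2).
Implicit Types (x y : 'I_n -> Rd) (lambda : R).

Section general_bound.
Variable M : R.
Hypothesis cM : forall a b, 0 <= c a b <= M.

(** The optimal coupling gives each row and each column mass [1 / n]. A cost perturbation [s] in row
    [i0] and [t] in column [j0] thus weighs at most [(s + t) / n]. *)
Lemma emp_cost_change lambda x y x' y' (i0 j0 : 'I_n) (s t : R) : 0 < lambda ->
  0 <= s -> 0 <= t ->
  (forall i j, cost_mx c x' y' i j - cost_mx c x y i j <=
     s * (i == i0)%:R + t * (j == j0)%:R) ->
  emp_cost n_gt0 c lambda x' y' - emp_cost n_gt0 c lambda x y <= (s + t) / n%:R.
Proof.
move=> l0 s0 t0 hD; have [P [P0 Pr Pc /(_ x' y')]] := emp_cost_perturb n_gt0 bc cM l0 x y.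
suff : \sum_(i < n) \sum_(j < n)
    P i j * (cost_mx c x' y' i j - cost_mx c x y i j) <= (s + t) / n%:R.
  by move=> h1 h2; rewrite lerBlDl (le_trans h2)// lerD2l.
apply: (@le_trans _ _ (\sum_(i < n) \sum_(j < n)
   (P i j * (s * (i == i0)%:R)) + \sum_(i < n) \sum_(j < n) (P i j * (t * (j == j0)%:R)))).
  rewrite -big_split; apply: ler_sum => i _ /=.
  rewrite -big_split; apply: ler_sum => j _ /=.
  by rewrite -mulrDr ler_wpM2l.
rewrite mulrDl lerD//.
  under eq_bigr do rewrite -mulr_suml Pr.
  rewrite (bigD1 i0)//= eqxx big1 ?addr0 ?mulr1 1?mulrC// => i /negbTE ->.
  by rewrite !mulr0.
rewrite exchange_big/=; under eq_bigr do rewrite -mulr_suml Pc.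
rewrite (bigD1 j0)//= eqxx big1 ?addr0 ?mulr1 1?mulrC// => i /negbTE ->.
by rewrite !mulr0.
Qed.

Definition emp_sinkhorn lambda x y : R := emp_cost n_gt0 c lambda x y -
  2^-1 * (emp_cost n_gt0 c lambda x x + emp_cost n_gt0 c lambda y y).

(** Each of the three costs drops by an amount between 0 and [2 * lambda * ln n] when [lambda]
    becomes 0. The self costs have total weight 1 and the opposite sign, so the errors do not add
    up. *)
Lemma emp_sinkhorn0_dist lambda x y : 0 < lambda ->
  `|emp_sinkhorn lambda x y - emp_sinkhorn 0 x y| <= 2 * lambda * ln n%:R.
Proof.
move=> l0; have := emp_cost0_le n_gt0 bc cM x y l0.
have := emp_cost0_le n_gt0 bc cM x x l0.
have := emp_cost0_le n_gt0 bc cM y y l0.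
rewrite /emp_sinkhorn.
move: (emp_cost _ _ _ _ _) (emp_cost _ _ _ _ _) (emp_cost _ _ _ _ _)
  (emp_cost _ _ _ _ _) (emp_cost _ _ _ _ _) (emp_cost _ _ _ _ _) => a1 a2 a3 a4 a5 a6.
by rewrite ler_norml; lra.
Qed.

Lemma measurable_emp_sinkhorn lambda {dZ} {Z : measurableType dZ}
    (X Y : 'I_n -> Z -> Rd) :
  (forall i, measurable_fun setT (X i)) -> (forall i, measurable_fun setT (Y i)) ->
  0 <= lambda -> measurable_fun setT (fun z => emp_sinkhorn lambda (X^~ z) (Y^~ z)).
Proof.
move=> mX mY.
have pos l : 0 < l -> measurable_fun setT (fun z => emp_sinkhorn l (X^~ z) (Y^~ z)).
  move=> l0; apply: measurable_funB; first exact: (measurable_emp_cost n_gt0 bc cM mX mY l0).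
  apply: measurable_funM => //; apply: measurable_funD.
    exact: (measurable_emp_cost n_gt0 bc cM mX mX l0).
  exact: (measurable_emp_cost n_gt0 bc cM mY mY l0).
rewrite le_eqVlt => /predU1P[<-|]; last exact: pos.
apply: (@measurable_fun_cvg _ _ _ _ (fun k z => emp_sinkhorn k.+1%:R^-1 (X^~ z) (Y^~ z))).
  by move=> k; apply: pos; rewrite invr_gt0.
move=> z _; apply/cvgrPdist_le => e e0.
have cK : 2 * ln n%:R * k.+1%:R^-1 @[k --> \oo] --> 2 * ln (n%:R : R) * 0.
  by apply: cvgMr; exact: cvg_harmonic.
rewrite mulr0 in cK; have /cvgrPdist_le/(_ e e0) := cK.
apply: filterS => k; rewrite sub0r normrN => hk.
rewrite distrC (le_trans (emp_sinkhorn0_dist _ _ _))// ?invr_gt0//.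
by rewrite mulrAC (le_trans (ler_norm _)).
Qed.

End general_bound.

Hypothesis c1 : forall a b, 0 <= c a b <= 1.

(** The mixed cost changes by at most [1 / n]. The self cost of [x] sees both a row and a column
    move, hence [2 / n], but enters with weight one half. *)
Let diff_x lambda x x' y i0 : 0 < lambda -> (forall i, i != i0 -> x' i = x i) ->
  emp_sinkhorn lambda x' y - emp_sinkhorn lambda x y <= 2 / n%:R.
Proof.
move=> l0 xx.
have cd a b a' b' : c a b - c a' b' <= 1 by have := c1 a b; have := c1 a' b'; lra.
have h1 : emp_cost n_gt0 c lambda x' y - emp_cost n_gt0 c lambda x y <= (1 + 0) / n%:R.
  apply: (emp_cost_change c1 (i0 := i0) (j0 := i0)) => // i j.
  rewrite mul0r addr0 mul1r; case: eqVneq => [_|ii]; first exact: cd.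
  by rewrite /cost_mx xx// subrr.
have h2 : emp_cost n_gt0 c lambda x x - emp_cost n_gt0 c lambda x' x' <= (1 + 1) / n%:R.
  apply: (emp_cost_change c1 (i0 := i0) (j0 := i0)) => // i j.
  rewrite !mul1r; case: eqVneq => [_|ii].
    by rewrite (le_trans (cd _ _ _ _))// lerDl.
  rewrite add0r; case: eqVneq => [_|jj]; first exact: cd.
  by rewrite /cost_mx !xx// subrr.
move: h1 h2; rewrite /emp_sinkhorn addr0 (_ : 1 + 1 = 2)//.
move: (emp_cost _ _ _ _ _) (emp_cost _ _ _ _ _) (emp_cost _ _ _ _ _)
  (emp_cost _ _ _ _ _) (emp_cost _ _ _ _ _) => a1 a2 a3 a4 a5.
by lra.
Qed.

Let diff_y lambda x y y' i0 : 0 < lambda -> (forall i, i != i0 -> y' i = y i) ->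
  emp_sinkhorn lambda x y' - emp_sinkhorn lambda x y <= 2 / n%:R.
Proof.
move=> l0 xx.
have cd a b a' b' : c a b - c a' b' <= 1 by have := c1 a b; have := c1 a' b'; lra.
have h1 : emp_cost n_gt0 c lambda x y' - emp_cost n_gt0 c lambda x y <= (0 + 1) / n%:R.
  apply: (emp_cost_change c1 (i0 := i0) (j0 := i0)) => // i j.
  rewrite mul0r add0r mul1r; case: eqVneq => [_|ii]; first exact: cd.
  by rewrite /cost_mx xx// subrr.
have h2 : emp_cost n_gt0 c lambda y y - emp_cost n_gt0 c lambda y' y' <= (1 + 1) / n%:R.
  apply: (emp_cost_change c1 (i0 := i0) (j0 := i0)) => // i j.
  rewrite !mul1r; case: eqVneq => [_|ii].
    by rewrite (le_trans (cd _ _ _ _))// lerDl.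
  rewrite add0r; case: eqVneq => [_|jj]; first exact: cd.
  by rewrite /cost_mx !xx// subrr.
move: h1 h2; rewrite /emp_sinkhorn add0r (_ : 1 + 1 = 2)//.
move: (emp_cost _ _ _ _ _) (emp_cost _ _ _ _ _) (emp_cost _ _ _ _ _)
  (emp_cost _ _ _ _ _) (emp_cost _ _ _ _ _) => a1 a2 a3 a4 a5.
by lra.
Qed.

Lemma emp_sinkhorn_bounded_diff lambda x y x' y' i0 : 0 <= lambda ->
  (forall i, i != i0 -> x' i = x i) /\ y' = y \/
  x' = x /\ (forall i, i != i0 -> y' i = y i) ->
  emp_sinkhorn lambda x' y' - emp_sinkhorn lambda x y <= 2 / n%:R.
Proof.
have pos l : 0 < l -> (forall i, i != i0 -> x' i = x i) /\ y' = y \/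
  x' = x /\ (forall i, i != i0 -> y' i = y i) ->
  emp_sinkhorn l x' y' - emp_sinkhorn l x y <= 2 / n%:R.
  by move=> l0 [[xx ->]|[-> yy]]; [exact: diff_x xx | exact: diff_y yy].
rewrite le_eqVlt => /predU1P[<-|] H; last exact: pos.
apply/ler_addgt0Pr => e e0.
(* At [lambda = e / L] the two replacements of [lambda] by 0 cost [4 * lambda * ln n <= e]. The
   added 1 keeps [L] positive when [n = 1]. *)
pose L := 4 * ln (n%:R : R) + 1.
have ln_n0 : 0 <= ln (n%:R : R) by rewrite ln_ge0// ler1n.
have L0 : 0 < L by rewrite ltr_wpDl// mulr_ge0.
have l0 : 0 < e / L by rewrite divr_gt0.
have eL : 4 * (e / L) * ln n%:R <= e.
  rewrite mulrAC mulrA ler_pdivrMr// mulrC ler_pM2l// /L lerDl//.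
have := pos _ l0 H.
have := emp_sinkhorn0_dist c1 x y l0; have := emp_sinkhorn0_dist c1 x' y' l0.
move: (emp_sinkhorn _ _ _) (emp_sinkhorn _ _ _) (emp_sinkhorn _ _ _)
  (emp_sinkhorn _ _ _) => a1 a2 a3 a4.
by rewrite !ler_norml; move: eL; lra.
Qed.

End bounded_differences.

(** * McDiarmid's inequality *)

Section hoeffding.
Context {R : realType}.

Lemma is_derive_ge0_le (f df : R -> R) (u : R) :
  (forall x : R, is_derive x 1 f (df x)) -> (forall x, 0 <= x -> 0 <= df x) ->
  0 <= u -> f 0 <= f u.
Proof.
move=> fdf df0 u0.
have fc : {within `[0, u], continuous f}.
  apply: continuous_subspaceT => x.
  apply: differentiable_continuous; apply/derivable1_diffP.
  exact: ex_derive.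
have [z zu] := MVT_segment u0 (fun x _ => fdf x) fc.
rewrite in_itv/= in zu; case/andP: zu => z0 _.
by rewrite subr0 => fE; rewrite -subr_ge0 fE mulr_ge0// df0.
Qed.

(** Hoeffding's estimate for a Bernoulli variable with generating function [D]: the second
    derivative of [ln D] is [(1 - p) * p * expR y / D y ^+ 2], at most [1 / 4] by the square of
    [1 - p - p * expR y]. Two integrations from 0, where [psi] and [psi'] vanish, give the claim. *)
Let bernoulli_mgf_ge0 (p u : R) : 0 <= p <= 1 -> 0 <= u ->
  1 - p + p * expR u <= expR (p * u + u ^+ 2 / 8).
Proof.
move=> /andP[p0 p1] u0; pose D x := 1 - p + p * expR x.
have D0 x : 0 < D x.
  rewrite /D; have [p1'|p1'] := ltP p 1.
    by rewrite ltr_pwDl ?subr_gt0// mulr_ge0// expR_ge0.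
  have -> : p = 1 by apply/eqP; rewrite eq_le p1.
  by rewrite subrr add0r mul1r expR_gt0.
have Dn x : D x != 0 by rewrite gt_eqF.
have dD (x : R) : is_derive x 1 D (p * expR x).
  by rewrite /D; apply: is_derive_eq; rewrite add0r mul1r.
have tau x : 0 <= x -> p - (1 - (1 - p) / D x) + x / 4 >= 0.
  move=> x0; pose k x := p - (1 - (1 - p) * (D x)^-1) + x / 4.
  have k0 : k 0 = 0 by rewrite /k /D expR0 mulr1 subrK invr1; ring.
  have dDV (y : R) : is_derive y 1 (fun y => (D y)^-1) (- (D y) ^- 2 *: (p * expR y)).
    exact: is_deriveV.
  have dk (y : R) : is_derive y 1 k (4^-1 - (1 - p) * (p * expR y) / (D y) ^+ 2).
    rewrite /k; apply: is_derive_eq.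
    rewrite /GRing.scale/=; ring.
  rewrite -k0; apply: (is_derive_ge0_le dk) => // y y0.
  rewrite subr_ge0 ler_pdivrMr ?exprn_gt0//.
  have := sqr_ge0 (1 - p - p * expR y); rewrite /D; move: (expR y) => e; nra.
pose psi x := x ^+ 2 / 8 + p * x - ln (D x).
have dpsi (x : R) : is_derive x 1 psi (p - (1 - (1 - p) / D x) + x / 4).
  have dl : is_derive x 1 (fun x => ln (D x)) ((p * expR x) / D x).
    have := is_derive1_ln (D0 x) => h.
    by apply: is_derive_eq; rewrite mulrC.
  rewrite /psi; apply: is_derive_eq.
  rewrite /GRing.scale/=; rewrite /D; field.
  exact: Dn.
have := is_derive_ge0_le dpsi tau u0.
rewrite /psi /D expR0 mulr1 subrK ln1 mulr0 expr0n mul0r addr0 subr0 -/(D u).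
by rewrite subr_ge0 -ler_expR lnK ?posrE ?D0// addrC.
Qed.

(** For negative [u] the two outcomes are exchanged, replacing [p] by [1 - p] and [u] by [- u]. *)
Lemma bernoulli_mgf_le (p u : R) : 0 <= p <= 1 ->
  1 - p + p * expR u <= expR (p * u + u ^+ 2 / 8).
Proof.
move=> p01; have [u0|/ltW u0] := leP 0 u; first exact: bernoulli_mgf_ge0.
have q01 : 0 <= 1 - p <= 1 by move: p01; lra.
have nu0 : 0 <= - u by rewrite oppr_ge0.
have := bernoulli_mgf_ge0 q01 nu0.
rewrite -(ler_pM2r (expR_gt0 u)) -expRD => h.
have -> : p * u + u ^+ 2 / 8 = (1 - p) * - u + (- u) ^+ 2 / 8 + u by ring.
apply: le_trans h; rewrite mulrDl -mulrA -expRD addNr expR0; lra.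
Qed.

Context {dT} {T : measurableType dT}.

(** [F] takes values between [a = inf F] and [a + c]. Convexity replaces it by a Bernoulli variable
    on the two ends with the same mean. When [c = 0] the function is constant and is treated
    apart. *)
Lemma hoeffding_mgf (mu : probability T R) (F : T -> R) (c s : R) : bmeas F ->
  (forall x x', F x' - F x <= c) ->
  \int[mu]_x expR (s * F x) <= expR (s * \int[mu]_x F x + s ^+ 2 * c ^+ 2 / 8).
Proof.
move=> bF Fc; have [x0 _] := probability_inhabited mu.
have c0 : 0 <= c by have := Fc x0 x0; rewrite subrr.
set E := \int[mu]_x F x.
have Elb : has_lbound (range F) by exists (F x0 - c) => _ [x _ <-]; have := Fc x x0; lra.
have hi : has_inf (range F) by split => //; exists (F x0), x0.
pose a := inf (range F).
have aF x : a <= F x by apply: ge_inf => //; exists x.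
have Fac x : F x <= a + c.
  rewrite -lerBlDr; apply: lb_le_inf; first by case: hi.
  by move=> _ [x' _ <-]; have := Fc x' x; lra.
have aE : a <= E by exact: bRintegral_ge.
have Eac : E <= a + c by exact: bRintegral_le.
move: c0; rewrite le_eqVlt => /predU1P[c0|c0].
  rewrite -c0 addr0 in Fac Eac.
  have FE x : F x = E by have := Fac x; have := aF x; move: aE Eac; lra.
  under eq_Rintegral do rewrite FE.
  by rewrite bRintegral_cst -c0 expr0n mulr0 mul0r addr0.
pose p := (E - a) / c.
have p01 : 0 <= p <= 1.
  by rewrite divr_ge0 ?subr_ge0 ?(ltW c0)//= ler_pdivrMr// mul1r lerBlDl.
have := bernoulli_mgf_le (s * c) p01.
rewrite -(ler_pM2l (expR_gt0 (s * a))) -expRD.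
have -> : s * a + (p * (s * c) + (s * c) ^+ 2 / 8) = s * E + s ^+ 2 * c ^+ 2 / 8.
  by rewrite /p; field; rewrite gt_eqF.
apply: le_trans.
have b1 : bmeas (fun x => (F x - a) / c).
  by apply: bmeasM; [apply: bmeasB => // |]; exact: bmeas_cst.
(* The chord bound for the exponential, obtained from the tangent at [z] evaluated at 0 and at [w],
   with weights [1 - t] and [t]. *)
have conv x : expR (s * F x) <= expR (s * a) * (1 + (F x - a) / c * (expR (s * c) - 1)).
  pose t := (F x - a) / c.
  have t01 : 0 <= t <= 1.
    by rewrite divr_ge0 ?subr_ge0 ?(ltW c0)//= ler_pdivrMr// mul1r lerBlDl.
  have -> : s * F x = s * a + t * (s * c) by rewrite /t; field; rewrite gt_eqF.
  rewrite expRD ler_pM2l ?expR_gt0// -/t.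
  set w := s * c; set z := t * w.
  have E0 := expR_gt0 z; have /andP[t0 t1] := t01.
  have h1 : expR z * (1 + (0 - z)) <= 1.
    have := expR_ge1Dx (0 - z).
    by rewrite -(ler_pM2l E0) -expRD (_ : z + (0 - z) = 0) ?expR0//; ring.
  have h2 : expR z * (1 + (w - z)) <= expR w.
    have := expR_ge1Dx (w - z).
    by rewrite -(ler_pM2l E0) -expRD (_ : z + (w - z) = w)//; ring.
  have t1' : 0 <= 1 - t by rewrite subr_ge0.
  have := ler_wpM2l t0 h2; have := ler_wpM2l t1' h1.
  by rewrite /z; move: (expR w) (expR (t * w)) => ew ez; lra.
apply: (@le_trans _ _ (\int[mu]_x (expR (s * a) * (1 + (F x - a) / c * (expR (s * c) - 1))))).
  apply: ler_bRintegral => //.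
  - by apply/bmeas_expR/bmeasM => //; exact: bmeas_cst.
  - apply: bmeasM; first exact: bmeas_cst.
    apply: bmeasD; first exact: bmeas_cst.
    by apply: bmeasM => //; exact: bmeas_cst.
rewrite bRintegralZ; last first.
  apply: bmeasD; first exact: bmeas_cst.
  by apply: bmeasM => //; exact: bmeas_cst.
rewrite bRintegralD; [|exact: bmeas_cst|by apply: bmeasM => //; exact: bmeas_cst].
rewrite bRintegral_cst bRintegralZr// bRintegralZr; last by apply: bmeasB => //; exact: bmeas_cst.
rewrite bRintegralB//; last exact: bmeas_cst.
rewrite bRintegral_cst -/E -/p ler_pM2l ?expR_gt0//.
by rewrite mulrBr mulr1 addrA addrAC.
Qed.

End hoeffding.

Section tuple_product.
Context {dT} {T : measurableType dT} {R : realType}.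

Definition tcons N (z : T * N.-tuple T) : N.+1.-tuple T := [tuple of z.1 :: z.2].

Lemma measurable_tcons N : measurable_fun [set: T * N.-tuple T] (@tcons N).
Proof. exact: (measurable_cons measurable_fst measurable_snd). Qed.

HB.instance Definition _ N :=
  isMeasurableFun.Build _ _ _ _ (@tcons N) (@measurable_tcons N).

(** The family of laws is indexed by [nat] so that removing the first coordinate is a mere shift,
    which suits induction on [N]. *)
Fixpoint tuple_prob N (m : nat -> probability T R) : probability (N.-tuple T) R :=
  if N is N'.+1 then
    distribution (prod_prob (m 0) (tuple_prob N' (fun k => m k.+1))) (@tcons N')
  else \d_([tuple] : 0.-tuple T).

Lemma tuple_prob_integral N m (G : N.+1.-tuple T -> R) : bmeas G ->
  \int[tuple_prob N.+1 m]_t G t =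
  \int[m 0]_x \int[tuple_prob N (fun k => m k.+1)]_t G (tcons (x, t)).
Proof.
move=> bG /=; rewrite (bRintegral_image (@measurable_tcons N)
  (P := prod_prob (m 0) (tuple_prob N (fun k => m k.+1))) _ bG)//.
rewrite (bRintegral_prod _ _ (F := fun x t => G (tcons (x, t))))//.
by apply: (eq_bmeas (bmeas_comp (@measurable_tcons N) bG)) => -[].
Qed.

Definition tuple_box N (A : 'I_N -> set T) : set (N.-tuple T) :=
  [set t | forall i, A i (tnth t i)].

Lemma measurable_tuple_box N (A : 'I_N -> set T) :
  (forall i, measurable (A i)) -> measurable (tuple_box A).
Proof.
move=> mA; rewrite (_ : tuple_box A =
    \big[setI/setT]_(i < N) ((fun t => tnth t i) @^-1` A i)).
  apply: bigsetI_measurable => i _.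
  by rewrite -[X in measurable X]setTI; exact: measurable_tnth.
rewrite -bigcap_seq; apply/seteqP; split => [t h i _|t h i]; first exact: h.
by apply: (h i); rewrite /= mem_index_enum.
Qed.

Lemma tuple_prob_box N m (A : 'I_N -> set T) : (forall i, measurable (A i)) ->
  (tuple_prob N m (tuple_box A) = \prod_(i < N) m i (A i))%E.
Proof.
elim: N m A => [|N IH] m A mA.
  by rewrite big_ord0 /= /dirac indicE mem_set// => -[].
rewrite big_ord_recl /=.
transitivity (prod_prob (m 0) (tuple_prob N (fun k => m k.+1))
   (A ord0 `*` tuple_box (fun i => A (lift ord0 i)))).
  congr (prod_prob _ _ _); apply/seteqP; split => [[x t] /= h|[x t] /= [h0 h] i].
    by split=> [|i]; [exact: (h ord0) | have := h (lift ord0 i); rewrite /tcons tnthS].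
  by case: (unliftP ord0 i) => [j ->|->//]; rewrite /tcons tnthS.
have mB : measurable (tuple_box (fun i => A (lift ord0 i))).
  by apply: measurable_tuple_box => i.
transitivity (m 0%N (A ord0) *
  tuple_prob N (fun k => m k.+1) (tuple_box (fun i => A (lift ord0 i))))%E.
  exact: product_measure1E.
rewrite IH//.
Qed.

(** Boxes are stable under intersection and generate the product sigma-algebra, so their masses
    determine a probability. *)
Lemma tuple_prob_unique N (m : nat -> probability T R)
    (Q : probability (N.-tuple T) R) :
  (forall A : 'I_N -> set T, (forall i, measurable (A i)) ->
     Q (tuple_box A) = (\prod_(i < N) m i (A i))%E) ->
  forall B, measurable B -> tuple_prob N m B = Q B.
Proof.
move=> QE B mB.
pose G := [set tuple_box A | A in [set A : 'I_N -> set T | forall i, measurable (A i)]].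
have GT : G setT.
  by exists (fun=> setT) => //; apply/seteqP; split => t.
apply: (measure_unique G (fun=> setT)) => //.
- apply/seteqP; split.
    apply: smallest_sub; first exact: smallest_sigma_algebra.
    rewrite -bigcup_seq; apply: bigcup_sub => i _ _ [A mA <-]; rewrite setTI.
    apply: sub_sigma_algebra; exists (fun j => if j == i then A else setT).
      by move=> j /=; case: ifP.
    apply/seteqP; split => [t /(_ i)|t At j]; first by rewrite eqxx.
    by case: eqVneq => [->|].
  apply: smallest_sub; first exact: sigma_algebra_measurable.
  by move=> _ [A mA <-]; exact: measurable_tuple_box.
- move=> _ _ [A mA <-] [A' mA' <-]; exists (fun i => A i `&` A' i).
    by move=> i; exact: measurableI.
  by apply/seteqP; split => [t h|t [h h'] i]; [split => i; have [] := h i | split].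
- by rewrite bigcup_const.
- by move=> _ [A mA <-]; exact: etrans (tuple_prob_box m mA) (esym (QE _ mA)).
- by move=> k; rewrite -ge0_fin_numE// fin_num_measure.
Qed.

Definition bounded_diff N (c : R) (G : N.-tuple T -> R) :=
  forall i t t', (forall j, j != i -> tnth t j = tnth t' j) -> G t' - G t <= c.

(** Induction on the coordinates in place of martingale differences: the induction hypothesis treats
    [G] with the first coordinate frozen, and Hoeffding's bound treats its mean [H] over the others,
    which still oscillates by at most [c]. *)
Lemma mcdiarmid_mgf N (m : nat -> probability T R) (G : N.-tuple T -> R) (c s : R) :
  bmeas G -> bounded_diff c G ->
  \int[tuple_prob N m]_t expR (s * G t) <=
  expR (s * \int[tuple_prob N m]_t G t + N%:R * (s ^+ 2 * c ^+ 2 / 8)).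
Proof.
elim: N m G => [|N IH] m G bG cG.
  have -> : G = fun=> G [tuple] by apply/funext => t; rewrite tuple0.
  by rewrite !bRintegral_cst mul0r addr0.
have bE : bmeas (fun t => expR (s * G t)).
  by apply/bmeas_expR/bmeasM => //; exact: bmeas_cst.
rewrite !tuple_prob_integral//.
set Q := tuple_prob N _.
have bG2 : bmeas (fun z : T * N.-tuple T => G (tcons (z.1, z.2))).
  by apply: (eq_bmeas (bmeas_comp (@measurable_tcons N) bG)) => -[].
have bGx x : bmeas (fun t => G (tcons (x, t))).
  exact: (bmeas_pair1 (F := fun x t => G (tcons (x, t)))).
pose H x := \int[Q]_t G (tcons (x, t)).
have bH : bmeas H by exact: (bmeas_fubini1 (m 0) Q (F := fun x t => G (tcons (x, t)))).
pose K := N%:R * (s ^+ 2 * c ^+ 2 / 8).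
apply: (@le_trans _ _ (\int[m 0]_x expR (s * H x + K))).
  apply: ler_bRintegral.
  - apply: (bmeas_fubini1 (m 0) Q (F := fun x t => expR (s * G (tcons (x, t))))).
    by apply/bmeas_expR/bmeasM => //; exact: bmeas_cst.
  - by apply/bmeas_expR/bmeasD; [apply: bmeasM => // |]; exact: bmeas_cst.
  move=> x; apply: IH => // i t t' tt'.
  apply: (cG (lift ord0 i)) => j; case: (unliftP ord0 j) => [k ->|->//] ki.
  by rewrite /tcons !tnthS; apply: tt'; apply: contra_neq ki => ->.
under eq_Rintegral do rewrite expRD.
rewrite bRintegralZr; last by apply/bmeas_expR/bmeasM => //; exact: bmeas_cst.
have Hc x x' : H x' - H x <= c.
  rewrite -bRintegralB//; apply: bRintegral_le; first exact: bmeasB.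
  move=> t; apply: (cG ord0) => j; case: (unliftP ord0 j) => [k ->|->]; last by rewrite eqxx.
  by rewrite /tcons !tnthS.
have := hoeffding_mgf (m 0) s bH Hc.
rewrite -(ler_pM2r (expR_gt0 K)) => /le_trans; apply.
by rewrite -expRD ler_expR /K -natr1; lra.
Qed.

Lemma mcdiarmid N (m : nat -> probability T R) (G : N.-tuple T -> R) (c t : R) :
  bmeas G -> bounded_diff c G -> 0 < c -> (0 < N)%N -> 0 <= t ->
  \int[tuple_prob N m]_w \1_[set w | t <= `|G w - \int[tuple_prob N m]_v G v|] w <=
  2 * expR (- (2 * t ^+ 2 / (N%:R * c ^+ 2))).
Proof.
move=> bG cG c0 N0 t0; set Q := tuple_prob N m; set E := \int[Q]_v G v.
have Nr0 : 0 < N%:R :> R by rewrite ltr0n.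
(* The minimiser of [- s * t + N * s ^+ 2 * c ^+ 2 / 8], with minimum
   [- 2 * t ^+ 2 / (N * c ^+ 2)]. *)
pose s := 4 * t / (N%:R * c ^+ 2).
have s0 : 0 <= s by rewrite divr_ge0 ?mulr_ge0// ?ler0n// ltW.
have Nc0 : N%:R * c ^+ 2 != 0 by rewrite mulf_neq0// gt_eqF// exprn_gt0.
pose u := s * t.
have mD : measurable_fun setT (fun w => `|G w - E|).
  by apply: measurableT_comp => //; apply: measurable_funB => //; case: bG.
have mS : measurable [set w | t <= `|G w - E|].
  rewrite (_ : [set _ | _] = (fun w => `|G w - E|) @^-1` `[t, +oo[%classic).
    by rewrite -[X in measurable X]setTI; exact: mD.
  by apply/seteqP; split => w /=; rewrite in_itv/= andbT.
have bs r : bmeas (fun w => expR (r * G w)).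
  by apply/bmeas_expR/bmeasM => //; exact: bmeas_cst.
(* Markov's inequality for both tails at once: the indicator is below the sum of the two
   exponentials. *)
apply: (@le_trans _ _ (\int[Q]_w (expR (- (s * E) - u) * expR (s * G w) +
                                 expR (s * E - u) * expR (- s * G w)))).
  apply: ler_bRintegral; first exact: bmeas_indic.
    by apply: bmeasD; apply: bmeasM => //; exact: bmeas_cst.
  move=> w; rewrite indicE; have [|_] := boolP (_ \in _); last first.
    by rewrite addr_ge0// mulr_ge0// expR_ge0.
  rewrite inE/= ler_normr => /orP[h|h]; rewrite -!expRD.
    rewrite ler_wpDr ?expR_ge0// -expR0 ler_expR.
    by have := ler_wpM2l s0 h; rewrite /u; lra.
  rewrite ler_wpDl ?expR_ge0// -expR0 ler_expR.
  by have := ler_wpM2l s0 h; rewrite /u; lra.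
have bZ r q : bmeas (fun w => expR q * expR (r * G w)).
  by apply: bmeasM => //; exact: bmeas_cst.
rewrite bRintegralD// !bRintegralZ//.
have h1 := mcdiarmid_mgf m s bG cG; have h2 := mcdiarmid_mgf m (- s) bG cG.
rewrite -/Q -/E in h1 h2.
have := ler_wpM2l (expR_ge0 (- (s * E) - u)) h1.
have := ler_wpM2l (expR_ge0 (s * E - u)) h2.
rewrite -!expRD sqrrN.
have -> : s * E - u + (- s * E + N%:R * (s ^+ 2 * c ^+ 2 / 8)) =
    - (2 * t ^+ 2 / (N%:R * c ^+ 2)).
  by rewrite /u /s; field; rewrite !gt_eqF.
have -> : - (s * E) - u + (s * E + N%:R * (s ^+ 2 * c ^+ 2 / 8)) =
    - (2 * t ^+ 2 / (N%:R * c ^+ 2)).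
  by rewrite /u /s; field; rewrite !gt_eqF.
by move=> k1 k2; rewrite [2 * expR _]mulrDl !mul1r; exact: lerD k2 k1.
Qed.

End tuple_product.

(** * Expectations over independent samples *)

Section sample_law.
Context {dO} {Omega : measurableType dO} {R : realType} {dT} {T : measurableType dT}.
Variable P : probability Omega R.

Lemma tuple_prob0_integral (m : nat -> probability T R) (G : 0.-tuple T -> R) :
  \int[tuple_prob 0 m]_t G t = G [tuple].
Proof.
have -> : G = fun=> G [tuple] by apply/funext => t; rewrite tuple0.
exact: bRintegral_cst.
Qed.

Variables (J : finType) (Z : J -> {RV P >-> T}) (law : J -> probability T R).
Hypothesis Zlaw : forall j, has_law (Z j) (law j).
Hypothesis Zind : mutually_independent Z.

(** [iota] selects distinct members of the family, in any order. Pairs, triples and the whole sample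
    are instances. *)
Lemma sample_tuple_law N (iota : 'I_N -> J) (m : nat -> probability T R)
    (G : N.-tuple T -> R) :
  injective iota -> (forall i : 'I_N, m i = law (iota i)) -> bmeas G ->
  \int[P]_w G [tuple Z (iota i) w | i < N] = \int[tuple_prob N m]_t G t.
Proof.
move=> inj mE bG; pose W w := [tuple Z (iota i) w | i < N].
have mW : measurable_fun setT W.
  apply/measurable_fun_tnthP => i.
  rewrite (_ : _ \o W = Z (iota i))//.
  by apply/funext => w; rewrite /= /W tnth_mktuple.
pose Wm : {mfun Omega >-> (N.-tuple T)} :=
  HB.pack W (isMeasurableFun.Build _ _ _ _ W mW).
apply/esym/bRintegral_image => // B mB.
apply: (tuple_prob_unique (Q := distribution P Wm)) => // A mA.
pose A' j := if [pick i | iota i == j] is Some i then A i else setT.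
have A'E i : A' (iota i) = A i.
  by rewrite /A'; case: pickP => [k /eqP/inj ->//|/(_ i)]; rewrite eqxx.
have mA' j : measurable (A' j) by rewrite /A'; case: pickP.
have := Zind [set iota i | i in 'I_N]%SET mA'.
rewrite (_ : [set w | _] = W @^-1` tuple_box A); last first.
  apply/seteqP; split => w /= h.
    move=> i; rewrite tnth_mktuple -A'E; apply: h.
    exact: imset_f.
  by move=> _ /imsetP[i _ ->]; rewrite A'E; have := h i; rewrite tnth_mktuple.
move=> PE; rewrite [LHS]PE big_imset/=; last by move=> i j _ _; exact: inj.
apply: eq_big => // i _; rewrite A'E mE -Zlaw//.
Qed.

Lemma sample_pair_law a b (phi : T -> T -> R) : a != b ->
  bmeas (fun z : T * T => phi z.1 z.2) ->
  \int[P]_w phi (Z a w) (Z b w) = \int[law a]_x \int[law b]_y phi x y.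
Proof.
move=> ab bphi; pose iota (i : 'I_2) := nth a [:: a; b] i.
pose m k := law (nth a [:: a; b] k).
pose G (t : 2.-tuple T) := phi (tnth t ord0) (tnth t (lift ord0 ord0)).
have bG : bmeas G.
  apply: (bmeas_comp (f := fun z : T * T => phi z.1 z.2)
    (g := fun t : 2.-tuple T => (tnth t ord0, tnth t (lift ord0 ord0)))) => //.
  by apply: measurable_fun_pair; exact: measurable_tnth.
have inj : injective iota.
  move=> i j /eqP; rewrite /iota nth_uniq//= ?inE ?ab// => /eqP ij.
  exact: val_inj.
have := sample_tuple_law inj (m := m) (fun=> erefl) bG.
rewrite /G; under eq_Rintegral do rewrite !tnth_mktuple.
move=> ->; rewrite tuple_prob_integral//.
apply: eq_Rintegral => x _; rewrite tuple_prob_integral; last first.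
  apply: (bmeas_comp (g := fun t => tcons (x, t)) _ bG).
  by apply: measurableT_comp => //; exact: measurable_tcons.
by apply: eq_Rintegral => y _; rewrite tuple_prob0_integral.
Qed.

Lemma sample_triple_law a b c (phi : T -> T -> T -> R) : a != b -> a != c -> b != c ->
  bmeas (fun z : T * T * T => phi z.1.1 z.1.2 z.2) ->
  \int[P]_w phi (Z a w) (Z b w) (Z c w) =
  \int[law a]_x \int[law b]_y \int[law c]_z phi x y z.
Proof.
move=> ab ac bc bphi; pose iota (i : 'I_3) := nth a [:: a; b; c] i.
pose m k := law (nth a [:: a; b; c] k).
pose i1 : 'I_3 := lift ord0 ord0; pose i2 : 'I_3 := lift ord0 (lift ord0 ord0).
pose G (t : 3.-tuple T) := phi (tnth t ord0) (tnth t i1) (tnth t i2).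
have bG : bmeas G.
  apply: (bmeas_comp (f := fun z : T * T * T => phi z.1.1 z.1.2 z.2)
    (g := fun t : 3.-tuple T => ((tnth t ord0, tnth t i1), tnth t i2))) => //.
  apply: measurable_fun_pair; last exact: measurable_tnth.
  by apply: measurable_fun_pair; exact: measurable_tnth.
have inj : injective iota.
  move=> i j /eqP; rewrite /iota nth_uniq//= ?inE ?negb_or ?ab ?ac ?bc// => /eqP ij.
  exact: val_inj.
have := sample_tuple_law inj (m := m) (fun=> erefl) bG.
rewrite /G; under eq_Rintegral do rewrite !tnth_mktuple.
move=> ->; rewrite tuple_prob_integral//.
apply: eq_Rintegral => x _.
have bG1 : bmeas (fun t => G (tcons (x, t))).
  apply: (bmeas_comp (g := fun t => tcons (x, t)) _ bG).
  by apply: measurableT_comp => //; exact: measurable_tcons.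
rewrite tuple_prob_integral//; apply: eq_Rintegral => y _.
rewrite tuple_prob_integral; last first.
  apply: (bmeas_comp (g := fun t => tcons (y, t)) _ bG1).
  by apply: measurableT_comp => //; exact: measurable_tcons.
by apply: eq_Rintegral => z _; rewrite tuple_prob0_integral.
Qed.

Lemma sample_law j (phi : T -> R) : bmeas phi ->
  \int[P]_w phi (Z j w) = \int[law j]_x phi x.
Proof.
move=> bphi; apply/esym/bRintegral_image => // A mA.
exact: esym (Zlaw j mA).
Qed.

End sample_law.

(** The first moment is bounded by the second, in which only the [n] diagonal terms survive. *)
Lemma orthogonal_mean_le {dO} {Omega : measurableType dO} {R : realType}
    (P : probability Omega R) (n : nat) (W : 'I_n -> Omega -> R) (V : R) :
  (0 < n)%N -> (forall j, bmeas (W j)) ->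
  (forall j k, j != k -> \int[P]_w (W j w * W k w) = 0) ->
  (forall j, \int[P]_w (W j w ^+ 2) <= V) ->
  \int[P]_w `|n%:R^-1 * \sum_(j < n) W j w| <= Num.sqrt (V / n%:R).
Proof.
move=> n0 bW W0 WV; have nr0 : 0 < n%:R :> R by rewrite ltr0n.
have V0 : 0 <= V.
  by apply: le_trans (WV (Ordinal n0)); apply: Rintegral_ge0 => w _; exact: sqr_ge0.
have bS : bmeas (fun w => n%:R^-1 * \sum_(j < n) W j w).
  by apply: bmeasM; [exact: bmeas_cst | exact: bmeas_sum].
have I0 : 0 <= \int[P]_w `|n%:R^-1 * \sum_(j < n) W j w|.
  by apply: Rintegral_ge0 => w _; exact: normr_ge0.
rewrite -[leLHS]ger0_norm// -sqrtr_sqr ler_wsqrtr//.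
apply: le_trans (bRintegral_sqr_le _ (bmeas_norm bS)) _.
have bWW j k : bmeas (fun w => W j w * W k w) by exact: bmeasM.
have E w : `|n%:R^-1 * \sum_(j < n) W j w| ^+ 2 =
    n%:R^-1 ^+ 2 * \sum_(j < n) \sum_(k < n) (W j w * W k w).
  by rewrite real_normK ?num_real// exprMn [X in _ * X]expr2 big_distrlr.
under eq_Rintegral do rewrite E.
rewrite bRintegralZ; last by apply: bmeas_sum => j _; exact: bmeas_sum.
rewrite bRintegral_sum; last by move=> j _; exact: bmeas_sum.
apply: (@le_trans _ _ (n%:R^-1 ^+ 2 * \sum_(j < n) V)).
  rewrite ler_wpM2l ?sqr_ge0//; apply: ler_sum => j _.
  rewrite bRintegral_sum//  (bigD1 j)//= big1 ?addr0; last first.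
    by move=> k kj; apply: W0; rewrite eq_sym.
  by apply: le_trans (WV j); under eq_Rintegral do rewrite -expr2.
rewrite sumr_const card_ord -[V *+ n]mulr_natl.
rewrite (_ : _ ^+ 2 * _ = V / n%:R)//.
by field; rewrite gt_eqF.
Qed.

(** * The optimal density *)

Section gibbs_square.
Context {d1 d2} {T1 : measurableType d1} {T2 : measurableType d2} {R : realType}.
Variables (mu : probability T1 R) (nu : probability T2 R).
Variables (c : T1 -> T2 -> R) (eps : R) (f : T1 -> R) (g : T2 -> R).
Hypothesis bc : bmeas (fun z : T1 * T2 => c z.1 z.2).
Hypothesis S : schrodinger mu nu c eps f g.
Let p x y := gibbs c eps f g x y.
Let pi := prod_prob mu nu.

Let bp : bmeas (fun z : T1 * T2 => p z.1 z.2).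
Proof. by have [bf bg _ _] := S; exact: bmeas_gibbs. Qed.

(* Integrating the hypothesis in [z'] and using the marginal constraints of [p]
   gives [p z * \int_W p <= C] on [W]. *)
Lemma gibbs_square_le (W : set (T1 * T2)) (C : R) : measurable W -> 0 <= C ->
  (forall z z', W z -> W z' -> p z.1 z.2 * p z'.1 z'.2 <= C * (p z.1 z'.2 * p z'.1 z.2)) ->
  \int[pi]_z (p z.1 z.2 ^+ 2 * \1_W z) <= C.
Proof.
move=> mW C0 WC; have b1 := bmeas_indic (R := R) mW.
have p0 x y : 0 < p x y by exact: gibbs_gt0.
have i01 z : 0 <= (\1_W z : R) <= 1 by rewrite indicE; case: (_ \in _); rewrite lexx ler01.
have bI : bmeas (fun z => p z.1 z.2 * \1_W z) by exact: bmeasM.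
have bJ : bmeas (fun z => p z.1 z.2 ^+ 2 * \1_W z).
  by apply: bmeasM => //; apply: (eq_bmeas (bmeasM bp bp)) => z; rewrite expr2.
set I := \int[pi]_z (p z.1 z.2 * \1_W z).
have I0 : 0 <= I.
  by apply: Rintegral_ge0 => z _; rewrite mulr_ge0 ?(ltW (p0 _ _))//; case/andP: (i01 z).
have key z : W z -> p z.1 z.2 * I <= C.
  move=> Wz; rewrite -bRintegralZ//.
  pose F x' y' := p z.1 y' * p x' z.2.
  have bF : bmeas (fun z' : T1 * T2 => F z'.1 z'.2).
    apply: bmeasM.
      by apply: (bmeas_comp (g := snd) (f := p z.1)) => //; exact: bmeas_pair1 bp.
    by apply: (bmeas_comp (g := fst) (f := p^~ z.2)) => //; exact: bmeas_pair2 bp.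
  apply: (@le_trans _ _ (\int[pi]_z' (C * F z'.1 z'.2))).
    apply: ler_bRintegral.
    - by apply: bmeasM => //; exact: bmeas_cst.
    - by apply: bmeasM => //; exact: bmeas_cst.
    move=> z'; rewrite indicE; have [|_] := boolP (z' \in W).
      by rewrite inE mulr1 => Wz'; exact: WC.
    by rewrite !mulr0 mulr_ge0// mulr_ge0// ltW.
  rewrite bRintegralZ// (bRintegral_prod mu nu (F := F))// /F.
  have [_ _ px py] := S.
  under eq_Rintegral => x' _.
    rewrite bRintegralZr; last exact: bmeas_pair1 bp.
    rewrite px mul1r; over.
  by rewrite py mulr1.
have JI : (\int[pi]_z (p z.1 z.2 ^+ 2 * \1_W z)) * I <= C * I.
  rewrite -bRintegralZr// -bRintegralZ//.
  apply: ler_bRintegral.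
  - by apply: bmeasM => //; exact: bmeas_cst.
  - by apply: bmeasM => //; exact: bmeas_cst.
  move=> z; rewrite indicE; have [|_] := boolP (z \in W); last by rewrite !mulr0 mul0r.
  rewrite inE !mulr1 => Wz; rewrite expr2 -mulrA [C * _]mulrC ler_pM2l//.
  exact: key.
(* If [I] is zero it cannot be divided out; since [p <= M], the integral of [p ^+ 2] over [W] is
   then at most [M * I = 0]. *)
move: I0; rewrite le_eqVlt => /predU1P[I0|I0]; last by rewrite -(ler_pM2r I0).
apply: (@le_trans _ _ 0) => //.
have [_ [M pM]] := bp.
have : \int[pi]_z (p z.1 z.2 ^+ 2 * \1_W z) <= \int[pi]_z (M * (p z.1 z.2 * \1_W z)).
  apply: ler_bRintegral => //.
    by apply: bmeasM => //; exact: bmeas_cst.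
  move=> z; rewrite expr2 mulrA ler_wpM2r//.
  by rewrite ler_pM2r// (le_trans (ler_norm _)).
by rewrite bRintegralZ// -/I -I0 mulr0.
Qed.

End gibbs_square.

Section gibbs_diagonal.
Context {dT} {T : measurableType dT} {R : realType}.
Variables (mu : probability T R).
Variables (c : T -> T -> R) (eps : R) (f g : T -> R).
Hypothesis bc : bmeas (fun z : T * T => c z.1 z.2).
Hypothesis S : schrodinger mu mu c eps f g.
Let p x y := gibbs c eps f g x y.

Let bp : bmeas (fun z : T * T => p z.1 z.2).
Proof. by have [bf bg _ _] := S; exact: bmeas_gibbs. Qed.

Lemma bmeas_gibbs_diag : bmeas (fun x => p x x).
Proof.
apply: (bmeas_comp (g := fun x : T => (x, x)) _ bp).
exact: measurable_fun_pair.
Qed.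

Let young (C w u v : R) : 0 <= C -> 0 <= w ->
  C * (u * v * w) <= C / 2 * (u ^+ 2 * w + v ^+ 2 * w).
Proof. by move=> C0 w0; have := mulr_ge0 C0 (mulr_ge0 w0 (sqr_ge0 (u - v))); lra. Qed.

Let half_sum (C u v : R) : 0 <= C -> u <= C -> v <= C -> C / 2 * (u + v) <= C * C.
Proof.
move=> C0 uC vC; have C20 : 0 <= C / 2 by rewrite divr_ge0.
have := ler_wpM2l C20 uC; have := ler_wpM2l C20 vC.
by rewrite mulrDr; lra.
Qed.

(** The hypothesis at [(x, x)] and [(x', x')] bounds the square of the diagonal integral by [C]
    times the integral of [p x x' * p x' x] over the square of [W]. By the inequality between means
    this is at most [C] times the integral of [p ^+ 2] there, itself at most [C]. The diagonal
    appears when both samples are the same. *)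
Lemma gibbs_diagonal_le (W : set T) (C : R) : measurable W -> 0 <= C ->
  (forall x y x' y', W x -> W y -> W x' -> W y' ->
     p x y * p x' y' <= C * (p x y' * p x' y)) ->
  \int[mu]_x (p x x * \1_W x) <= C.
Proof.
move=> mW C0 WC; have b1 := bmeas_indic (R := R) mW.
have p0 x y : 0 < p x y by exact: gibbs_gt0.
have bD := bmeas_gibbs_diag.
have bD1 : bmeas (fun x => p x x * \1_W x) by exact: bmeasM.
set D := \int[mu]_x (p x x * \1_W x).
have i01 z : 0 <= \1_W z :> R by rewrite indicE; case: (_ \in _).
have D0 : 0 <= D by apply: Rintegral_ge0 => z _; rewrite mulr_ge0// ltW.
have bsw : measurable_fun setT (fun z : T * T => (z.2, z.1)) by exact: measurable_fun_pair.
have bpT : bmeas (fun z : T * T => p z.2 z.1) by exact: (bmeas_comp bsw bp).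
have bW1 : bmeas (fun z : T * T => \1_W z.1 : R) by exact: (bmeas_comp (g := fst) _ b1).
have bW2 : bmeas (fun z : T * T => \1_W z.2 : R) by exact: (bmeas_comp (g := snd) _ b1).
pose F x x' := C * (p x x' * p x' x * (\1_W x * \1_W x')).
have bF : bmeas (fun z : T * T => F z.1 z.2).
  apply: bmeasM; first exact: bmeas_cst.
  by apply: bmeasM; exact: bmeasM.
have DD : D * D <= \int[mu]_x \int[mu]_x' F x x'.
  rewrite -bRintegralZr//; apply: ler_bRintegral.
  - by apply: bmeasM => //; exact: bmeas_cst.
  - exact: (bmeas_fubini1 mu mu (F := F)).
  move=> x; rewrite -bRintegralZ//; apply: ler_bRintegral.
  - by apply: bmeasM => //; exact: bmeas_cst.
  - exact: bmeas_pair1 bF.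
  move=> x'; rewrite /F !indicE.
  have [|_] := boolP (x \in W); last by rewrite !(mulr0, mul0r).
  have [|_] := boolP (x' \in W); last by rewrite !(mulr0, mul0r).
  by rewrite !inE !mulr1 => Wx' Wx; exact: WC.
pose W2 : set (T * T) := W `*` W.
have mW2 : measurable W2 by exact: measurableX.
have i2 z : \1_W2 z = \1_W z.1 * \1_W z.2 :> R 
  by rewrite !indicE -natrM mulnb /W2 in_setX.
have J0 : \int[prod_prob mu mu]_z (p z.1 z.2 ^+ 2 * \1_W2 z) <= C.
  apply: (gibbs_square_le bc S mW2 C0) => -[x y] [x' y'] [/= Wx Wy] [/= Wx' Wy'].
  exact: WC.
have bJ : bmeas (fun z : T * T => p z.1 z.2 ^+ 2 * (\1_W z.1 * \1_W z.2)).
  apply: bmeasM; last exact: bmeasM.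
  by apply: (eq_bmeas (bmeasM bp bp)) => z; rewrite expr2.
have J : \int[prod_prob mu mu]_z (p z.1 z.2 ^+ 2 * (\1_W z.1 * \1_W z.2)) <= C.
  rewrite (@eq_Rintegral _ _ _ _ _ (fun z => p z.1 z.2 ^+ 2 * \1_W2 z))// => z _.
  by rewrite i2.
rewrite (bRintegral_prod mu mu (F := fun x y => p x y ^+ 2 * (\1_W x * \1_W y)))// in J.
have J' : \int[mu]_x \int[mu]_y (p y x ^+ 2 * (\1_W y * \1_W x)) <= C.
  by rewrite -(bRintegral_swap mu mu (F := fun x y => p x y ^+ 2 * (\1_W x * \1_W y))).
have DC : D * D <= C * C.
  apply: (le_trans DD).
  pose G x y := C / 2 * (p x y ^+ 2 * (\1_W x * \1_W y) + p y x ^+ 2 * (\1_W y * \1_W x)).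
  have bG2 : bmeas (fun z : T * T => p z.2 z.1 ^+ 2 * (\1_W z.2 * \1_W z.1)).
    exact: (bmeas_comp bsw bJ).
  have bG : bmeas (fun z : T * T => G z.1 z.2).
    by apply: bmeasM; [exact: bmeas_cst | exact: bmeasD].
  apply: (@le_trans _ _ (\int[mu]_x \int[mu]_y G x y)).
    apply: ler_bRintegral.
    - exact: (bmeas_fubini1 mu mu (F := F)).
    - exact: (bmeas_fubini1 mu mu (F := G)).
    move=> x; apply: ler_bRintegral.
    - exact: bmeas_pair1 bF.
    - exact: bmeas_pair1 bG.
    move=> y; rewrite /F /G [\1_W y * _]mulrC; apply: young => //.
  have -> : \int[mu]_x \int[mu]_y G x y = C / 2 *
     (\int[mu]_x \int[mu]_y (p x y ^+ 2 * (\1_W x * \1_W y)) +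
      \int[mu]_x \int[mu]_y (p y x ^+ 2 * (\1_W y * \1_W x))).
    rewrite -bRintegralD; [|exact: (bmeas_fubini1 mu mu (F := fun x y => p x y ^+ 2 * (\1_W x * \1_W y)))
      |exact: (bmeas_fubini1 mu mu (F := fun x y => p y x ^+ 2 * (\1_W y * \1_W x)))].
    rewrite -bRintegralZ; last first.
      apply: bmeasD; first exact: (bmeas_fubini1 mu mu (F := fun x y => p x y ^+ 2 * (\1_W x * \1_W y))).
      exact: (bmeas_fubini1 mu mu (F := fun x y => p y x ^+ 2 * (\1_W y * \1_W x))).
    apply: eq_Rintegral => x _.
    have h1 := bmeas_pair1 (F := fun x y => p x y ^+ 2 * (\1_W x * \1_W y)) x bJ.
    have h2 := bmeas_pair1 (F := fun x y => p y x ^+ 2 * (\1_W y * \1_W x)) x bG2.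
    rewrite -bRintegralD// -bRintegralZ//.
    exact: bmeasD.
  exact: half_sum C0 J J'.
by rewrite -(ler_pXn2r (n := 2))// ?nnegrE// !expr2.
Qed.

End gibbs_diagonal.

(** * Covering the support by cells *)

Section gibbs_covering.
Context {R : realType} {d : nat}.
Local Notation Rd := (d.-tuple R).
Variables (lambda : R) (B : set Rd).
Hypothesis lambda01 : 0 < lambda <= 1.
Hypothesis mB : measurable B.
Hypothesis B1 : forall x y, B x -> B y -> euclid_dist x y ^+ 2 <= 1.
Local Notation c := (@trunc_cost R d 1).
Let eps := 2 * lambda.
Let h := Num.sqrt lambda.

Let lambda0 : 0 < lambda. Proof. by case/andP: lambda01. Qed.
Let h0 : 0 < h. Proof. by rewrite sqrtr_gt0. Qed.
Let h1 : h <= 1.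
Proof. by case/andP: lambda01 => _ l1; rewrite -sqrtr1 ler_wsqrtr. Qed.
Let hh : h ^+ 2 = lambda. Proof. by rewrite sqr_sqrtr// ltW. Qed.

Let bc : bmeas (fun z : Rd * Rd => c z.1 z.2).
Proof. exact: bmeas_trunc_cost. Qed.

(** On [B] the truncation is inactive. Potentials and squared norms cancel in the quotient, and only
    the scalar product of the increments is left. *)
Lemma gibbs_cross (f g : Rd -> R) x y x' y' : B x -> B y -> B x' -> B y' ->
  gibbs c eps f g x y * gibbs c eps f g x' y' =
  expR ((\sum_(i < d) (tnth x i - tnth x' i) * (tnth y i - tnth y' i)) / lambda) *
  (gibbs c eps f g x y' * gibbs c eps f g x' y).
Proof.
move=> Bx By Bx' By'; rewrite /gibbs -!expRD; congr expR.
have cE a b : B a -> B b -> c a b = \sum_(i < d) (tnth b i - tnth a i) ^+ 2.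
  by move=> Ba Bb; rewrite /trunc_cost -sqr_euclid_dist; apply/min_idPl; exact: B1.
have cross : c x y + c x' y' = c x y' + c x' y -
    2 * \sum_(i < d) (tnth x i - tnth x' i) * (tnth y i - tnth y' i).
  rewrite !cE// mulr_sumr -!big_split/= -sumrB.
  by apply: eq_bigr => i _; ring.
set s := \sum_(i < d) _ in cross *.
have l0 : lambda != 0 by rewrite gt_eqF.
rewrite -!mulrDl (_ : s / lambda = 2 * s / eps); last by rewrite /eps; field.
by rewrite -mulrDl; congr (_ / _); move: cross; lra.
Qed.

(** Cells per coordinate: [x] and [y] are within 1 of [b0], so [x + y] measured from [2 * b0 - 2]
    lies between 0 and 4. The successor admits the index of the end point 4, and [h <= 1] absorbs it
    into [5 / h]. *)
Let K := (Num.truncn (4 / h)).+1.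

Let K_gt x : x <= 4 -> (Num.truncn (x / h) < K)%N.
Proof. by move=> x4; rewrite ltnS le_truncn// ler_pM2r ?invr_gt0. Qed.

Let K_le : K%:R <= 5 / h :> R.
Proof.
have h4 : 0 <= 4 / h by rewrite divr_ge0// ltW.
have k4 : (Num.truncn (4 / h))%:R <= 4 / h by rewrite truncn_le.
rewrite /K -natr1.
have : 1 <= h^-1 by rewrite invf_ge1.
by move: k4; lra.
Qed.

Definition cell_constant : R := expR (d%:R / 4).

(** At most [(5 / h) ^+ d] cells with [expR (d / 4)] for each. As [h] is the root of [lambda], this
    has order [lambda ^ (- d / 2)]. *)
Definition covering_bound : R := cell_constant * (5 / h) ^+ d.

Let cell (a : 'I_d -> R) (k : {ffun 'I_d -> 'I_K}) (u : 'I_d -> R) :=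
  forall i, (k i)%:R * h <= u i - a i < (k i).+1%:R * h.

Let cell_cross a k u u' i : cell a k u -> cell a k u' -> `|u i - u' i| <= h.
Proof.
move=> /(_ i) /andP[u1 u2] /(_ i) /andP[u1' u2'].
by move: u1 u2 u1' u2'; rewrite -natr1 mulrDl mul1r ler_norml; lra.
Qed.

(** In each coordinate the product of the increments is at most a quarter of the square of their
    sum, that is [lambda / 4]. Only the sums [x + y] need to be close. *)
Let sum_cross_le (x y x' y' : Rd) :
  (forall i, `|(tnth x i + tnth y i) - (tnth x' i + tnth y' i)| <= h) ->
  expR ((\sum_(i < d) (tnth x i - tnth x' i) * (tnth y i - tnth y' i)) / lambda) <=
  cell_constant.
Proof.
move=> uh; rewrite ler_expR ler_pdivrMr//.
apply: (@le_trans _ _ (\sum_(i < d) lambda / 4)); last first.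
  by rewrite sumr_const card_ord -[lambda / 4 *+ d]mulr_natl; lra.
apply: ler_sum => i _; rewrite -hh.
have u2 := uh i.
have : (tnth x i + tnth y i - (tnth x' i + tnth y' i)) ^+ 2 <= h ^+ 2.
  rewrite -[leLHS]real_normK ?num_real// lerXn2r// nnegrE ?normr_ge0//.
  exact: ltW.
have := sqr_ge0 (tnth x i - tnth x' i - (tnth y i - tnth y' i)).
lra.
Qed.

Let cell_cover (b0 : Rd) x y : B b0 -> B x -> B y ->
  exists k, cell (fun i => 2 * tnth b0 i - 2) k (fun i => tnth x i + tnth y i).
Proof.
move=> Bb Bx By.
have near t i : B t -> `|tnth t i - tnth b0 i| <= 1.
  move=> Bt; have := B1 Bb Bt; rewrite sqr_euclid_dist => s1.
  have : (tnth t i - tnth b0 i) ^+ 2 <= 1.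
    apply: le_trans s1; rewrite (bigD1 i)//= lerDl sumr_ge0// => j _.
    exact: sqr_ge0.
  by rewrite -[X in X <= _]real_normK ?num_real// expr_le1.
pose v i := tnth x i + tnth y i - (2 * tnth b0 i - 2).
have v04 i : 0 <= v i <= 4.
  have := near x i Bx; have := near y i By; rewrite !ler_norml /v; lra.
have vK i : (Num.truncn (v i / h) < K)%N by apply: K_gt; case/andP: (v04 i).
exists [ffun i => Ordinal (vK i)] => i; rewrite ffunE/=.
have vh : 0 <= v i / h by rewrite divr_ge0 ?(ltW h0)//; case/andP: (v04 i).
have := truncn_itv vh; rewrite -/(v i) => /andP[k1 k2].
by rewrite -ler_pdivlMr// -ltr_pdivrMr// k1 k2.
Qed.

Let measurable_cell {dZ} {Z : measurableType dZ} (u : 'I_d -> Z -> R) a k :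
  (forall i, measurable_fun setT (u i)) ->
  measurable [set z | cell a k (u^~ z)].
Proof.
move=> mu'; rewrite (_ : [set z | _] = \big[setI/setT]_(i < d)
   ((fun z => u i z - a i) @^-1` `[(k i)%:R * h, (k i).+1%:R * h[%classic)).
  apply: bigsetI_measurable => i _; rewrite -[X in measurable X]setTI.
  have := measurable_funB (mu' i) (measurable_cst (a i)).
  by apply.
rewrite -bigcap_seq; apply/seteqP; split => [z hz i _|z hz i] /=.
  by rewrite in_itv/=; exact: hz.
by have := hz i; rewrite /= mem_index_enum in_itv/=; exact.
Qed.

Let sum_le (F : {ffun 'I_d -> 'I_K} -> R) : (forall k, F k <= cell_constant) ->
  \sum_k F k <= covering_bound.
Proof.
move=> FC; apply: (@le_trans _ _ (\sum_(k : {ffun 'I_d -> 'I_K}) cell_constant)).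
  exact: ler_sum.
rewrite sumr_const card_ffun !card_ord -[leLHS]mulr_natl mulrC natrX.
rewrite ler_pM2l ?expR_gt0// lerXn2r// nnegrE// divr_ge0// ltW//.
Qed.

Let cell_constant_ge0 : 0 <= cell_constant. Proof. exact: expR_ge0. Qed.

Let B_inhabited (mu : probability Rd R) : mu B = 1%E -> exists b, B b.
Proof.
move=> B1'; apply/not_existsP => nB.
have : B = set0 by apply/seteqP; split => x // Bx; have := nB x.
by move=> B0; move: B1'; rewrite B0 measure0 => /eqP; rewrite eq_sym onee_eq0.
Qed.

Lemma gibbs_L2_le (mu nu : probability Rd R) (f g : Rd -> R) :
  mu B = 1%E -> nu B = 1%E -> schrodinger mu nu c eps f g ->
  \int[mu]_x \int[nu]_y (gibbs c eps f g x y ^+ 2) <= covering_bound.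
Proof.
move=> muB nuB S; have [b0 Bb0] := B_inhabited muB.
have [bf bg _ _] := S; have bG := bmeas_gibbs eps bc bf bg.
set p := gibbs c eps f g in bG *.
have bp2 : bmeas (fun z : Rd * Rd => p z.1 z.2 ^+ 2).
  by apply: (eq_bmeas (bmeasM bG bG)) => z; rewrite expr2.
rewrite -(bRintegral_prod mu nu (F := fun x y => p x y ^+ 2))//.
pose a i := 2 * tnth b0 i - 2.
pose W (k : {ffun 'I_d -> 'I_K}) : set (Rd * Rd) :=
  (B `*` B) `&` [set z | cell a k (fun i => tnth z.1 i + tnth z.2 i)].
have mBB : measurable (B `*` B) by exact: measurableX.
have mW k : measurable (W k).
  apply: measurableI => //.
  apply: (measurable_cell (u := fun i (z : Rd * Rd) => tnth z.1 i + tnth z.2 i)) => i.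
  apply: measurable_funD; first exact: (measurableT_comp (measurable_tnth i)).
  exact: (measurableT_comp (measurable_tnth i)).
have piB : prod_prob mu nu (B `*` B) = 1%E.
  by transitivity (mu B * nu B)%E; [exact: product_measure1E | rewrite muB nuB mule1].
have bW k : bmeas (fun z => p z.1 z.2 ^+ 2 * \1_(W k) z).
  by apply: bmeasM => //; exact: bmeas_indic.
apply: (@le_trans _ _ (\int[prod_prob mu nu]_z (p z.1 z.2 ^+ 2 * \1_(B `*` B) z))).
  rewrite le_eqVlt; apply/orP; left; apply/eqP; congr fine.
  apply: (ae_eq_bRintegral mBB piB).
  - by case: bp2.
  - by case: (bmeasM bp2 (bmeas_indic (R := R) mBB)).
  - by move=> z Bz; rewrite indicE mem_set// mulr1.
apply: (@le_trans _ _ (\int[prod_prob mu nu]_z \sum_k (p z.1 z.2 ^+ 2 * \1_(W k) z))).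
  apply: ler_bRintegral.
  - by apply: bmeasM => //; exact: bmeas_indic.
  - exact: bmeas_sum.
  move=> [x y]; rewrite indicE; have [|_] := boolP (_ \in _); last first.
    by rewrite mulr0 sumr_ge0// => k _; rewrite mulr_ge0 ?sqr_ge0// indicE ler0n.
  rewrite inE => -[/= Bx By]; have [k hk] := cell_cover Bb0 Bx By.
  rewrite (bigD1 k)//= indicE mem_set; last by split.
  by rewrite lerDl sumr_ge0// => j _; rewrite mulr_ge0 ?sqr_ge0// indicE ler0n.
rewrite bRintegral_sum//; apply: sum_le => k.
apply: (gibbs_square_le bc S (mW k) cell_constant_ge0).
move=> [x y] [x' y'] [[/= Bx By] cz] [[/= Bx' By'] cz'].
rewrite gibbs_cross// ler_wpM2r ?mulr_ge0 ?expR_ge0//.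
by apply: sum_cross_le => i; exact: cell_cross cz cz'.
Qed.

(** Cells are taken for [2 * x], so their points differ by at most [h / 2] per coordinate and the
    sums of any two pairs of points by at most [h]. *)
Lemma gibbs_diag_le (mu : probability Rd R) (f g : Rd -> R) :
  mu B = 1%E -> schrodinger mu mu c eps f g ->
  \int[mu]_x gibbs c eps f g x x <= covering_bound.
Proof.
move=> muB S; have [b0 Bb0] := B_inhabited muB.
have [bf bg _ _] := S; have bG := bmeas_gibbs_diag bc S.
pose a i := 2 * tnth b0 i - 2.
pose W (k : {ffun 'I_d -> 'I_K}) : set Rd :=
  B `&` [set z | cell a k (fun i => tnth z i + tnth z i)].
have mW k : measurable (W k).
  apply: measurableI => //.
  apply: (measurable_cell (u := fun i (z : Rd) => tnth z i + tnth z i)) => i.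
  by apply: measurable_funD; exact: measurable_tnth.
have bW k : bmeas (fun z => gibbs c eps f g z z * \1_(W k) z).
  by apply: bmeasM => //; exact: bmeas_indic.
apply: (@le_trans _ _ (\int[mu]_z (gibbs c eps f g z z * \1_B z))).
  rewrite le_eqVlt; apply/orP; left; apply/eqP; congr fine.
  apply: (ae_eq_bRintegral mB muB).
  - by case: bG.
  - by case: (bmeasM bG (bmeas_indic (R := R) mB)).
  - by move=> z Bz; rewrite indicE mem_set// mulr1.
apply: (@le_trans _ _ (\int[mu]_z \sum_k (gibbs c eps f g z z * \1_(W k) z))).
  apply: ler_bRintegral.
  - by apply: bmeasM => //; exact: bmeas_indic.
  - exact: bmeas_sum.
  move=> x; rewrite indicE; have [|_] := boolP (_ \in _); last first.
    by rewrite mulr0 sumr_ge0// => k _; rewrite mulr_ge0 ?expR_ge0// indicE ler0n.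
  rewrite inE => Bx; have [k hk] := cell_cover Bb0 Bx Bx.
  rewrite (bigD1 k)//= indicE mem_set; last by split.
  by rewrite lerDl sumr_ge0// => j _; rewrite mulr_ge0 ?expR_ge0// indicE ler0n.
rewrite bRintegral_sum//; apply: sum_le => k.
apply: (gibbs_diagonal_le bc S (mW k) cell_constant_ge0).
move=> x y x' y' [Bx cx] [By cy] [Bx' cx'] [By' cy'].
rewrite gibbs_cross// ler_wpM2r ?mulr_ge0 ?expR_ge0//.
apply: sum_cross_le => i; have := cell_cross i cx cx'; have := cell_cross i cy cy'.
by rewrite !ler_norml; lra.
Qed.

End gibbs_covering.

(** * Expected deviation of the empirical cost *)

Section emp_cost_deviation.
Context {R : realType} {d n : nat}.
Local Notation Rd := (d.-tuple R).
Variables (n_gt0 : (0 < n)%N) (c : Rd -> Rd -> R) (lambda : R).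
Hypothesis bc : bmeas (fun z : Rd * Rd => c z.1 z.2).
Hypothesis c1 : forall a b, 0 <= c a b <= 1.
Hypothesis lambda0 : 0 < lambda.
Implicit Types x y : 'I_n -> Rd.
Let eps := 2 * lambda.
Let eps0 : 0 < eps. Proof. exact: mulr_gt0. Qed.

Lemma norm_emp_cost_le x y : `|emp_cost n_gt0 c lambda x y| <= 3.
Proof.
have [f [g [S fM gM]]] := schrodinger_ex (empirical_prob n_gt0 x)
  (empirical_prob n_gt0 y) bc eps0 c1.
rewrite (emp_cost_schrodinger bc lambda0 S).
have h1 : mean (fun i => `|f (x i)|) <= 1.
  by rewrite -[leRHS](mean_cst n_gt0); exact: ler_mean.
have h2 : mean (fun i => `|g (y i)|) <= 2.
  rewrite -[leRHS](mean_cst n_gt0); apply: ler_mean => // i.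
  by rewrite (le_trans (gM _))// mulr1.
have := ler_norm_mean (f \o x); have := ler_norm_mean (g \o y).
rewrite /comp => k1 k2; rewrite (le_trans (ler_normD _ _))//.
by move: h1 h2 k1 k2; lra.
Qed.

Hypothesis lambda1 : lambda <= 1.
Let eps2 : eps <= 2. Proof. by rewrite /eps; move: lambda1; lra. Qed.

(** The population potentials are tested in the empirical dual, where the couplings they define have
    row defects [r] and column defects [s]. The factor 4 on rows is [eps <= 2] from the Gibbs mass
    plus 2 from [f' - f]; the one on columns comes from [g' - g]. *)
Lemma emp_cost_dev (mu nu : probability Rd R) f g x y :
  (forall t, `|f t| <= 1) -> (forall t, `|g t| <= 2) ->
  `|emp_cost n_gt0 c lambda x y - (\int[mu]_t f t + \int[nu]_t g t)| <=
  `|mean (fun i => f (x i) - \int[mu]_t f t)| +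
  `|mean (fun j => g (y j) - \int[nu]_t g t)| +
  4 * mean (fun i => `|mean (fun j => 1 - gibbs c eps f g (x i) (y j))|) +
  4 * mean (fun j => `|mean (fun i => 1 - gibbs c eps f g (x i) (y j))|).
Proof.
move=> fM gM; pose p i j := gibbs c eps f g (x i) (y j).
pose a i := f (x i); pose b j := g (y j); pose C := cost_mx c x y.
pose r i := mean (fun j => 1 - p i j); pose s j := mean (fun i => 1 - p i j).
rewrite -/(mean (fun i => `|r i|)) -/(mean (fun j => `|s j|)).
pose P i j := gibbs_mx eps a b C i j.
have PE i j : P i j = n%:R^-1 * (n%:R^-1 * p i j).
  by rewrite /P /gibbs_mx expr2 -mulrA.
have Prow i : \sum_(j < n) P i j = n%:R^-1 * (1 - r i).
  rewrite /r meanB mean_cst// opprB addrC subrK /mean mulr_sumr mulr_sumr.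
  by apply: eq_bigr => j _; rewrite PE.
have Pcol j : \sum_(i < n) P i j = n%:R^-1 * (1 - s j).
  rewrite /s meanB mean_cst// opprB addrC subrK /mean mulr_sumr mulr_sumr.
  by apply: eq_bigr => i _; rewrite PE.
have PT : \sum_(i < n) \sum_(j < n) P i j = 1 - mean r.
  rewrite -[X in _ = X - _](mean_cst n_gt0) -meanB /mean mulr_sumr.
  by apply: eq_bigr => i _; exact: Prow.
have nr : `|mean r| <= mean (fun i => `|r i|) by exact: ler_norm_mean.
have nr0 : 0 <= mean (fun i => `|r i|) by exact: le_trans nr.
have ns0 : 0 <= mean (fun i => `|s i|).
  by apply: le_trans (ler_norm_mean s).
have er : `|eps * mean r| <= 2 * mean (fun i => `|r i|).
  by rewrite normrM ger0_norm ?(ltW eps0)// ler_pM// ltW.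
have lo : mean a + mean b + eps * mean r <= emp_cost n_gt0 c lambda x y.
  have := emp_cost_dual n_gt0 bc c1 lambda0 x y a b.
  by rewrite /dual_value -/eps -/C (eq_bigr (fun i => \sum_(j < n) P i j))// PT; lra.
(* The tangent at the population potentials is evaluated at the empirical optimum, of Gibbs mass 1.
   There [a' - a] and [b' - b], bounded by 2 and 4, are paired with [r] and [s]. *)
have hi : emp_cost n_gt0 c lambda x y <= mean a + mean b +
   eps * mean r + 2 * mean (fun i => `|r i|) + 4 * mean (fun j => `|s j|).
  have [f' [g' [S fM' gM']]] := schrodinger_ex (empirical_prob n_gt0 x)
    (empirical_prob n_gt0 y) bc eps0 c1.
  rewrite (emp_cost_schrodinger bc lambda0 S).
  pose a' i := f' (x i); pose b' j := g' (y j).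
  have -> : mean (f' \o x) = mean a' by [].
  have -> : mean (g' \o y) = mean b' by [].
  have := dual_tangent eps0 a b C a' b' C.
  have -> : \sum_(i < n) \sum_(j < n) gibbs_mx eps a' b' C i j = 1.
    transitivity (mean (fun i => mean (fun j => gibbs c eps f' g' (x i) (y j)))).
      rewrite /mean mulr_sumr; apply: eq_bigr => i _.
      rewrite mulr_sumr mulr_sumr; apply: eq_bigr => j _.
      by rewrite /gibbs_mx expr2 -mulrA.
    under [X in mean X]funext do rewrite (schrodinger_row bc S).
    exact: mean_cst.
  rewrite (eq_bigr (fun i => \sum_(j < n) P i j))// PT.
  have -> : \sum_(i < n) \sum_(j < n) gibbs_mx eps a b C i j *
      (a' i + b' j - C i j - (a i + b j - C i j)) =
      mean (fun i => (a' i - a i) * (1 - r i)) + mean (fun j => (b' j - b j) * (1 - s j)).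
    transitivity (\sum_(i < n) \sum_(j < n) (P i j * (a' i - a i)) +
      \sum_(i < n) \sum_(j < n) (P i j * (b' j - b j))).
      rewrite -big_split; apply: eq_bigr => i _ /=.
      rewrite -big_split; apply: eq_bigr => j _ /=; rewrite -/(P i j); ring.
    congr (_ + _).
      rewrite /mean mulr_sumr; apply: eq_bigr => i _.
      by rewrite -mulr_suml Prow; ring.
    rewrite exchange_big /mean mulr_sumr; apply: eq_bigr => j _.
    by rewrite -mulr_suml Pcol; ring.
  have h1 : mean a' - mean a - mean (fun i => (a' i - a i) * (1 - r i)) <=
      2 * mean (fun i => `|r i|).
    rewrite -!meanB -meanZ; apply: ler_mean => // i.
    have := fM (x i); have := fM' (x i) => k1 k2.
    have : (a' i - a i) * r i <= 2 * `|r i|.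
      rewrite (le_trans (ler_norm _))// normrM ler_wpM2r//.
      by rewrite (le_trans (ler_normB _ _))// /a /a'; move: k1 k2; lra.
    by lra.
  have h2 : mean b' - mean b - mean (fun i => (b' i - b i) * (1 - s i)) <=
      4 * mean (fun i => `|s i|).
    rewrite -!meanB -meanZ; apply: ler_mean => // i.
    have := gM (y i); have := gM' (y i) => k1 k2.
    have : (b' i - b i) * s i <= 4 * `|s i|.
      rewrite (le_trans (ler_norm _))// normrM ler_wpM2r//.
      by rewrite (le_trans (ler_normB _ _))// /b /b'; move: k1 k2; lra.
    by lra.
  by move: h1 h2; lra.
rewrite !meanB !mean_cst// -/(mean a) -/(mean b).
have n1 := ler_norm (mean a - \int[mu]_t f t).
have n2 := ler_norm (mean b - \int[nu]_t g t).
have n1' := ler_norm (- (mean a - \int[mu]_t f t)).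
have n2' := ler_norm (- (mean b - \int[nu]_t g t)).
rewrite !normrN in n1' n2'.
move: er lo hi n1 n2 n1' n2' nr0 ns0.
move: (`|mean a - _|) (`|mean b - _|) (mean (fun i => `|r i|)) (mean (fun i => `|s i|)) => u1 u2 u3 u4.
rewrite !ler_norml; lra.
Qed.

End emp_cost_deviation.

Section sample_means.
Context {dO} {Omega : measurableType dO} {R : realType} {dT} {T : measurableType dT}.
Variables (P : probability Omega R) (J : finType) (Z : J -> {RV P >-> T}).
Variable law : J -> probability T R.
Hypothesis Zlaw : forall j, has_law (Z j) (law j).
Hypothesis Zind : mutually_independent Z.
Variables (n : nat) (n_gt0 : (0 < n)%N) (b : 'I_n -> J) (nu : probability T R).
Hypothesis binj : injective b.
Hypothesis lawb : forall j, law (b j) = nu.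

Let bZ j (h : T -> R) : bmeas h -> bmeas (fun w => h (Z j w)).
Proof. by move=> bh; apply: (bmeas_comp _ bh). Qed.

Let bZ2 i j (h : T -> T -> R) : bmeas (fun z : T * T => h z.1 z.2) ->
  bmeas (fun w => h (Z i w) (Z j w)).
Proof.
move=> bh; apply: (bmeas_comp (g := fun w => (Z i w, Z j w)) _ bh).
exact: measurable_fun_pair.
Qed.

Lemma sample_mean_dev (h : T -> R) (M : R) : bmeas h -> (forall t, `|h t| <= M) ->
  \int[P]_w `|mean (fun j => h (Z (b j) w) - \int[nu]_t h t)| <=
  Num.sqrt ((2 * M) ^+ 2 / n%:R).
Proof.
move=> bh hM; set m := \int[nu]_t h t.
have [t0 _] := probability_inhabited nu.
have M0 : 0 <= M by rewrite (le_trans _ (hM t0)).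
have bhm : bmeas (fun t => h t - m) by apply: bmeasB => //; exact: bmeas_cst.
have mM : `|m| <= M.
  by rewrite (le_trans (ler_norm_bRintegral _ bh))//; apply: bRintegral_le => //; exact: bmeas_norm.
have hm0 : \int[nu]_t (h t - m) = 0.
  by rewrite bRintegralB//; [rewrite bRintegral_cst subrr | exact: bmeas_cst].
apply: (orthogonal_mean_le (W := fun j w => h (Z (b j) w) - m)) => //.
- by move=> j; exact: (bZ _ bhm).
- move=> j k jk; have bjk : b j != b k by apply: contra_neq jk; exact: binj.
  rewrite (sample_pair_law Zlaw Zind (phi := fun x y => (h x - m) * (h y - m)) bjk).
    under eq_Rintegral do rewrite bRintegralZ// lawb hm0 mulr0.
    exact: bRintegral_cst.
  apply: bmeasM; first exact: (bmeas_comp (g := fst) _ bhm).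
  exact: (bmeas_comp (g := snd) _ bhm).
- move=> j; apply: bRintegral_le.
    by apply: (eq_bmeas (bmeasM (bZ (b j) bhm) (bZ (b j) bhm))) => w; rewrite expr2.
  move=> w; rewrite -[leLHS]real_normK ?num_real// lerXn2r// ?nnegrE ?mulr_ge0//.
  rewrite (le_trans (ler_normB _ _))//.
  by have := hM (Z (b j) w); move: mM; lra.
Qed.

(* The terms [phi (Z a, Z (b j))] with [b j != a] are orthogonal because
   [phi] integrates to zero in its second variable. *)
Lemma conditional_mean_dev (a : J) (phi : T -> T -> R) (V D : R) :
  bmeas (fun z : T * T => phi z.1 z.2) ->
  (forall x, \int[nu]_y phi x y = 0) ->
  0 <= V -> \int[law a]_x \int[nu]_y (phi x y ^+ 2) <= V ->
  0 <= D -> (forall j, b j = a -> \int[law a]_x `|phi x x| <= D) ->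
  \int[P]_w `|mean (fun j => phi (Z a w) (Z (b j) w))| <=
  Num.sqrt (V / n%:R) + D / n%:R.
Proof.
move=> bphi phi0 V0 phiV D0 phiD.
pose W j w := if b j == a then 0 else phi (Z a w) (Z (b j) w).
(* By injectivity at most one index [j] has [b j = a]; this single term is split off and contributes
   [D / n]. *)
pose U j w := if b j == a then `|phi (Z a w) (Z a w)| else 0.
have bphi2 : bmeas (fun z : T * T => phi z.1 z.2 ^+ 2).
  by apply: (eq_bmeas (bmeasM bphi bphi)) => z; rewrite expr2.
have bW j : bmeas (W j).
  by rewrite /W; case: (b j == a); [exact: bmeas_cst | exact: bZ2].
have bU j : bmeas (U j).
  by rewrite /U; case: (b j == a); [exact/bmeas_norm/bZ2 | exact: bmeas_cst].
have n0 : 0 < n%:R :> R by rewrite ltr0n.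
apply: (@le_trans _ _ (\int[P]_w (`|n%:R^-1 * \sum_(j < n) W j w| +
                                  n%:R^-1 * \sum_(j < n) U j w))).
  apply: ler_bRintegral.
  - apply/bmeas_norm/bmeasM; first exact: bmeas_cst.
    by apply: bmeas_sum => j _; exact: bZ2.
  - apply: bmeasD; first by apply/bmeas_norm/bmeasM; [exact: bmeas_cst | exact: bmeas_sum].
    by apply: bmeasM; [exact: bmeas_cst | exact: bmeas_sum].
  move=> w; rewrite /mean (eq_bigr (fun j => W j w + (if b j == a then phi (Z a w) (Z a w) else 0))).
    rewrite big_split mulrDr (le_trans (ler_normD _ _))// lerD2l.
    rewrite normrM ger0_norm ?invr_ge0 ?ler0n// ler_wpM2l ?invr_ge0 ?ler0n//.
    rewrite (le_trans (ler_norm_sum _ _ _))// ler_sum// => j _.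
    by rewrite /U; case: ifP; rewrite ?normr0.
  by move=> j _; rewrite /W; case: eqP => [->|_]; rewrite ?add0r ?addr0.
rewrite bRintegralD; last 2 first.
- by apply/bmeas_norm/bmeasM; [exact: bmeas_cst | exact: bmeas_sum].
- by apply: bmeasM; [exact: bmeas_cst | exact: bmeas_sum].
apply: lerD.
  apply: orthogonal_mean_le => //.
  - move=> j k jk; rewrite /W; have [_|aj] := eqVneq (b j) a.
      by under eq_Rintegral do rewrite mul0r; exact: bRintegral_cst.
    have [_|ak] := eqVneq (b k) a.
      by under eq_Rintegral do rewrite mulr0; exact: bRintegral_cst.
    have bjk : b j != b k by apply: contra_neq jk; exact: binj.
    have b1 : bmeas (fun z : T * T * T => phi z.1.1 z.1.2).
      exact: (bmeas_comp (g := fst) _ bphi).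
    have b2 : bmeas (fun z : T * T * T => phi z.1.1 z.2).
      apply: (bmeas_comp (g := fun z : T * T * T => (z.1.1, z.2)) _ bphi).
      apply: measurable_fun_pair => //.
      exact: (measurableT_comp measurable_fst measurable_fst).
    rewrite eq_sym in aj; rewrite eq_sym in ak.
    (* Both factors share the point [Z a], so they are not independent; the third variable is
       integrated first, with the other two fixed. *)
    rewrite (sample_triple_law Zlaw Zind (phi := fun x y z => phi x y * phi x z) aj ak bjk).
      rewrite -[RHS](bRintegral_cst (law a)); apply: eq_Rintegral => x _.
      rewrite -[RHS](bRintegral_cst (law (b j))); apply: eq_Rintegral => y _.
      by rewrite bRintegralZ ?lawb ?phi0 ?mulr0//; exact: bmeas_pair1 bphi.
    exact: bmeasM.
  - move=> j; rewrite /W; have [_|aj] := eqVneq (b j) a.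
      by under eq_Rintegral do rewrite expr0n/=; rewrite bRintegral_cst.
    rewrite eq_sym in aj.
    by rewrite (sample_pair_law Zlaw Zind (phi := fun x y => phi x y ^+ 2) aj)// lawb.
rewrite bRintegralZ; last exact: bmeas_sum.
rewrite mulrC ler_pM2r ?invr_gt0// bRintegral_sum//.
have bdiag : bmeas (fun x => `|phi x x|).
  apply: bmeas_norm; apply: (bmeas_comp (g := fun x : T => (x, x)) _ bphi).
  exact: measurable_fun_pair.
have [/existsP[j0 /eqP bj0]|/existsPn none] := boolP [exists j, b j == a].
  rewrite (bigD1 j0)//= big1 ?addr0; last first.
    move=> j jj0; have bja : b j != a by rewrite -bj0; apply: contra_neq jj0; exact: binj.
    by rewrite /U (negbTE bja) bRintegral_cst.
  rewrite /U bj0 eqxx (sample_law Zlaw a bdiag); exact: phiD bj0.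
by rewrite big1// => j _; rewrite /U (negbTE (none j)) bRintegral_cst.
Qed.

End sample_means.

Lemma ler_covering_bound0 (R : realType) (d : nat) (lambda : R) :
  0 <= @covering_bound R d lambda.
Proof.
by rewrite mulr_ge0 ?expR_ge0// exprn_ge0// divr_ge0// sqrtr_ge0.
Qed.

Section emp_cost_mean_dev.
Context {dO} {Omega : measurableType dO} {R : realType} {d n : nat}.
Local Notation Rd := (d.-tuple R).
Variables (P : probability Omega R) (J : finType) (Z : J -> {RV P >-> Rd}).
Variable law : J -> probability Rd R.
Hypothesis Zlaw : forall j, has_law (Z j) (law j).
Hypothesis Zind : mutually_independent Z.
Variables (n_gt0 : (0 < n)%N) (a b : 'I_n -> J) (mu nu : probability Rd R).
Hypotheses (ainj : injective a) (binj : injective b).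
Hypotheses (lawa : forall i, law (a i) = mu) (lawb : forall j, law (b j) = nu).
Variables (lambda : R) (B : set Rd).
Hypothesis lambda01 : 0 < lambda <= 1.
Local Notation c := (@trunc_cost R d 1).
Let eps := 2 * lambda.
Let V := @covering_bound R d lambda.

Let lambda0 : 0 < lambda. Proof. by case/andP: lambda01. Qed.
Let lambda1 : lambda <= 1. Proof. by case/andP: lambda01. Qed.
Let eps0 : 0 < eps. Proof. exact: mulr_gt0. Qed.

Let bc : bmeas (fun z : Rd * Rd => c z.1 z.2).
Proof. exact: bmeas_trunc_cost. Qed.

Let c1 x y : 0 <= c x y <= 1.
Proof. by rewrite trunc_cost_ge0// trunc_cost_le. Qed.

Let emp w := emp_cost n_gt0 c lambda (fun i => Z (a i) w) (fun j => Z (b j) w).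

Lemma bmeas_emp_cost : bmeas emp.
Proof.
split; last by exists 3 => w; exact: norm_emp_cost_le.
exact: (measurable_emp_cost (X := fun i w => Z (a i) w) (Y := fun j w => Z (b j) w)
  n_gt0 bc c1).
Qed.

Hypothesis mB : measurable B.
Hypothesis B1 : forall x y, B x -> B y -> euclid_dist x y ^+ 2 <= 1.
Hypothesis muB : mu B = 1%E.
Hypothesis nuB : nu B = 1%E.
(* The second alternative is used with [a = b], when both samples coincide. *)
Hypothesis disj : (forall i j, a i != b j) \/ mu = nu.

Let integral_weighted (F1 F2 F3 F4 : Omega -> R) :
  bmeas F1 -> bmeas F2 -> bmeas F3 -> bmeas F4 ->
  \int[P]_w (F1 w + F2 w + 4 * F3 w + 4 * F4 w) =
  \int[P]_w F1 w + \int[P]_w F2 w + 4 * \int[P]_w F3 w + 4 * \int[P]_w F4 w.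
Proof.
move=> b1 b2 b3 b4; have b4Z (F : Omega -> R) : bmeas F -> bmeas (fun w => 4 * F w).
  by move=> bF; apply: bmeasM => //; exact: bmeas_cst.
rewrite (bRintegralD P (bmeasD (bmeasD b1 b2) (b4Z _ b3)) (b4Z _ b4)).
rewrite (bRintegralD P (bmeasD b1 b2) (b4Z _ b3)) (bRintegralD P b1 b2).
by rewrite (bRintegralZ P 4 b3) (bRintegralZ P 4 b4).
Qed.

Lemma emp_cost_mean_dev :
  \int[P]_w `|emp w - fine (cost_eot c lambda mu nu)| <=
  Num.sqrt ((2 * 1) ^+ 2 / n%:R) + Num.sqrt ((2 * 2) ^+ 2 / n%:R) +
  8 * (Num.sqrt (V / n%:R) + (1 + V) / n%:R).
Proof.
have V0 : 0 <= V by exact: ler_covering_bound0.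
have V10 : 0 <= 1 + V by rewrite addr_ge0.
have [f [g [S fM gM]]] := schrodinger_ex mu nu bc eps0 c1.
rewrite mulr1 in gM.
rewrite (cost_eot_schrodinger bc lambda0 S)/=.
have [bf bg px py] := S; have bG := bmeas_gibbs eps bc bf bg.
have L2 := gibbs_L2_le lambda01 mB B1 muB nuB S.
rewrite -/eps in S px py bG L2 *.
set p := gibbs c eps f g in px py bG L2.
pose phi x y := 1 - p x y; pose phiT y x := 1 - p x y.
have bphi : bmeas (fun z : Rd * Rd => phi z.1 z.2).
  by apply: bmeasB => //; exact: bmeas_cst.
have bphi2 : bmeas (fun z : Rd * Rd => phi z.1 z.2 ^+ 2).
  by apply: (eq_bmeas (bmeasM bphi bphi)) => z; rewrite expr2.
have bphiT : bmeas (fun z : Rd * Rd => phiT z.1 z.2).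
  apply: (bmeas_comp (g := fun z : Rd * Rd => (z.2, z.1)) _ bphi).
  exact: measurable_fun_pair.
have phi0 x : \int[nu]_y phi x y = 0.
  rewrite bRintegralB; [|exact: bmeas_cst|exact: bmeas_pair1 bG].
  by rewrite bRintegral_cst px subrr.
have phiT0 y : \int[mu]_x phiT y x = 0.
  rewrite bRintegralB; [|exact: bmeas_cst|exact: (bmeas_pair2 (F := p)) bG].
  by rewrite bRintegral_cst py subrr.
have bp2 : bmeas (fun z : Rd * Rd => p z.1 z.2 ^+ 2).
  by apply: (eq_bmeas (bmeasM bG bG)) => z; rewrite expr2.
(* By the row constraint the integral of [(1 - p) ^+ 2] is that of [p ^+ 2] minus 1. *)
have phiV : \int[mu]_x \int[nu]_y (phi x y ^+ 2) <= V.
  apply: le_trans L2; apply: ler_bRintegral.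
  - exact: (bmeas_fubini1 mu nu (F := fun x y => phi x y ^+ 2)).
  - exact: (bmeas_fubini1 mu nu (F := fun x y => p x y ^+ 2)).
  move=> x; have b1 := bmeas_pair1 x bG; have b2 := bmeas_pair1 (F := fun x y => p x y ^+ 2) x bp2.
  have b3 : bmeas (fun y => 1 - 2 * p x y).
    by apply: bmeasB; [exact: bmeas_cst | apply: bmeasM => //; exact: bmeas_cst].
  rewrite (@eq_Rintegral _ _ _ _ _ (fun y => p x y ^+ 2 + (1 - 2 * p x y))); last first.
    by move=> y _; rewrite /phi; ring.
  rewrite bRintegralD// bRintegralB; [|exact: bmeas_cst|by apply: bmeasM => //; exact: bmeas_cst].
  by rewrite bRintegralZ// px bRintegral_cst; lra.
have phiTV : \int[nu]_y \int[mu]_x (phiT y x ^+ 2) <= V.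
  by rewrite -(bRintegral_swap mu nu (F := fun x y => phi x y ^+ 2)).
have diag : mu = nu -> \int[mu]_x `|phi x x| <= 1 + V.
  move=> mn; have S' : schrodinger mu mu c eps f g by rewrite {2}mn.
  have D := gibbs_diag_le lambda01 mB B1 muB S'.
  have bD := bmeas_gibbs_diag bc S'.
  apply: (@le_trans _ _ (\int[mu]_x (1 + p x x))).
    apply: ler_bRintegral.
    - apply: bmeas_norm; apply: (bmeas_comp (g := fun x : Rd => (x, x)) _ bphi).
      exact: measurable_fun_pair.
    - by apply: bmeasD => //; exact: bmeas_cst.
    move=> x; rewrite /phi (le_trans (ler_normB _ _))// normr1 lerD2l.
    by rewrite ger0_norm ?expR_ge0.
  rewrite bRintegralD//; last exact: bmeas_cst.
  by rewrite bRintegral_cst lerD2l.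
have diagab i j : b j = a i -> mu = nu.
  by case: disj => // ab /eqP; rewrite eq_sym (negbTE (ab i j)).
have row i : \int[P]_w `|mean (fun j => phi (Z (a i) w) (Z (b j) w))| <=
    Num.sqrt (V / n%:R) + (1 + V) / n%:R.
  apply: (conditional_mean_dev Zlaw Zind n_gt0 binj lawb (phi := phi) bphi phi0 V0 _ V10).
    by rewrite lawa; exact: phiV.
  by move=> j ba; rewrite lawa; apply: diag; exact: diagab ba.
have col j : \int[P]_w `|mean (fun i => phiT (Z (b j) w) (Z (a i) w))| <=
    Num.sqrt (V / n%:R) + (1 + V) / n%:R.
  apply: (conditional_mean_dev Zlaw Zind n_gt0 ainj lawa (phi := phiT) bphiT phiT0 V0 _ V10).
    by rewrite lawb; exact: phiTV.
  move=> i ab; rewrite lawb; have mn := diagab _ _ (esym ab).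
  by rewrite -mn; exact: diag mn.
have bZ2 i j (h : Rd -> Rd -> R) : bmeas (fun z : Rd * Rd => h z.1 z.2) ->
    bmeas (fun w => h (Z i w) (Z j w)).
  move=> bh; apply: (bmeas_comp (g := fun w => (Z i w, Z j w)) _ bh).
  exact: measurable_fun_pair.
have bmean (F : 'I_n -> Omega -> R) : (forall i, bmeas (F i)) -> bmeas (fun w => mean (F^~ w)).
  by move=> bF; apply: bmeasM; [exact: bmeas_cst | exact: bmeas_sum].
have Emean (F : 'I_n -> Omega -> R) (e : R) : (forall i, bmeas (F i)) ->
    (forall i, \int[P]_w F i w <= e) -> \int[P]_w mean (F^~ w) <= e.
  move=> bF Fe; rewrite bRintegralZ; last exact: bmeas_sum.
  rewrite bRintegral_sum//; apply: (le_trans (ler_mean n_gt0 Fe)).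
  by rewrite mean_cst.
pose F1 w := `|mean (fun i => f (Z (a i) w) - \int[mu]_t f t)|.
pose F2 w := `|mean (fun j => g (Z (b j) w) - \int[nu]_t g t)|.
pose F3 w := mean (fun i => `|mean (fun j => phi (Z (a i) w) (Z (b j) w))|).
pose F4 w := mean (fun j => `|mean (fun i => phiT (Z (b j) w) (Z (a i) w))|).
have bF1 : bmeas F1.
  apply/bmeas_norm/bmean => i; apply: bmeasB; last exact: bmeas_cst.
  exact: (bmeas_comp _ bf).
have bF2 : bmeas F2.
  apply/bmeas_norm/bmean => i; apply: bmeasB; last exact: bmeas_cst.
  exact: (bmeas_comp _ bg).
have b3 i : bmeas (fun w => `|mean (fun j => phi (Z (a i) w) (Z (b j) w))|).
  by apply/bmeas_norm/bmean => j; exact: bZ2.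
have b4 j : bmeas (fun w => `|mean (fun i => phiT (Z (b j) w) (Z (a i) w))|).
  by apply/bmeas_norm/bmean => i; exact: bZ2.
have bF3 : bmeas F3 by exact: bmean.
have bF4 : bmeas F4 by exact: bmean.
have b4Z (F : Omega -> R) : bmeas F -> bmeas (fun w => 4 * F w).
  by move=> bF; apply: bmeasM => //; exact: bmeas_cst.
have b12 := bmeasD bF1 bF2; have b123 := bmeasD b12 (b4Z _ bF3).
apply: (@le_trans _ _ (\int[P]_w (F1 w + F2 w + 4 * F3 w + 4 * F4 w))).
  apply: ler_bRintegral.
  - by apply/bmeas_norm/bmeasB; [exact: bmeas_emp_cost | exact: bmeas_cst].
  - exact: bmeasD b123 (b4Z _ bF4).
  move=> w; exact: (emp_cost_dev n_gt0 bc c1 lambda0 lambda1 mu nu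
    (fun i => Z (a i) w) (fun j => Z (b j) w) fM gM).
rewrite (integral_weighted bF1 bF2 bF3 bF4).
have E1 : \int[P]_w F1 w <= _ := sample_mean_dev Zlaw Zind n_gt0 ainj lawa bf fM.
have E2 : \int[P]_w F2 w <= _ := sample_mean_dev Zlaw Zind n_gt0 binj lawb bg gM.
have E3 : \int[P]_w F3 w <= _ := Emean _ _ b3 row.
have E4 : \int[P]_w F4 w <= _ := Emean _ _ b4 col.
have := lerD (lerD (lerD E1 E2) (ler_wpM2l (ler0n R 4) E3)) (ler_wpM2l (ler0n R 4) E4).
move=> /le_trans; apply.
by rewrite -[leLHS]addrA lerD2l -mulrDl -natrD.
Qed.

End emp_cost_mean_dev.

(** * The one-dimensional case *)

Lemma schrodinger_sym {d1 d2} {T1 : measurableType d1} {T2 : measurableType d2}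
    {R : realType} (mu : probability T1 R) (nu : probability T2 R)
    (c : T1 -> T2 -> R) (eps : R) f g :
  schrodinger mu nu c eps f g -> schrodinger nu mu (fun y x => c x y) eps g f.
Proof.
move=> [bf bg f1 g1]; split; [exact: bg|exact: bf|move=> y|move=> x].
  by rewrite -(g1 y); apply: eq_Rintegral => x _; rewrite /gibbs [g y + _]addrC.
by rewrite -(f1 x); apply: eq_Rintegral => y _; rewrite /gibbs [g y + _]addrC.
Qed.

Section marginal_stability.
Context {R : realType} {d : nat}.
Local Notation Rd := (d.-tuple R).
Variables (c : Rd -> Rd -> R) (lambda : R).
Hypothesis bc : bmeas (fun z : Rd * Rd => c z.1 z.2).
Hypothesis c1 : forall x y, 0 <= c x y <= 1.
Hypothesis lambda0 : 0 < lambda.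
Let eps := 2 * lambda.
Let eps0 : 0 < eps. Proof. exact: mulr_gt0. Qed.

Lemma cost_eot_fine (mu nu : probability Rd R) :
  (fine (cost_eot c lambda mu nu))%:E = cost_eot c lambda mu nu.
Proof.
have [f [g [S _ _]]] := schrodinger_ex mu nu bc eps0 c1.
by rewrite (cost_eot_schrodinger bc lambda0 S).
Qed.

(** The row constraint holds at every [x], so the potentials of [(mu, nu)] keep Gibbs mass 1 under
    [mu'] and are admissible there without penalty. *)
Lemma cost_eot_fst_le (mu mu' nu : probability Rd R) f g :
  schrodinger mu nu c eps f g ->
  fine (cost_eot c lambda mu nu) - fine (cost_eot c lambda mu' nu) <=
  \int[mu]_x f x - \int[mu']_x f x.
Proof.
move=> S; have [bf bg f1 _] := S.
rewrite (cost_eot_schrodinger bc lambda0 S)/=.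
have := cost_eot_ge mu' nu bc lambda0 bf bg.
have -> : \int[mu']_x \int[nu]_y gibbs c eps f g x y = 1.
  by rewrite -[RHS](bRintegral_cst mu'); apply: eq_Rintegral => x _; exact: f1.
rewrite -[X in (_ <= X)%E -> _]cost_eot_fine lee_fin subrr mulr0 subr0.
move: (fine _) (\int[mu]_x f x) (\int[mu']_x f x) (\int[nu]_y g y).
by move=> t a b e; lra.
Qed.

Lemma cost_eot_snd_le (mu nu nu' : probability Rd R) f g :
  schrodinger mu nu c eps f g ->
  fine (cost_eot c lambda mu nu) - fine (cost_eot c lambda mu nu') <=
  \int[nu]_x g x - \int[nu']_x g x.
Proof.
move=> S; have [bf bg _ g1] := S.
rewrite (cost_eot_schrodinger bc lambda0 S)/=.
have := cost_eot_ge mu nu' bc lambda0 bf bg.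
rewrite (bRintegral_swap mu nu' (F := gibbs c eps f g)); last exact: bmeas_gibbs.
have -> : \int[nu']_y \int[mu]_x gibbs c eps f g x y = 1.
  by rewrite -[RHS](bRintegral_cst nu'); apply: eq_Rintegral => y _; exact: g1.
rewrite -[X in (_ <= X)%E -> _]cost_eot_fine lee_fin subrr mulr0 subr0.
move: (fine _) (\int[mu]_x f x) (\int[nu']_x g x) (\int[nu]_y g y).
by move=> t a b e; lra.
Qed.

End marginal_stability.

Section one_dimensional.
Context {R : realType}.
Local Notation R1 := (1.-tuple R).
Local Notation c := (@trunc_cost R 1 1).
Implicit Types (x y : R1).
Let co x : R := tnth x ord0.

(** As a function of the distance, the squared distance truncated at 1 has slope at most 2. *)
Lemma trunc_cost1_lip x x' y : c x y - c x' y <= 2 * `|co x - co x'|.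
Proof.
rewrite /trunc_cost !sqr_euclid_dist !big_ord1 -/(co y) -/(co x) -/(co x').
move: (co x) (co x') (co y) => a a' b; rewrite !minEle.
have t : `|b - a| <= `|b - a'| + `|a - a'|.
  by rewrite [`|a - a'|]distrC -[leLHS](_ : `|(b - a') + (a' - a)| = _) ?ler_normD//; congr (`|_|); ring.
rewrite -[(b - a) ^+ 2]real_normK ?num_real// -[(b - a') ^+ 2]real_normK ?num_real//.
move: t (normr_ge0 (b - a)) (normr_ge0 (b - a')) (normr_ge0 (a - a')).
move: (`|b - a|) (`|b - a'|) (`|a - a'|) => u v w uvw u0 v0 w0.
rewrite !expr_le1//; have [u1|u1] := leP u 1; have [v1|v1] := leP v 1; last by lra.
- have := mulr_ge0 (addr_ge0 u0 v0) (_ : 0 <= v + w - u); rewrite subr_ge0 => /(_ uvw).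
  have : 0 <= (2 - u - v) * w by rewrite mulr_ge0//; lra.
  by rewrite !expr2; lra.
- have : u ^+ 2 <= 1 by rewrite expr_le1.
  by lra.
- have : 0 <= (1 - v) * (1 - v) by rewrite mulr_ge0// subr_ge0.
  by rewrite expr2; lra.
Qed.

Lemma trunc_cost1_lip2 x y y' : c x y - c x y' <= 2 * `|co y - co y'|.
Proof.
have sym a b : c a b = c b a.
  by rewrite /trunc_cost !sqr_euclid_dist !big_ord1 -sqrrN opprB.
by rewrite sym [c x y']sym; exact: trunc_cost1_lip.
Qed.

Section grid.
Variables (n : nat) (n_gt0 : (0 < n)%N) (mu : probability R1 R) (B : set R1) (alpha : R).
Hypothesis mB : measurable B.
Hypothesis muB : mu B = 1%E.
Hypothesis Bal : forall t, B t -> alpha <= co t <= alpha + 2.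
Let h : R := 2 / n%:R.
Let s (k : nat) : R := alpha + k%:R * h.
Let ray (k : nat) : set R1 := [set t | s k <= co t].
Let n0 : 0 < n%:R :> R. Proof. by rewrite ltr0n. Qed.
Let h0 : 0 < h. Proof. exact: divr_gt0. Qed.

Lemma measurable_ray k : measurable (ray k).
Proof.
rewrite (_ : ray k = co @^-1` `[s k, +oo[%classic).
  by rewrite -[X in measurable X]setTI; exact: (measurable_tnth ord0).
by apply/seteqP; split => t /=; rewrite in_itv/= andbT.
Qed.

(* The staircase interpolation of [phi] at the grid points, a combination of
   indicators of rays. *)
Let step (phi : R -> R) (m : nat) (r : R) : R :=
  phi (s 0) + \sum_(k < m) (phi (s k.+1) - phi (s k)) * (s k.+1 <= r)%R%:R.

(** Beyond [s m] the sum telescopes to [phi (s m)]; this clause carries the induction, since a point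
    of the next cell is compared with exactly that value, at distance at most [h]. *)
Let step_approx phi m r : (forall a b, `|phi a - phi b| <= 2 * `|a - b|) ->
  alpha <= r -> (s m <= r -> step phi m r = phi (s m)) /\
  (r < s m -> `|phi r - step phi m r| <= 2 * h).
Proof.
move=> lip ar; have sS k : s k.+1 = s k + h by rewrite /s -natr1 mulrDl mul1r addrA.
elim: m => [|m [IH1 IH2]].
  split; first by rewrite /step big_ord0 addr0.
  by rewrite /s mul0r addr0 ltNge ar.
have stepS : step phi m.+1 r = step phi m r + (phi (s m.+1) - phi (s m)) * (s m.+1 <= r)%R%:R.
  by rewrite /step big_ord_recr/= addrA.
rewrite stepS; split => hr.
  have hr' : s m <= r by move: hr; rewrite sS; move: h0; lra.
  by rewrite hr mulr1 IH1// addrC subrK.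
rewrite [s m.+1 <= r]leNgt hr mulr0 addr0; have [rm|rm] := ltP r (s m); first exact: IH2.
rewrite IH1// (le_trans (lip _ _))// ler_pM2l// ger0_norm ?subr_ge0//.
by move: hr; rewrite sS; lra.
Qed.

(** A bound common to all 2-Lipschitz functions bounded by 2. The weight [4 / n] is the largest jump
    of the staircase, [8 / n] is its error in the mean plus its error in the integral, and 8 is the
    crude bound [2 + 6] for points outside [B]. *)
Definition grid_dev (x : 'I_n -> R1) : R :=
  4 / n%:R * \sum_(k < n) `|mean (fun i => \1_(ray k.+1) (x i) - \int[mu]_t \1_(ray k.+1) t)| +
  8 / n%:R + 8 * mean (fun i => \1_(~` B) (x i)).

(** The function, which may depend on the sample, enters the staircase only through jumps of size at
    most [4 / n]. What is left are deviations of the empirical distribution function at fixed grid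
    points. *)
Lemma lipschitz_dev (f : R1 -> R) (x : 'I_n -> R1) : bmeas f ->
  (forall t, `|f t| <= 2) -> (forall t t', f t - f t' <= 2 * `|co t - co t'|) ->
  `|mean (f \o x) - \int[mu]_t f t| <= grid_dev x.
Proof.
move=> bf f2 flip; pose phi r := f [tuple r].
have fphi t : f t = phi (co t).
  by congr f; apply: eq_from_tnth => i; rewrite ord1 [RHS](tnth_nth 0).
have lip a b : `|phi a - phi b| <= 2 * `|a - b|.
  have := flip [tuple a] [tuple b]; have := flip [tuple b] [tuple a].
  by rewrite /co !(tnth_nth 0)/= -/(phi a) -/(phi b) [`|b - a|]distrC ler_norml; lra.
pose D (k : 'I_n) := phi (s k.+1) - phi (s k).
have sS k : s k.+1 - s k = h by rewrite /s -natr1; ring.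
have h2 : 2 * h = 4 / n%:R by rewrite /h mulrA -natrM.
have DE k : `|D k| <= 4 / n%:R.
  by rewrite (le_trans (lip _ _))// sS ger0_norm ?(ltW h0)// h2.
pose A t := phi (s 0) + \sum_(k < n) D k * \1_(ray k.+1) t.
have AE t : A t = step phi n (co t).
  congr (_ + _); apply: eq_bigr => k _; congr (_ * _).
  rewrite indicE; have -> // : (t \in ray k.+1) = (s k.+1 <= co t).
  by apply/idP/idP; rewrite inE.
have b1 k : bmeas (\1_(ray k) : R1 -> R) by apply: bmeas_indic; exact: measurable_ray.
have bDk k : bmeas (fun t => D k * \1_(ray k.+1) t).
  by apply: bmeasM => //; exact: bmeas_cst.
have bA : bmeas A by apply: bmeasD; [exact: bmeas_cst | exact: bmeas_sum].
have mBC := measurableC mB.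
have bBC := bmeas_indic (R := R) mBC.
have A6 t : `|A t| <= 6.
  have hh : `|\sum_(k < n) D k * \1_(ray k.+1) t| <= 4.
    rewrite (le_trans (ler_norm_sum _ _ _))//.
    apply: (@le_trans _ _ (\sum_(k < n) 4 / n%:R)).
      apply: ler_sum => k _; rewrite normrM (le_trans _ (DE k))// ler_piMr//.
      by rewrite indicE ger0_norm ?ler0n// lern1 leq_b1.
    by rewrite sumr_const card_ord -[_ *+ n]mulr_natl mulrCA mulfV ?gt_eqF// mulr1.
  rewrite (le_trans (ler_normD _ _))//; have := f2 [tuple s 0]; rewrite -/(phi _).
  by move: hh; lra.
have fA t : `|f t - A t| <= 4 / n%:R + 8 * \1_(~` B) t.
  rewrite indicE; have [|nB] := boolP (t \in ~` B).
    move=> _; rewrite (le_trans (ler_normB _ _))// mulr1 (le_trans (lerD (f2 t) (A6 t)))//.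
    by rewrite -natrD lerDr divr_ge0.
  have Bt : B t by apply: contrapT => nb; move: nB; rewrite notin_setE => /(_ nb).
  have /andP[al au] := Bal Bt.
  have [S1 S2] := step_approx n lip al.
  rewrite mulr0 addr0 AE fphi -h2; have [r1|r1] := ltP (co t) (s n); first exact: S2.
  (* The right end of the interval is the last grid point, which the strict inequality of the second
     clause excludes. *)
  have cs : co t = s n.
    apply/eqP; rewrite eq_le r1 andbT.
    by rewrite /s /h mulrCA mulfV ?gt_eqF// mulr1.
  by rewrite S1// cs subrr normr0 mulr_ge0// ltW.
have IA : \int[mu]_t A t = phi (s 0) + \sum_(k < n) D k * \int[mu]_t \1_(ray k.+1) t.
  rewrite bRintegralD; [|exact: bmeas_cst|exact: bmeas_sum].
  rewrite bRintegral_cst bRintegral_sum//; congr (_ + _).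
  by apply: eq_bigr => k _; rewrite bRintegralZ.
have IfA : `|\int[mu]_t f t - \int[mu]_t A t| <= 4 / n%:R.
  rewrite -bRintegralB//; have bfA := bmeasB bf bA.
  rewrite (le_trans (ler_norm_bRintegral _ bfA))//.
  apply: (@le_trans _ _ (\int[mu]_t (4 / n%:R + 8 * \1_(~` B) t))).
    apply: ler_bRintegral => //; first exact: bmeas_norm.
    by apply: bmeasD; [exact: bmeas_cst | apply: bmeasM => //; exact: bmeas_cst].
  rewrite bRintegralD; [|exact: bmeas_cst|by apply: bmeasM => //; exact: bmeas_cst].
  rewrite bRintegral_cst bRintegralZ//.
  have -> : \int[mu]_t \1_(~` B) t = 0.
    apply: EFin_inj; rewrite bRintegral_indic//.
    by rewrite [LHS](probability_setC mu mB) muB subee.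
  by rewrite mulr0 addr0.
have mA : mean (A \o x) - \int[mu]_t A t =
    \sum_(k < n) D k * mean (fun i => \1_(ray k.+1) (x i) - \int[mu]_t \1_(ray k.+1) t).
  rewrite IA (_ : mean _ = phi (s 0) + \sum_(k < n) D k * mean (fun i => \1_(ray k.+1) (x i))).
    rewrite opprD addrACA subrr add0r -sumrB; apply: eq_bigr => k _.
    by rewrite -mulrBr meanB mean_cst.
  rewrite /comp /A meanD mean_cst//; congr (_ + _).
  rewrite /mean exchange_big mulr_sumr; apply: eq_bigr => k _.
  by rewrite -mulr_sumr mulrCA.
have mfA : `|mean (f \o x) - mean (A \o x)| <= 4 / n%:R + 8 * mean (fun i => \1_(~` B) (x i)).
  rewrite -meanB (le_trans (ler_norm_mean _))//.
  apply: (le_trans (ler_mean n_gt0 (fun i => fA (x i)))).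
  by rewrite meanD mean_cst// meanZ.
have mA' : `|mean (A \o x) - \int[mu]_t A t| <= 4 / n%:R * \sum_(k < n)
   `|mean (fun i => \1_(ray k.+1) (x i) - \int[mu]_t \1_(ray k.+1) t)|.
  rewrite mA (le_trans (ler_norm_sum _ _ _))// mulr_sumr ler_sum// => k _.
  by rewrite normrM ler_wpM2r.
have -> : mean (f \o x) - \int[mu]_t f t = (mean (f \o x) - mean (A \o x)) +
   (mean (A \o x) - \int[mu]_t A t) - (\int[mu]_t f t - \int[mu]_t A t) by ring.
rewrite (le_trans (ler_normB _ _))// (le_trans (lerD (ler_normD _ _) IfA))//.
rewrite (le_trans (lerD (lerD mfA mA') (lexx _)))// /grid_dev.
have -> : 8 / n%:R = 4 / n%:R + 4 / n%:R :> R by rewrite -mulrDl -natrD.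
by rewrite le_eqVlt; apply/orP; left; apply/eqP; ring.
Qed.

End grid.

Section expectation.
Context {dO} {Omega : measurableType dO} {n : nat}.
Variables (P : probability Omega R) (J : finType) (Z : J -> {RV P >-> R1}).
Variable law : J -> probability R1 R.
Hypothesis Zlaw : forall j, has_law (Z j) (law j).
Hypothesis Zind : mutually_independent Z.
Variables (n_gt0 : (0 < n)%N) (B : set R1).
Hypothesis mB : measurable B.
Let n0 : 0 < n%:R :> R. Proof. by rewrite ltr0n. Qed.

Let bmean (F : 'I_n -> Omega -> R) :
  (forall i, bmeas (F i)) -> bmeas (fun w => mean (F^~ w)).
Proof. by move=> bF; apply: bmeasM; [exact: bmeas_cst | exact: bmeas_sum]. Qed.

Let bdev (a : 'I_n -> J) (mu : probability R1 R) alpha k :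
  bmeas (fun w => `|mean (fun i => \1_([set t | alpha + k.+1%:R * (2 / n%:R) <= co t]) (Z (a i) w) -
     \int[mu]_t \1_([set t | alpha + k.+1%:R * (2 / n%:R) <= co t]) t)|).
Proof.
have b1 := bmeas_indic (R := R) (measurable_ray n alpha k.+1).
apply/bmeas_norm/bmean => i; apply: bmeasB; last exact: bmeas_cst.
exact: (bmeas_comp _ b1).
Qed.

Let bout (a : 'I_n -> J) : bmeas (fun w => mean (fun i => \1_(~` B) (Z (a i) w) : R)).
Proof.
apply: bmean => i; apply: (bmeas_comp _ (bmeas_indic (measurableC mB))).
by [].
Qed.

Lemma bmeas_grid_dev (a : 'I_n -> J) (mu : probability R1 R) alpha :
  bmeas (fun w => grid_dev mu B alpha (fun i => Z (a i) w)).
Proof.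
apply: bmeasD.
  apply: bmeasD; last exact: bmeas_cst.
  apply: bmeasM; first exact: bmeas_cst.
  by apply: bmeas_sum => k _; exact: bdev.
by apply: bmeasM; [exact: bmeas_cst | exact: bout].
Qed.

Lemma grid_dev_mean (a : 'I_n -> J) (mu : probability R1 R) alpha :
  injective a -> (forall i, law (a i) = mu) -> mu B = 1%E ->
  \int[P]_w grid_dev mu B alpha (fun i => Z (a i) w) <=
  4 * Num.sqrt ((2 * 1) ^+ 2 / n%:R) + 8 / n%:R.
Proof.
move=> ainj lawa muB; have bd := bdev a mu alpha; have bo := bout a.
have b1 : bmeas (fun w => 4 / n%:R * \sum_(k < n)
    `|mean (fun i => \1_([set t | alpha + k.+1%:R * (2 / n%:R) <= co t]) (Z (a i) w) -
     \int[mu]_t \1_([set t | alpha + k.+1%:R * (2 / n%:R) <= co t]) t)|).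
  by apply: bmeasM; [exact: bmeas_cst | apply: bmeas_sum => k _; exact: bd].
have b2 := bmeasM (bmeas_cst (T := Omega) (8 : R)) bo.
rewrite /grid_dev (bRintegralD _ (bmeasD b1 (bmeas_cst _)) b2).
rewrite (bRintegralD _ b1 (bmeas_cst _)) bRintegral_cst.
have bs : bmeas (fun w => \sum_(k < n)
    `|mean (fun i => \1_([set t | alpha + k.+1%:R * (2 / n%:R) <= co t]) (Z (a i) w) -
     \int[mu]_t \1_([set t | alpha + k.+1%:R * (2 / n%:R) <= co t]) t)|).
  by apply: bmeas_sum => k _; exact: bd.
rewrite (bRintegralZ _ _ bo) (bRintegralZ _ _ bs) bRintegral_sum//.
have mBC := measurableC mB; have bBC := bmeas_indic (R := R) mBC.
have -> : \int[P]_w mean (fun i => \1_(~` B) (Z (a i) w)) = 0.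
  rewrite bRintegralZ; last by apply: bmeas_sum => i _; exact: (bmeas_comp _ bBC).
  rewrite bRintegral_sum; last by move=> i _; exact: (bmeas_comp _ bBC).
  rewrite big1 ?mulr0// => i _; rewrite (sample_law Zlaw (a i) bBC) lawa.
  apply: EFin_inj; rewrite bRintegral_indic//.
  by rewrite [LHS](probability_setC mu mB) muB subee.
rewrite mulr0 addr0 lerD2r.
apply: (@le_trans _ _ (4 / n%:R * \sum_(k < n) Num.sqrt ((2 * 1) ^+ 2 / n%:R))).
  rewrite ler_wpM2l ?divr_ge0 ?ler0n//; apply: ler_sum => k _.
  apply: (sample_mean_dev Zlaw Zind n_gt0 ainj lawa).
    exact: bmeas_indic (measurable_ray n alpha k.+1).
  by move=> t; rewrite indicE ger0_norm ?ler0n// lern1 leq_b1.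
by rewrite sumr_const card_ord -[Num.sqrt _ *+ n]mulr_natl mulrA divfK// pnatr_eq0 -lt0n.
Qed.

Variables (a b : 'I_n -> J) (mu nu : probability R1 R) (lambda : R).
Hypotheses (ainj : injective a) (binj : injective b).
Hypotheses (lawa : forall i, law (a i) = mu) (lawb : forall j, law (b j) = nu).
Hypothesis lambda01 : 0 < lambda <= 1.
Hypothesis B1 : forall x y, B x -> B y -> euclid_dist x y ^+ 2 <= 1.
Hypothesis muB : mu B = 1%E.
Hypothesis nuB : nu B = 1%E.

(** Arithmetic of passing from the empirical pair to [(mu, my)] and then to [(mu, nu)]. Each
    difference is bounded from both sides, by the potentials of its two ends. *)
Let two_step_dev (t1 t2 t3 u1 u2 r1 r2 r3 r4 r5 r6 r7 r8 : R) :
  t1 - t2 <= r1 - r2 -> t2 - t1 <= r4 - r3 ->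
  t2 - t3 <= r5 - r6 -> t3 - t2 <= r8 - r7 ->
  `|r1 - r2| <= u1 -> `|r3 - r4| <= u1 -> `|r5 - r6| <= u2 -> `|r7 - r8| <= u2 ->
  `|t1 - t3| <= u1 + u2.
Proof. by rewrite !ler_norml; lra. Qed.

(* The potentials depend on the sample, so a bound uniform over Lipschitz
   functions is needed. *)
Lemma emp_cost_mean_dev1 :
  \int[P]_w `|emp_cost n_gt0 c lambda (fun i => Z (a i) w) (fun j => Z (b j) w) -
             fine (cost_eot c lambda mu nu)| <=
  2 * (4 * Num.sqrt ((2 * 1) ^+ 2 / n%:R) + 8 / n%:R).
Proof.
have /andP[lambda0 _] := lambda01.
have bc : bmeas (fun z : R1 * R1 => c z.1 z.2) by exact: bmeas_trunc_cost.
have c1 x y : 0 <= c x y <= 1 by rewrite trunc_cost_ge0// trunc_cost_le.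
have eps0 : 0 < 2 * lambda by exact: mulr_gt0.
have [b0 Bb0] : exists b0, B b0.
  apply/not_existsP => nB; have BE : B = set0 by apply/seteqP; split => x // Bx; have := nB x.
  by move: muB; rewrite BE measure0 => /eqP; rewrite eq_sym onee_eq0.
(* All of [B] is within 1 of [b0], hence in an interval of length 2 starting at [alpha]. *)
pose alpha := co b0 - 1.
have Bal t : B t -> alpha <= co t <= alpha + 2.
  move=> Bt; have := B1 Bb0 Bt; rewrite sqr_euclid_dist big_ord1 -/(co t) -/(co b0).
  rewrite -[X in X <= _]real_normK ?num_real// expr_le1// ler_norml /alpha.
  by move: (co t) (co b0) => r r0; lra.
pose G1 w := grid_dev mu B alpha (fun i => Z (a i) w).
pose G2 w := grid_dev nu B alpha (fun i => Z (b i) w).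
have bG1 : bmeas G1 by exact: bmeas_grid_dev.
have bG2 : bmeas G2 by exact: bmeas_grid_dev.
have dev w : `|emp_cost n_gt0 c lambda (fun i => Z (a i) w) (fun j => Z (b j) w) -
             fine (cost_eot c lambda mu nu)| <= G1 w + G2 w.
  pose x i := Z (a i) w; pose y i := Z (b i) w.
  pose mx := @empirical_prob _ _ R _ n_gt0 x; pose my := @empirical_prob _ _ R _ n_gt0 y.
  rewrite -[emp_cost _ _ _ _ _]/(fine (cost_eot c lambda mx my)).
  have lf m1 m2 f g : schrodinger m1 m2 c (2 * lambda) f g ->
      forall t t', f t - f t' <= 2 * `|co t - co t'|.
    by move=> S t t'; apply: (schrodinger_modulus bc eps0 S) => z; exact: trunc_cost1_lip.
  have bcT : bmeas (fun z : R1 * R1 => c z.2 z.1).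
    apply: (bmeas_comp (g := fun z : R1 * R1 => (z.2, z.1)) _ bc).
    exact: measurable_fun_pair.
  have lg m1 m2 f g : schrodinger m1 m2 c (2 * lambda) f g ->
      forall t t', g t - g t' <= 2 * `|co t - co t'|.
    move=> S t t'; apply: (schrodinger_modulus bcT eps0 (schrodinger_sym S)) => z.
    exact: trunc_cost1_lip2.
  have [f [g [S fM gM]]] := schrodinger_ex mu nu bc eps0 c1.
  have [f' [g' [S' fM' gM']]] := schrodinger_ex mu my bc eps0 c1.
  have [f'' [g'' [S'' fM'' gM'']]] := schrodinger_ex mx my bc eps0 c1.
  have f2 (F : R1 -> R) : (forall t, `|F t| <= 1) -> forall t, `|F t| <= 2.
    by move=> F1 t; rewrite (le_trans (F1 t))// ler1n.
  have g2 (F : R1 -> R) : (forall t, `|F t| <= 2 * 1) -> forall t, `|F t| <= 2.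
    by move=> F1 t; rewrite (le_trans (F1 t))// mulr1.
  have D1 := cost_eot_fst_le bc c1 lambda0 mu S''.
  have D2 := cost_eot_fst_le bc c1 lambda0 mx S'.
  have D3 := cost_eot_snd_le bc c1 lambda0 nu S'.
  have D4 := cost_eot_snd_le bc c1 lambda0 my S.
  have [bf bg _ _] := S; have [bf' bg' _ _] := S'; have [bf'' bg'' _ _] := S''.
  have L1 := lipschitz_dev n_gt0 mB muB Bal x bf'' (f2 _ fM'') (lf _ _ _ _ S'').
  have L2 := lipschitz_dev n_gt0 mB muB Bal x bf' (f2 _ fM') (lf _ _ _ _ S').
  have L3 := lipschitz_dev n_gt0 mB nuB Bal y bg' (g2 _ gM') (lg _ _ _ _ S').
  have L4 := lipschitz_dev n_gt0 mB nuB Bal y bg (g2 _ gM) (lg _ _ _ _ S).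
  rewrite -[mean (f'' \o x)](integral_empirical n_gt0 x bf'') -/mx in L1.
  rewrite -[mean (f' \o x)](integral_empirical n_gt0 x bf') -/mx in L2.
  rewrite -[mean (g' \o y)](integral_empirical n_gt0 y bg') -/my in L3.
  rewrite -[mean (g \o y)](integral_empirical n_gt0 y bg) -/my in L4.
  rewrite -/(G1 w) in L1 L2; rewrite -/(G2 w) in L3 L4.
  exact: two_step_dev D1 D2 D3 D4 L1 L2 L3 L4.
have E1 := grid_dev_mean alpha ainj lawa muB.
have E2 := grid_dev_mean alpha binj lawb nuB.
apply: (@le_trans _ _ (\int[P]_w (G1 w + G2 w))).
  apply: ler_bRintegral => //; last exact: bmeasD.
  apply/bmeas_norm/bmeasB; last exact: bmeas_cst.
  exact: bmeas_emp_cost.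
by rewrite (bRintegralD _ bG1 bG2) (le_trans (lerD E1 E2))// -mulr2n -[_ *+ 2]mulr_natl.
Qed.

End expectation.

End one_dimensional.

(** * The empirical Sinkhorn divergence *)

(* The two null sets are intersected: each is null for one measure only. *)
Lemma supported_diameter1 {R : realType} {d : nat} (mu nu : probability (d.-tuple R) R)
    (A : set (d.-tuple R)) :
  diameter A = 1%E -> supported_on mu A -> supported_on nu A ->
  exists B, [/\ measurable B, mu B = 1%E, nu B = 1%E &
    forall x y, B x -> B y -> euclid_dist x y ^+ 2 <= 1].
Proof.
move=> dA [M [mM muM AM]] [N [mN nuN AN]]; pose B := ~` (M `&` N).
have mMN : measurable (M `&` N) by exact: measurableI.
have mB : measurable B by exact: measurableC.
have BA x : B x -> A x.
  by move=> Bx; apply: contrapT => nAx; apply: Bx; split; [exact: AM | exact: AN].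
have full (m : probability (d.-tuple R) R) L : measurable L -> m L = 0%E ->
    M `&` N `<=` L -> m B = 1%E.
  move=> mL mL0 sL; rewrite [LHS](probability_setC m mMN).
  by rewrite (subset_measure0 mMN mL sL mL0) sube0.
have muB : mu B = 1%E by exact: full mM muM (@subIsetl _ _ _).
have nuB : nu B = 1%E by exact: full mN nuN (@subIsetr _ _ _).
exists B; split => //.
move=> x y /BA Ax /BA Ay; rewrite expr_le1 ?sqrtr_ge0// -lee_fin -dA.
by apply: ereal_sup_ubound; exists (x, y).
Qed.

Section empirical_sinkhorn.
Context {R : realType} {d n : nat}.
Local Notation Rd := (d.-tuple R).
Variable n_gt0 : (0 < n)%N.
Implicit Types (x y : 'I_n -> Rd) (lambda M : R).

Lemma empirical_full x (B : set Rd) : measurable B -> (forall i, B (x i)) ->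
  empirical_prob n_gt0 x B = 1%E :> \bar R.
Proof.
move=> mB xB; rewrite empirical_preimage// (eq_bigr (fun=> 1)); last first.
  by move=> i _; rewrite indicE mem_set.
by rewrite sumr_const card_ord mulVf// pnatr_eq0 -lt0n.
Qed.

Lemma sinkhorn_div_empirical lambda M x y : 0 <= lambda -> 0 <= M ->
  (forall a b, (range x `|` range y) a -> (range x `|` range y) b ->
    euclid_dist a b ^+ 2 <= M) ->
  sinkhorn_div lambda (empirical_prob n_gt0 x) (empirical_prob n_gt0 y) =
  (emp_sinkhorn n_gt0 (trunc_cost M) lambda x y)%:E.
Proof.
move=> l0 M0; set B := _ `|` _ => BM.
have mB : measurable B by apply: measurableU; exact: measurable_range.
have xB : empirical_prob n_gt0 x B = 1%E :> \bar R.
  by apply: empirical_full => // i; left; exists i.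
have yB : empirical_prob n_gt0 y B = 1%E :> \bar R.
  by apply: empirical_full => // i; right; exists i.
have bc := bmeas_trunc_cost (d := d) M0.
have cM (a b : Rd) : 0 <= trunc_cost M a b <= M by rewrite trunc_cost_ge0// trunc_cost_le.
rewrite /sinkhorn_div (eot_trunc lambda M0 mB xB yB BM).
rewrite (eot_trunc lambda M0 mB xB xB BM) (eot_trunc lambda M0 mB yB yB BM).
by rewrite !(cost_eot_emp n_gt0 bc cM).
Qed.

(** Off the event that the sample lies in [B], no fixed truncation level is valid. But finitely many
    points have finite diameter, so every large level leaves the divergence unchanged. *)
Lemma sinkhorn_div_empirical_ev lambda x y : 0 <= lambda ->
  \forall k \near \oo,
    sinkhorn_div lambda (empirical_prob n_gt0 x) (empirical_prob n_gt0 y) =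
    (emp_sinkhorn n_gt0 (trunc_cost k%:R) lambda x y)%:E.
Proof.
move=> l0; pose D (z z' : 'I_n -> Rd) := \sum_(i < n) \sum_(j < n) euclid_dist (z i) (z' j) ^+ 2.
have D0 z z' : 0 <= D z z' by do 2 apply: sumr_ge0 => ? _; exact: sqr_ge0.
have DD z z' i j : euclid_dist (z i) (z' j) ^+ 2 <= D z z'.
  rewrite /D (bigD1 i)//= (bigD1 j)//= -addrA lerDl addr_ge0//.
    by apply: sumr_ge0 => ? _; exact: sqr_ge0.
  by do 2 apply: sumr_ge0 => ? _; exact: sqr_ge0.
exists (Num.trunc (D x x + D x y + D y x + D y y)).+1 => // k /= hk.
have Dk : D x x + D x y + D y x + D y y <= k%:R.
  rewrite (le_trans (ltW (truncnS_gt _)))// ler_nat//.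
have := D0 x x; have := D0 x y; have := D0 y x; have := D0 y y => *.
apply: sinkhorn_div_empirical => // a b [[i _ <-]|[i _ <-]] [[j _ <-]|[j _ <-]];
  (apply: le_trans Dk; apply: le_trans (DD _ _ _ _) _; lra).
Qed.

Lemma sinkhorn_div_empirical_fin lambda x y : 0 <= lambda ->
  sinkhorn_div lambda (empirical_prob n_gt0 x) (empirical_prob n_gt0 y) =
  (fine (sinkhorn_div lambda (empirical_prob n_gt0 x) (empirical_prob n_gt0 y)))%:E
    :> \bar R.
Proof.
move=> /(sinkhorn_div_empirical_ev x y)[k _ /(_ k (leqnn k)) ->].
by [].
Qed.

(** A pointwise limit of truncated divergences, eventually constant at each outcome. It makes the
    expectation and the event meaningful for the untruncated divergence at every outcome. *)
Lemma measurable_sinkhorn_div_empirical lambda {dZ} {Z : measurableType dZ}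
    (X Y : 'I_n -> Z -> Rd) :
  (forall i, measurable_fun setT (X i)) -> (forall i, measurable_fun setT (Y i)) ->
  0 <= lambda -> measurable_fun setT (fun z => fine (sinkhorn_div lambda
    (empirical_prob n_gt0 (X^~ z)) (empirical_prob n_gt0 (Y^~ z)) : \bar R)).
Proof.
move=> mX mY l0.
apply: (@measurable_fun_cvg _ _ _ _
  (fun k z => emp_sinkhorn n_gt0 (trunc_cost k%:R) lambda (X^~ z) (Y^~ z))).
  move=> k; have bc := bmeas_trunc_cost (d := d) (ler0n R k).
  have cM (a b : Rd) : 0 <= trunc_cost k%:R a b <= k%:R.
    by rewrite trunc_cost_ge0// trunc_cost_le.
  exact: (measurable_emp_sinkhorn n_gt0 bc cM mX mY l0).
move=> z _; apply: cvg_near_cst.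
by apply: filterS (sinkhorn_div_empirical_ev (X^~ z) (Y^~ z) l0) => k ->.
Qed.

End empirical_sinkhorn.

Lemma sample_full {dO} {Omega : measurableType dO} {R : realType} {dT}
    {T : measurableType dT} (P : probability Omega R) (J : finType)
    (Z : J -> {RV P >-> T}) (law : J -> probability T R) (B : set T) :
  (forall j, has_law (Z j) (law j)) -> mutually_independent Z ->
  measurable B -> (forall j, law j B = 1%E) ->
  measurable [set w | forall j, B (Z j w)] /\ P [set w | forall j, B (Z j w)] = 1%E.
Proof.
move=> Zlaw Zind mB lawB; split.
  rewrite (_ : [set w | _] = \bigcap_(j in [set: J]) (Z j @^-1` B)).
    apply: fin_bigcap_measurable; first exact: finite_finset.
    by move=> j _; rewrite -[X in measurable X]setTI; exact: measurable_funPT.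
  by apply/seteqP; split => [w h j _|w h j]; exact: h.
have := Zind [set: J]%SET (fun=> B) (fun=> mB).
rewrite big1 => [<-|j _]; last by rewrite -(lawB j) -(Zlaw j B mB).
by congr (P _); apply/seteqP; split => w h j => [_|]; exact: h.
Qed.

Section sinkhorn_samples.
Context {dO} {Omega : measurableType dO} {R : realType} {d n : nat}.
Local Notation Rd := (d.-tuple R).
Variables (P : probability Omega R) (n_gt0 : (0 < n)%N) (mu nu : probability Rd R).
Variables (X Y : 'I_n -> {RV P >-> Rd}).
Hypothesis samples : independent_samples mu nu X Y.
Variable B : set Rd.
Hypothesis mB : measurable B.
Hypothesis B1 : forall x y, B x -> B y -> euclid_dist x y ^+ 2 <= 1.
Hypothesis muB : mu B = 1%E.
Hypothesis nuB : nu B = 1%E.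
Local Notation c := (@trunc_cost R d 1).
Local Notation S := (empirical_sinkhorn_div n_gt0 X Y).

Let bc : bmeas (fun z : Rd * Rd => c z.1 z.2).
Proof. exact: bmeas_trunc_cost. Qed.

Let c1 x y : 0 <= c x y <= 1.
Proof. by rewrite trunc_cost_ge0// trunc_cost_le. Qed.

Definition sample_of (k : 'I_n + 'I_n) : {RV P >-> Rd} :=
  match k with inl i => X i | inr j => Y j end.

Definition sample_law_of (k : 'I_n + 'I_n) : probability Rd R :=
  match k with inl _ => mu | inr _ => nu end.

Lemma sample_of_law k : has_law (sample_of k) (sample_law_of k).
Proof. by case: samples => lX lY _; case: k. Qed.

Lemma sample_of_independent : mutually_independent sample_of.
Proof. by case: samples. Qed.

Let A : set Omega := [set w | forall k, B (sample_of k w)].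

Let full : measurable A /\ P A = 1%E.
Proof.
apply: sample_full sample_of_law sample_of_independent mB _.
by case.
Qed.

Definition trunc_sinkhorn lambda (w : Omega) : R :=
  emp_sinkhorn n_gt0 c lambda (X^~ w) (Y^~ w).

Lemma sinkhorn_div_sample lambda w : 0 <= lambda -> A w ->
  S lambda w = (trunc_sinkhorn lambda w)%:E.
Proof.
move=> l0 Aw; apply: (sinkhorn_div_empirical n_gt0 l0 (@ler01 R)) => a b.
have XB i : B (X i w) := Aw (inl i); have YB i : B (Y i w) := Aw (inr i).
by move=> [[i _ <-]|[i _ <-]] [[j _ <-]|[j _ <-]]; exact: B1.
Qed.

Lemma emp_sinkhorn_bounded lambda : 0 <= lambda ->
  exists M, forall x y, `|emp_sinkhorn n_gt0 c lambda x y| <= M.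
Proof.
have pos l x y : 0 < l -> `|emp_sinkhorn n_gt0 c l x y| <= 6.
  move=> l0; have := norm_emp_cost_le n_gt0 bc c1 l0 x y.
  have := norm_emp_cost_le n_gt0 bc c1 l0 x x.
  have := norm_emp_cost_le n_gt0 bc c1 l0 y y.
  rewrite /emp_sinkhorn.
  move: (emp_cost _ _ _ _ _) (emp_cost _ _ _ _ _) (emp_cost _ _ _ _ _) => a1 a2 a3.
  by rewrite !ler_norml; lra.
rewrite le_eqVlt => /predU1P[<-|l0]; last by exists 6 => x y; exact: pos.
(* At [lambda = 0] the bound is borrowed from [lambda = 1]; its dependence on [n] is harmless, as
   only boundedness is used. *)
exists (6 + 2 * 1 * ln n%:R) => x y; have h1 := pos 1 x y ltr01.
have := emp_sinkhorn0_dist n_gt0 bc c1 x y ltr01.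
move: h1; move: (emp_sinkhorn _ _ _ _ _) (emp_sinkhorn _ _ _ _ _) => a1 a2.
by rewrite !ler_norml; lra.
Qed.

Lemma bmeas_trunc_sinkhorn lambda : 0 <= lambda -> bmeas (trunc_sinkhorn lambda).
Proof.
move=> l0; have [M hM] := emp_sinkhorn_bounded l0.
split; last by exists M => w; exact: hM.
apply: (measurable_emp_sinkhorn n_gt0 bc c1 (X := fun i w => X i w)
  (Y := fun i w => Y i w)) => // i; exact: measurable_funPT.
Qed.

(** [phi] and [psi] are one function on the extended and on the real line: the identity for the
    expectation, the distance to a constant for the error. *)
Lemma integral_sinkhorn_div (phi : \bar R -> \bar R) (psi : R -> R) lambda :
  (forall r, phi r%:E = (psi r)%:E) -> measurable_fun [set: R] psi -> 0 <= lambda ->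
  (\int[P]_w phi (S lambda w) = \int[P]_w (psi (trunc_sinkhorn lambda w))%:E)%E.
Proof.
move=> phiE mpsi l0; have [mA A1] := full.
have SE w : S lambda w = (fine (S lambda w))%:E.
  exact: (sinkhorn_div_empirical_fin n_gt0 _ _ l0).
under eq_integral do rewrite SE phiE.
apply: (ae_eq_bRintegral (A := A)) => //.
- apply: measurableT_comp => //.
  apply: (measurable_sinkhorn_div_empirical n_gt0 (X := fun i w => X i w)
    (Y := fun i w => Y i w)) => // i; exact: measurable_funPT.
- apply: measurableT_comp => //; exact: (bmeas_trunc_sinkhorn l0).1.
by move=> w Aw; rewrite sinkhorn_div_sample.
Qed.

Let split_law (i : 'I_(n + n)) :
  (if (i < n)%N then mu else nu) = sample_law_of (fintype.split i).
Proof. by case: fintype.splitP. Qed.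

Lemma sinkhorn_div_concentration t lambda : 0 <= t -> 0 <= lambda ->
  (P [set w | t%:E <= `|S lambda w - \int[P]_v S lambda v|] <=
    (2 * expR (- (n%:R * t ^+ 2 / 4)))%:E)%E.
Proof.
move=> t0 l0; have [mA A1] := full.
(* Both samples are concatenated into one tuple, as McDiarmid's inequality allows coordinates with
   different laws. *)
pose G (u : (n + n).-tuple Rd) := emp_sinkhorn n_gt0 c lambda
  (fun i => tnth u (lshift n i)) (fun j => tnth u (rshift n j)).
have bG : bmeas G.
  have [M hM] := emp_sinkhorn_bounded l0; split; last by exists M => u; exact: hM.
  apply: (measurable_emp_sinkhorn n_gt0 bc c1
    (X := fun i (u : (n + n).-tuple Rd) => tnth u (lshift n i))
    (Y := fun i (u : (n + n).-tuple Rd) => tnth u (rshift n i))) => // i;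
  exact: measurable_tnth.
have dG : bounded_diff (2 / n%:R) G.
  move=> i u u' uu'; rewrite -[i]fintype.splitK in uu'; case: (fintype.split i) uu' => j uu'.
    apply: (emp_sinkhorn_bounded_diff n_gt0 bc c1 (i0 := j)) => //; left; split.
      by move=> k kj; rewrite uu'//= (inj_eq (@lshift_inj _ _)).
    by apply/funext => k; rewrite uu'//= eq_sym eq_lrshift.
  apply: (emp_sinkhorn_bounded_diff n_gt0 bc c1 (i0 := j)) => //; right; split.
    by apply/funext => k; rewrite uu'//= eq_lrshift.
  by move=> k kj; rewrite uu'//= (inj_eq (@rshift_inj _ _)).
pose m k := if (k < n)%N then mu else nu.
have inj := can_inj (@fintype.splitK n n).
have GE w : G [tuple sample_of (fintype.split i) w | i < n + n] = trunc_sinkhorn lambda w.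
  rewrite /G /trunc_sinkhorn; congr emp_sinkhorn; apply/funext => i; rewrite tnth_mktuple.
    by rewrite -[lshift n i]/(fintype.unsplit (inl i)) fintype.unsplitK.
  by rewrite -[rshift n i]/(fintype.unsplit (inr i)) fintype.unsplitK.
have law F : bmeas F -> \int[P]_w F [tuple sample_of (fintype.split i) w | i < n + n] =
    \int[tuple_prob (n + n) m]_u F u.
  exact: (sample_tuple_law sample_of_law sample_of_independent inj split_law).
have IG : \int[P]_w trunc_sinkhorn lambda w = \int[tuple_prob (n + n) m]_u G u.
  by rewrite -(law G bG); apply: eq_Rintegral => w _; rewrite GE.
have IS : (\int[P]_w S lambda w = (\int[tuple_prob (n + n) m]_u G u)%:E)%E.
  have I1 := @integral_sinkhorn_div id id lambda (fun=> erefl) (@measurable_id _ _ _) l0.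
  rewrite [LHS]I1.
  rewrite -IG.
  apply: esym. apply: Rintegral_EFin.
  exact: bmeas_trunc_sinkhorn.
rewrite IS; set e := \int[_]_u G u; pose D := [set u | t <= `|G u - e|].
have bGe : bmeas (fun u => `|G u - e|).
  by apply: bmeas_norm; apply: bmeasB bG _; exact: bmeas_cst.
have mge : measurable `[t, +oo[%classic by exact: measurable_itv.
have mD : measurable D.
  rewrite (_ : D = (fun u => `|G u - e|) @^-1` `[t, +oo[%classic).
    by rewrite -[X in measurable X]setTI; exact: bGe.1.
  by apply/seteqP; split => u; rewrite /= in_itv/= andbT.
have mS : measurable_fun setT (fun w => `|fine (S lambda w) - e|).
  apply: measurableT_comp => //; apply: measurable_funB => //.
  apply: (measurable_sinkhorn_div_empirical n_gt0 (X := fun i w => X i w)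
    (Y := fun i w => Y i w)) => // i; exact: measurable_funPT.
have SE w : S lambda w = (fine (S lambda w))%:E.
  exact: (sinkhorn_div_empirical_fin n_gt0 _ _ l0).
set E := [set w | _].
have mE : measurable E.
  rewrite (_ : E = (fun w => `|fine (S lambda w) - e|) @^-1` `[t, +oo[%classic).
    by rewrite -[X in measurable X]setTI; exact: mS.
  by apply/seteqP; split => w; rewrite /E/= SE in_itv/= andbT lee_fin.
have -> : (P E = (\int[P]_w \1_D [tuple sample_of (fintype.split i) w | i < n + n])%:E)%E.
  have bD : bmeas (\1_D : _ -> R) by exact: bmeas_indic.
  have bDZ : bmeas (fun w => \1_D [tuple sample_of (fintype.split i) w | i < n + n] : R).
    apply: bmeas_comp bD; apply/measurable_fun_tnthP => i.
    apply: (eq_measurable_fun (sample_of (fintype.split i))) => [w _|]; last exact: measurable_funPT.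
    by rewrite /= tnth_mktuple.
  have bE := bmeas_indic (R := R) mE.
  rewrite -[LHS](bRintegral_indic P mE) (Rintegral_EFin P bE) (Rintegral_EFin P bDZ).
  apply: (ae_eq_bRintegral mA A1 bE.1 bDZ.1) => w Aw.
  rewrite !indicE; congr (_%:R); congr nat_of_bool.
  apply/idP/idP; rewrite !inE /E /D /= GE sinkhorn_div_sample//.
rewrite lee_fin (law (\1_D)); last exact: bmeas_indic.
have nr0 : 0 < n%:R :> R by rewrite ltr0n.
have c0 : 0 < 2 / n%:R :> R by exact: divr_gt0.
apply: le_trans (mcdiarmid m bG dG c0 _ t0) _; first by rewrite addn_gt0 n_gt0.
(* There are [2 * n] coordinates, each with bounded difference [2 / n]. *)
rewrite (_ : 2 * t ^+ 2 / _ = n%:R * t ^+ 2 / 4)// natrD.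
by move: (n%:R : R) nr0 => r r0; field; rewrite !gt_eqF ?addr_gt0.
Qed.

End sinkhorn_samples.

(** * Rates *)

Section rates.
Context {R : realType} (x D : R).
Hypothesis x1 : 1 <= x.
Hypothesis D4 : 4 <= D.
Let s := x `^ (- (2 / D)).
Let lambda := x `^ (- (1 / D)).

Let x0 : 0 < x. Proof. exact: lt_le_trans x1. Qed.
Let D0 : 0 < D. Proof. exact: lt_le_trans D4. Qed.

Lemma lambda_rate : 0 < lambda <= 1.
Proof.
rewrite powR_gt0//= -[leRHS](powRr0 x) ler_powR// oppr_le0.
by rewrite divr_ge0// ltW.
Qed.

Lemma lambda_rate_sqr : lambda ^+ 2 = s.
Proof.
rewrite -powR_mulrn ?powR_ge0// -powRrM; congr (_ `^ _).
by field; rewrite gt_eqF.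
Qed.

(** Comparison of exponents: [1 / 2 >= 2 / D] because [D >= 4]. *)
Lemma rate_sqrt : Num.sqrt x^-1 <= s.
Proof.
rewrite /s -powR12_sqrt ?invr_ge0 ?(ltW x0)// -[x^-1]powR_inv1 ?(ltW x0)// -powRrM ler_powR//.
by rewrite mulN1r lerN2 ler_pdivrMr//; move: D4; lra.
Qed.

Lemma rate_inv : x^-1 <= s.
Proof.
rewrite /s -[x^-1]powR_inv1 ?(ltW x0)// ler_powR// lerN2 ler_pdivrMr// mul1r.
by move: D4; lra.
Qed.

Lemma rate_le1 : s <= 1.
Proof. by rewrite /s -[leRHS](powRr0 x) ler_powR// oppr_le0 divr_ge0// ltW. Qed.

(** The left side has order [x ^ (d / (2 * D) - 1)], and this exponent is at most [- 4 / D] exactly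
    when [d + 8 <= 2 * D]. *)
Lemma covering_rate (d : nat) : d%:R + 8 <= 2 * D ->
  @covering_bound R d lambda / x <= expR (d%:R / 4) * 5 ^+ d * s ^+ 2.
Proof.
move=> dD; have -> : s ^+ 2 = x `^ (- (4 / D)).
  rewrite -powR_mulrn ?powR_ge0// -powRrM; congr (_ `^ _).
  by field; rewrite gt_eqF.
have sl : (Num.sqrt lambda)^-1 = x `^ (1 / (2 * D)).
  rewrite -powR12_sqrt ?powR_ge0// /lambda -powRrM -powRN; congr (_ `^ _).
  by field; rewrite gt_eqF.
rewrite /covering_bound /cell_constant exprMn sl -!mulrA ler_wpM2l ?expR_ge0//.
rewrite ler_wpM2l ?exprn_ge0// -powR_mulrn ?powR_ge0// -powRrM.
rewrite -[x^-1]powR_inv1 ?(ltW x0)// -powRD; last by rewrite (gt_eqF x0) implybT.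
rewrite ler_powR// -subr_le0 (_ : _ - _ = (d%:R + 8 - 2 * D) / (2 * D)).
  by rewrite ler_pdivrMr ?mulr_gt0// mul0r subr_le0.
by field; rewrite gt_eqF.
Qed.

End rates.

Definition covering_constant {R : realType} (d : nat) : R := expR (d%:R / 4) * 5 ^+ d.

(** The 32 serves dimension one; 6 is [2 + 4] from the sample means of [f] and [g]; the rest comes
    from the row and column means. *)
Definition deviation_constant {R : realType} (d : nat) : R :=
  32 + 6 + 8 * (Num.sqrt (covering_constant d) + (1 + covering_constant d)).

Lemma emp_cost_mean_rate {dO} {Omega : measurableType dO} {R : realType} {d n : nat}
    (P : probability Omega R) (J : finType) (Z : J -> {RV P >-> d.-tuple R})
    (law : J -> probability (d.-tuple R) R) (n_gt0 : (0 < n)%N)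
    (a b : 'I_n -> J) (mu nu : probability (d.-tuple R) R) (B : set (d.-tuple R)) (D lambda : R) :
  (forall j, has_law (Z j) (law j)) -> mutually_independent Z ->
  injective a -> injective b ->
  (forall i, law (a i) = mu) -> (forall j, law (b j) = nu) ->
  measurable B -> (forall x y, B x -> B y -> euclid_dist x y ^+ 2 <= 1) ->
  mu B = 1%E -> nu B = 1%E -> (forall i j, a i != b j) \/ mu = nu ->
  (0 < d)%N ->
  D = (2 * (d %/ 2))%N%:R + 4 -> lambda = n%:R `^ (- (1 / D)) ->
  \int[P]_w `|emp_cost n_gt0 (trunc_cost 1) lambda (fun i => Z (a i) w)
                (fun j => Z (b j) w) -
              fine (cost_eot (trunc_cost 1) lambda mu nu)| <=
  deviation_constant d * n%:R `^ (- (2 / D)).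
Proof.
have arith (s v w r q c m : R) : r <= s -> m <= s -> v <= q * s -> w <= c * s ->
    2 * 1 * r + 2 * 2 * r + 8 * (v + (m + w)) <= (6 + 8 * (q + (1 + c))) * s.
  by lra.
move=> Zlaw Zind ainj binj lawa lawb mB B1 muB nuB disj d0 DE lE.
have x1 : 1 <= n%:R :> R by rewrite ler1n.
have D4 : 4 <= D by rewrite DE lerDr.
have l01 := lambda_rate x1 D4; rewrite -lE in l01.
have rs := rate_sqrt x1 D4; have ri := rate_inv x1 D4; have r1 := rate_le1 x1 D4.
have s0 : 0 <= n%:R `^ (- (2 / D)) by exact: powR_ge0.
have sq0 (t : R) : 0 <= t -> Num.sqrt (t ^+ 2 / n%:R) = t * Num.sqrt (n%:R^-1).
  by move=> t0; rewrite sqrtrM ?sqr_ge0// sqrtr_sqr ger0_norm.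
have C0 : 0 <= covering_constant d :> R by rewrite mulr_ge0 ?expR_ge0// exprn_ge0.
set s := n%:R `^ _ in rs ri r1 s0 *.
(* Here [D = 4] and [d + 8 = 9] exceeds [2 * D], so the covering bound is too weak and the grid
   argument replaces it. *)
have [d1|d1] := eqVneq d 1%N.
  subst d.
  apply: le_trans (emp_cost_mean_dev1 Zlaw Zind n_gt0 mB ainj binj lawa lawb l01 B1 muB nuB) _.
  rewrite sq0//; apply: (@le_trans _ _ (32 * s)); first by move: rs ri; lra.
  rewrite ler_wpM2r// /deviation_constant.
  have := sqrtr_ge0 (covering_constant 1 : R); move: C0; lra.
have dD : d%:R + 8 <= 2 * D.
  (* For [d >= 2] the quotient is at least 1, so twice the even part of [d] absorbs the remainder;
     this is [d <= 2 * d']. *)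
  have dd : (d <= 2 * (2 * (d %/ 2)))%N.
    have q0 : (0 < d %/ 2)%N by rewrite divn_gt0// ltn_neqAle eq_sym d1.
    have r2 : (d %% 2 < 2)%N by rewrite ltn_mod.
    rewrite {1}(divn_eq d 2) mul2n -addnn leq_add//; first by rewrite mulnC.
    by rewrite (leq_trans (ltnW r2))// leq_pmulr.
  by rewrite DE mulrDr -!natrM -!natrD ler_nat leq_add2r.
apply: le_trans (emp_cost_mean_dev Zlaw Zind n_gt0 ainj binj lawa lawb l01 mB B1 muB nuB disj) _.
have V1 := covering_rate x1 D4 dD; rewrite -lE -/s -/(covering_constant d) in V1.
have V0 : 0 <= @covering_bound R d lambda / n%:R.
  by rewrite divr_ge0// ler_covering_bound0.
have V2 : Num.sqrt (@covering_bound R d lambda / n%:R) <= Num.sqrt (covering_constant d) * s.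
  rewrite (le_trans (ler_wsqrtr V1))// sqrtrM// sqrtr_sqr ger0_norm//.
have V3 : @covering_bound R d lambda / n%:R <= covering_constant d * s.
  apply: le_trans V1 _; rewrite ler_wpM2l// expr2 ler_piMr//.
rewrite !sq0// [(1 + _) / n%:R]mulrDl mul1r /deviation_constant.
apply: le_trans (arith _ _ _ _ _ _ _ rs ri V2 V3) _.
by rewrite ler_wpM2r// lerD2r; lra.
Qed.

Lemma sinkhorn_div_trunc {R : realType} {d : nat} (mu nu : probability (d.-tuple R) R)
    (B : set (d.-tuple R)) (lambda : R) :
  measurable B -> (forall x y, B x -> B y -> euclid_dist x y ^+ 2 <= 1) ->
  mu B = 1%E -> nu B = 1%E -> 0 < lambda ->
  let T := fun mu nu => fine (cost_eot (@trunc_cost R d 1) lambda mu nu) in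
  sinkhorn_div lambda mu nu = (T mu nu - 2^-1 * (T mu mu + T nu nu))%:E.
Proof.
move=> mB B1 muB nuB l0 T; have bc := bmeas_trunc_cost (d := d) (@ler01 R).
have c1 (x y : d.-tuple R) : 0 <= trunc_cost 1 x y <= 1.
  by rewrite trunc_cost_ge0// trunc_cost_le.
have E := eot_trunc lambda (@ler01 R) mB.
rewrite /sinkhorn_div (E mu nu)// (E mu mu)// (E nu nu)//.
have F := cost_eot_fine bc c1 l0.
by rewrite -(F mu nu) -(F mu mu) -(F nu nu).
Qed.

(** The three costs have the same rate. In the self costs both index maps coincide, which is the
    second alternative of the disjointness hypothesis. The weights [1 + 1 / 2 + 1 / 2] give the
    factor 2. *)
Lemma trunc_sinkhorn_mean_rate {dO} {Omega : measurableType dO} {R : realType} {d n : nat}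
    (P : probability Omega R) (n_gt0 : (0 < n)%N) (mu nu : probability (d.-tuple R) R)
    (X Y : 'I_n -> {RV P >-> d.-tuple R}) (B : set (d.-tuple R)) (D lambda : R) :
  independent_samples mu nu X Y ->
  measurable B -> (forall x y, B x -> B y -> euclid_dist x y ^+ 2 <= 1) ->
  mu B = 1%E -> nu B = 1%E -> (0 < d)%N ->
  D = (2 * (d %/ 2))%N%:R + 4 -> lambda = n%:R `^ (- (1 / D)) ->
  \int[P]_w `|trunc_sinkhorn n_gt0 X Y lambda w - fine (sinkhorn_div lambda mu nu)| <=
  2 * deviation_constant d * n%:R `^ (- (2 / D)).
Proof.
have arith (a b c a' b' c' : R) :
    `|a - 2^-1 * (b + c) - (a' - 2^-1 * (b' + c'))| <=
    `|a - a'| + 2^-1 * (`|b - b'| + `|c - c'|).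
  rewrite (_ : _ - _ = (a - a') + 2^-1 * - ((b - b') + (c - c'))); last by ring.
  rewrite (le_trans (ler_normD _ _))// lerD2l normrM normrN ger0_norm ?invr_ge0//.
  by rewrite ler_wpM2l ?invr_ge0// ler_normD.
have arith2 (s e1 e2 e3 : R) : e1 <= s -> e2 <= s -> e3 <= s ->
    e1 + 2^-1 * (e2 + e3) <= 2 * s by lra.
move=> samples mB B1 muB nuB d0 DE lE.
have l0 : 0 < lambda by rewrite lE powR_gt0// ltr0n.
rewrite (sinkhorn_div_trunc mB B1 muB nuB l0)/=.
have bc := bmeas_trunc_cost (d := d) (@ler01 R).
have c1 (x y : d.-tuple R) : 0 <= trunc_cost 1 x y <= 1.
  by rewrite trunc_cost_ge0// trunc_cost_le.
have Zlaw := sample_of_law samples; have Zind := sample_of_independent samples.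
set Z := sample_of X Y in Zlaw Zind.
pose dev (a b : 'I_n -> 'I_n + 'I_n) (m1 m2 : probability (d.-tuple R) R)
    (w : Omega) : R :=
  `|emp_cost n_gt0 (trunc_cost 1) lambda (fun i => Z (a i) w) (fun j => Z (b j) w) -
    fine (cost_eot (trunc_cost 1) lambda m1 m2)|.
have bdev a b m1 m2 : bmeas (dev a b m1 m2).
  apply/bmeas_norm/bmeasB; last exact: bmeas_cst.
  split; last by exists 3 => w; exact: norm_emp_cost_le.
  exact: (measurable_emp_cost (X := fun i w => Z (a i) w) (Y := fun j w => Z (b j) w)
    n_gt0 bc c1).
have rate a b m1 m2 := @emp_cost_mean_rate _ _ _ _ _ P _ Z _ n_gt0 a b m1 m2 B D lambda Zlaw Zind.
have inl_i : injective (@inl 'I_n 'I_n) by move=> i j [].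
have inr_i : injective (@inr 'I_n 'I_n) by move=> i j [].
pose s : R := deviation_constant d * n%:R `^ (- (2 / D)).
have E1 : \int[P]_w dev inl inr mu nu w <= s.
  by apply: (rate inl inr mu nu) => //; left.
have E2 : \int[P]_w dev inl inl mu mu w <= s.
  by apply: (rate inl inl mu mu) => //; right.
have E3 : \int[P]_w dev inr inr nu nu w <= s.
  by apply: (rate inr inr nu nu) => //; right.
have b23 := bmeasD (bdev inl inl mu mu) (bdev inr inr nu nu).
have b23' := bmeasM (bmeas_cst (2^-1 : R)) b23.
apply: (@le_trans _ _ (\int[P]_w (dev inl inr mu nu w +
    2^-1 * (dev inl inl mu mu w + dev inr inr nu nu w)))).
  apply: ler_bRintegral.
  - by apply/bmeas_norm/bmeasB; [exact: bmeas_trunc_sinkhorn (ltW l0) | exact: bmeas_cst].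
  - exact: bmeasD.
  move=> w; rewrite /dev /trunc_sinkhorn /emp_sinkhorn /=.
  exact: arith.
rewrite bRintegralD// bRintegralZ// bRintegralD//.
by apply: le_trans (arith2 _ _ _ _ E1 E2 E3) _; rewrite /s mulrA.
Qed.

Theorem proposition4 (R : realType) (d : nat) (hd : (1 <= d)%N)
    (I : R) (hI : 0 < I) :
  let d' : R := (2 * (d %/ 2))%N%:R in
  exists C : R, forall mu nu : probability (d.-tuple R) R,
    (exists A : set (d.-tuple R),
      [/\ diameter A = 1%E, supported_on mu A & supported_on nu A]) ->
    (forall lambda : R, 0 <= lambda ->
      (`|sinkhorn_div lambda mu nu - wasserstein2_sq mu nu|
        <= (lambda ^+ 2 * I)%:E)%E) ->
    forall (n : nat) (hn : (0 < n)%N) (dO : measure_display)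
      (Omega : measurableType dO) (P : probability Omega R)
      (X Y : 'I_n -> {RV P >-> d.-tuple R}),
      independent_samples mu nu X Y ->
      let S := empirical_sinkhorn_div hn X Y in
      (\int[P]_w `|S (n%:R `^ (- (1 / (d' + 4))))%R w - wasserstein2_sq mu nu|
        <= (C * n%:R `^ (- (2 / (d' + 4))))%:E)%E
      /\
      (forall t lambda : R, 0 <= t -> 0 <= lambda ->
        (P [set w | t%:E <= `|S lambda w - \int[P]_v S lambda v|]
          <= (2 * expR (- (n%:R * t ^+ 2 / 4)))%:E)%E).
Proof.
(* The first summand is the bias, as [lambda ^+ 2] equals the target rate; the second is the
   fluctuation around the population divergence. *)
move=> d'; exists (I + 2 * deviation_constant d) => mu nu [A [dA muA nuA]] hS.
have [B [mB muB nuB B1]] := supported_diameter1 dA muA nuA.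
move=> n hn dO Omega P X Y samples S; split; last first.
  by move=> t lambda; exact: (sinkhorn_div_concentration hn samples mB B1 muB nuB).
pose D := d' + 4; pose lambda := n%:R `^ (- (1 / D)); pose s := n%:R `^ (- (2 / D)).
have x1 : 1 <= n%:R :> R by rewrite ler1n.
have D4 : 4 <= D by rewrite lerDr.
have /andP[l0 _] := lambda_rate x1 D4; rewrite -/lambda in l0.
have l2 : lambda ^+ 2 = s := lambda_rate_sqr n%:R D4.
have rate := trunc_sinkhorn_mean_rate hn samples mB B1 muB nuB hd (erefl D) (erefl lambda).
have SE := sinkhorn_div_trunc mB B1 muB nuB l0.
have := hS lambda (ltW l0); rewrite l2.
move: SE rate; case: (sinkhorn_div lambda mu nu) => [q|//|//] _ /=.
rewrite -/s => rate.
(* An infinite transport cost would make the bias infinite, against the assumed bound. *)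
case: (wasserstein2_sq mu nu) => [r|//|//]; rewrite -EFinB lee_fin => bias.
rewrite -/D -/lambda -/s.
have mabs : measurable_fun [set: R] (fun u : R => `|u - r|).
  by apply: measurableT_comp => //; exact: measurable_funB.
have bT := bmeas_trunc_sinkhorn hn X Y (ltW l0).
have I1 := @integral_sinkhorn_div _ _ _ _ _ _ hn _ _ _ _ samples _ mB B1 muB nuB
  (fun e => `|e - r%:E|%E) (fun u => `|u - r|) lambda (fun=> erefl) mabs (ltW l0).
rewrite [leLHS]I1 -[leLHS]Rintegral_EFin; last first.
  by apply/bmeas_norm/bmeasB; [exact: bT | exact: bmeas_cst].
rewrite lee_fin.
apply: (@le_trans _ _ (\int[P]_w (`|trunc_sinkhorn hn X Y lambda w - q| + `|q - r|))).
  apply: ler_bRintegral.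
  - by apply/bmeas_norm/bmeasB; [exact: bT | exact: bmeas_cst].
  - apply: bmeasD; last exact: bmeas_cst.
    by apply/bmeas_norm/bmeasB; [exact: bT | exact: bmeas_cst].
  by move=> w; exact: ler_distD.
rewrite bRintegralD; first last.
  exact: bmeas_cst.
  by apply/bmeas_norm/bmeasB; [exact: bT | exact: bmeas_cst].
rewrite bRintegral_cst mulrDl addrC lerD//.
by rewrite mulrC.
Qed.
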